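(* Let $\mathcal{E}$ be a nonempty set, $b:\mathcal{E}\to\mathbb{R}^d$ a bounded function, and $a=\sigma^a(\sigma^a)^T$ for some bounded $\sigma^a:\mathcal{E}\to\mathbb{R}^{d\times K}$. Let $T\ge0$. For any bounded viscosity subsolution $\varphi$ and bounded viscosity supersolution $\psi$ of $$\partial_t\varphi=\sup_{\xi\in\mathcal{E}}\left\{b(\xi)\cdot D\varphi+\mathrm{tr}\left(a(\xi)D^2\varphi\right)\right\}\quad\text{in }\mathbb{R}^d\times(0,\infty),$$ one has $$\int_{\mathbb{R}^d}\sup_{\overline{Q}_1(x)\times[0,T]}(\varphi^*-\psi_* )^+\,dx\le C\int_{\mathbb{R}^d}\sup_{\overline{Q}_1(x)}(\varphi^*-\psi_* )^+(\cdot,0)\,dx,$$ for some constant $C=C(d,\|a\|_\infty,\|b\|_\infty,T)\ge0$ depending only on $d,\|a\|_\infty,\|b\|_\infty,T$.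
   Context: Notation: $\mathbb{R}^+=[0,\infty)$; $\overline{Q}_1(x)=x+[-1,1]^d$; $D$, $D^2$ are the gradient and Hessian in $x$; $\mathrm{tr}$ is the trace; $K$ is a fixed positive integer; $r^+=\max\{r,0\}$. The suprema are pointwise. For locally bounded $\varphi$ on $\mathbb{R}^d\times\mathbb{R}^+$, $\varphi^*(x,t)=\limsup_{(y,s)\to(x,t)}\varphi(y,s)$ and $\varphi_*(x,t)=\liminf_{(y,s)\to(x,t)}\varphi(y,s)$, with $(y,s)\in\mathbb{R}^d\times\mathbb{R}^+$ (including at $t=0$). A locally bounded $\varphi:\mathbb{R}^d\times\mathbb{R}^+\to\mathbb{R}$ is a viscosity subsolution (resp. supersolution) of the equation if for every $\phi\in C^\infty(\mathbb{R}^d\times\mathbb{R}^+)$ and every local maximum $(x,t)\in\mathbb{R}^d\times(0,\infty)$ of $\varphi^*-\phi$ (resp. local minimum of $\varphi_*-\phi$), $\partial_t\phi(x,t)\le\sup_{\mathcal{E}}\{b\cdot D\phi(x,t)+\mathrm{tr}(aD^2\phi(x,t))\}$ (resp. $\ge$). *)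

(* Defs.v *)
From HB Require Import structures.
From mathcomp Require Import all_boot all_order all_algebra.
From mathcomp Require Import all_classical all_reals all_analysis.
Set Implicit Arguments.
Unset Strict Implicit.
Unset Printing Implicit Defensive.
Import Order.TTheory GRing.Theory Num.Theory.
Import numFieldNormedType.Exports.

Local Open Scope classical_set_scope.
Local Open Scope ring_scope.

Section lebesgue_tuple.
Context {R : realType}.
Local Open Scope ereal_scope.

(* [lebesgue_measure] lives on [measurableTypeR R], not on [R] itself. *)
Local Notation mR := (measurableTypeR R).

Definition cons_pair n (p : mR * n.-tuple mR) : n.+1.-tuple mR :=
  [the n.+1.-tuple mR of p.1 :: p.2].

(* Lebesgue measure on the Borel sets of R^n (the product sigma-algebra of
   n-tuples), as the n-fold product of the one-dimensional one. *)
Fixpoint lebesgue_tuple n : set (n.-tuple mR) -> \bar R :=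
  match n with
  | 0 => \d_[tuple]
  | n'.+1 => pushforward (lebesgue_measure \x @lebesgue_tuple n')
               (@cons_pair n')
  end.

Let uncons_pair n (t : n.+1.-tuple mR) : mR * n.-tuple mR :=
  (tnth t ord0, [tuple of behead t]).

Let cons_pairK n : cancel (@cons_pair n) (@uncons_pair n).
Proof.
by case=> x t; congr pair; exact: val_inj.
Qed.

Let uncons_pairK n : cancel (@uncons_pair n) (@cons_pair n).
Proof. by move=> t; rewrite [RHS]tuple_eta; exact: val_inj. Qed.

Let measurable_cons_pair n : measurable_fun setT (@cons_pair n).
Proof. exact: measurable_cons. Qed.

Let measurable_uncons_pair n : measurable_fun setT (@uncons_pair n).
Proof.
apply/measurable_fun_pairP; split; first exact: measurable_tnth.
exact: measurable_behead.
Qed.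

(* Reproved here: for two general sigma-finite factors the library's instance
   is not found by unification. *)
Let prod_sigma_finite d1 d2 (T1 : measurableType d1) (T2 : measurableType d2)
    (m1 : {sigma_finite_measure set T1 -> \bar R})
    (m2 : {sigma_finite_measure set T2 -> \bar R}) :
  sigma_finite setT (m1 \x m2).
Proof.
have /sigma_finiteP[F [TF ndF Foo]] := sigma_finiteT m1.
have /sigma_finiteP[G [TG ndG Goo]] := sigma_finiteT m2.
exists (fun n => F n `*` G n).
  rewrite -setXTT TF TG predeqE => -[x y]; split.
    move=> [/= [n _ Fnx] [k _ Gky]]; exists (maxn n k) => //; split.
    - by move: x Fnx; exact/subsetPset/ndF/leq_maxl.
    - by move: y Gky; exact/subsetPset/ndG/leq_maxr.
  by move=> [n _ []/= ? ?]; split; exists n.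
move=> k; have [? ?] := Foo k; have [? ?] := Goo k.
split; first exact: measurableX.
by rewrite product_measure1E// lte_mul_pinfty// ge0_fin_numE.
Qed.

Let lebesgue_tuple_subproof n :
  { m : {sigma_finite_measure set (n.-tuple mR) -> \bar R}
  | m = @lebesgue_tuple n :> (set (n.-tuple mR) -> \bar R) }.
Proof.
elim: n => [|n [m mE]] /=.
  pose d0 : {sigma_finite_measure set (0.-tuple mR) -> \bar R} := \d_[tuple].
  by exists d0.
pose l : {sigma_finite_measure set mR -> \bar R} := lebesgue_measure.
pose p : {measure set (mR * n.-tuple mR)%type -> \bar R} := l \x m.
have sfp : sigma_finite setT p by exact: (prod_sigma_finite l m).
pose pf : {measure set (n.+1.-tuple mR) -> \bar R} :=
  pushforward p (@cons_pair n).
pose q := pf (@measurable_cons_pair n).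
have sfq : sigma_finite setT q.
  have [F FT mF] := sfp; exists (fun i => @uncons_pair n @^-1` F i).
    by rewrite -preimage_bigcup -FT preimage_setT.
  move=> i; have [mFi Fioo] := mF i; split.
    by rewrite -[X in measurable X]setTI; exact: measurable_uncons_pair.
  rewrite /q /= /pushforward -comp_preimage (_ : _ \o _ = id) ?preimage_id//.
  by apply/funext => x /=; rewrite cons_pairK.
pose H := Measure_isSigmaFinite.Build _ _ _ q sfq.
pose q' : {sigma_finite_measure set (n.+1.-tuple mR) -> \bar R} :=
  HB.pack (Measure.sort q) (Measure.class q) H.
by exists q'; rewrite /= -mE.
Qed.

Let lebesgue_tuple0 n : @lebesgue_tuple n set0 = 0.
Proof. by have [m <-] := lebesgue_tuple_subproof n; exact: measure0. Qed.

Let lebesgue_tuple_ge0 n A : 0 <= @lebesgue_tuple n A.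
Proof. by have [m <-] := lebesgue_tuple_subproof n; exact: measure_ge0. Qed.

Let lebesgue_tuple_sigma_additive n : semi_sigma_additive (@lebesgue_tuple n).
Proof.
have [m <-] := lebesgue_tuple_subproof n.
exact: measure_semi_sigma_additive.
Qed.

HB.instance Definition _ n := isMeasure.Build _ _ _ (@lebesgue_tuple n)
  (lebesgue_tuple0 n) (@lebesgue_tuple_ge0 n)
  (@lebesgue_tuple_sigma_additive n).

Let lebesgue_tuple_sigma_finite n : sigma_finite setT (@lebesgue_tuple n).
Proof. by have [m <-] := lebesgue_tuple_subproof n; exact: sigma_finiteT. Qed.

HB.instance Definition _ n := Measure_isSigmaFinite.Build _ _ _
  (@lebesgue_tuple n) (@lebesgue_tuple_sigma_finite n).

Lemma lebesgue_tuple_box n (A : 'I_n -> set mR) :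
  (forall i, measurable (A i)) ->
  lebesgue_tuple [set t : n.-tuple mR | forall i, A i (tnth t i)] =
  \prod_(i < n) lebesgue_measure (A i).
Proof.
elim: n A => [|n IH] A mA.
  rewrite big_ord0 /= diracE mem_set//= => -[].
  by [].
rewrite big_ord_recl -IH//.
pose l : {sigma_finite_measure set mR -> \bar R} := lebesgue_measure.
rewrite -(@product_measure1E _ _ _ _ _ l (@lebesgue_tuple n))//; last first.
  rewrite (_ : mkset _ =
      \bigcap_(i in [set: 'I_n]) ((fun t => tnth t i) @^-1` A (lift ord0 i))).
    apply: fin_bigcap_measurable => // i _.
    by rewrite -[X in measurable X]setTI; exact: measurable_tnth.
  by apply/seteqP; split => t /= tA i => [_|]; exact: tA.
congr (product_measure1 _ _ _); apply/seteqP; split => -[x t] /=.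
  move=> xtA; split; first exact: (xtA ord0).
  by move=> i; have := xtA (lift ord0 i); rewrite /cons_pair tnthS.
case=> xA tA i; case: (unliftP ord0 i) => [j|] ->; last by [].
by rewrite /cons_pair tnthS; exact: tA.
Qed.

End lebesgue_tuple.

Section viscosity.
Context {R : realType} {d : nat}.
Local Notation point := ('rV[R]_d * R)%type.

Definition integral_Rd (f : 'rV[R]_d -> \bar R) : \bar R :=
  (\int[@lebesgue_tuple R d]_t f (\row_i tnth t i))%E.

(* R^d x [0, oo).  Functions on it are represented by total functions on
   R^d x R; their values at negative times are irrelevant. *)
Definition halfspace : set point := [set p | 0 <= p.2].

(* The point p itself is not removed, so [usc_env f p >= f p]. *)
Definition usc_env (f : point -> R) (p : point) : \bar R :=
  limf_esup (EFin \o f) (within halfspace (nbhs p)).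

Definition lsc_env (f : point -> R) (p : point) : \bar R :=
  limf_einf (EFin \o f) (within halfspace (nbhs p)).

Definition locally_bounded (f : point -> R) : Prop :=
  forall p, halfspace p -> bounded_near f (within halfspace (nbhs p)).

(* C^k on all of R^d x R, via all iterated directional derivatives.  A C^oo
   function on the closed half-space is the restriction of such a function. *)
Fixpoint continuously_differentiable (k : nat) (f : point -> R) : Prop :=
  match k with
  | 0 => continuous f
  | k'.+1 => (forall p v, derivable f p v) /\
             (forall v, continuously_differentiable k' ('D_v f))
  end.

Definition smooth (f : point -> R) : Prop :=
  forall k, continuously_differentiable k f.

Definition space_dir (i : 'I_d) : point := (delta_mx 0 i, 0).
Definition time_dir : point := (0, 1).

Definition dt (f : point -> R) (p : point) : R := 'D_time_dir f p.

Definition grad (f : point -> R) (p : point) : 'rV[R]_d :=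
  \row_i 'D_(space_dir i) f p.

Definition hess (f : point -> R) (p : point) : 'M[R]_d :=
  \matrix_(i, j) 'D_(space_dir i) ('D_(space_dir j) f) p.

Section equation.
Context {E : Type} (b : E -> 'rV[R]_d) (a : E -> 'M[R]_d).

Definition hamiltonian (g : 'rV[R]_d) (H : 'M[R]_d) : \bar R :=
  ereal_sup (range (fun xi : E =>
    (\sum_(i < d) b xi 0 i * g 0 i + \tr (a xi *m H))%:E)).

Definition viscosity_subsolution (f : point -> R) : Prop :=
  locally_bounded f /\
  forall phi : point -> R, smooth phi ->
  forall p : point, 0 < p.2 ->
    (\forall q \near within halfspace (nbhs p),
       (usc_env f q - (phi q)%:E <= usc_env f p - (phi p)%:E)%E) ->
    ((dt phi p)%:E <= hamiltonian (grad phi p) (hess phi p))%E.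

Definition viscosity_supersolution (f : point -> R) : Prop :=
  locally_bounded f /\
  forall phi : point -> R, smooth phi ->
  forall p : point, 0 < p.2 ->
    (\forall q \near within halfspace (nbhs p),
       (lsc_env f p - (phi p)%:E <= lsc_env f q - (phi q)%:E)%E) ->
    (hamiltonian (grad phi p) (hess phi p) <= (dt phi p)%:E)%E.

End equation.

Definition closed_unit_cube (x : 'rV[R]_d) : set 'rV[R]_d :=
  [set y | forall i, `|y 0 i - x 0 i| <= 1].

(* Envelopes of bounded functions are finite, so no oo - oo arises below. *)
Definition env_gap (f g : point -> R) (p : point) : \bar R :=
  maxe (usc_env f p - lsc_env g p)%E 0%E.

End viscosity.

(* On vectors and matrices [`|_|] is the largest absolute value of an entry. *)
Definition sup_norm {R : realType} {E : Type} {V : normedModType R}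
    (f : E -> V) : R := sup (range (fun xi => `|f xi|)).

(* Main.v *)
(* Fix a control [xi].  The function [- psi_*] is a viscosity subsolution of the linear
   equation with coefficients [b xi, a xi], so its sup-convolution, which is Lipschitz,
   is dominated by its averages along a random walk approximating the diffusion.
   Domination by averages of translates survives mollification, so the mollified
   sup-convolution is a classical subsolution of all the linear equations at once.
   Subtracting it from a supersolution [S] gives a smooth perturbation of [S], and
   [phi^* - psi_* <= S] becomes a comparison of [phi^*] with functions having second-order
   jets: no Crandall-Ishii theorem on sums is needed.

   As [S] one takes the sum over unit cells, with corners [y_j], of
   [m_j exp (d + kappa t - |x - y_j|_1)], where [m_j] is the supremum of the gap at time 0
   over the cell, plus a small multiple of [\sum_k exp (kappa t +- x_k)] to control
   infinity.  Summing the supremum of [S] over all cells costs a factor bounded by [5^d]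
   by the exponential decay, while [\sum_j m_j] is at most the right-hand integral. *)

Require Import Defs.
From mathcomp Require Import all_boot all_order all_algebra.
From mathcomp Require Import all_classical all_reals all_analysis.
From mathcomp Require Import ring lra measurable_realfun.
Set Implicit Arguments. Unset Strict Implicit. Unset Printing Implicit Defensive.
Import Order.TTheory GRing.Theory Num.Theory.
Import numFieldNormedType.Exports.

Local Open Scope classical_set_scope.
Local Open Scope ring_scope.

(** * Averages of continuous functions over an interval, by way of primitives *)

Section Primitive.
Context {R : realType}.
Implicit Types (h g : R -> R).
Let mu := @lebesgue_measure R.

(** The two inequalities play different roles: $\sup_\xi\le\partial_t\psi$ splits into one linear
    inequality per control, while the inequality for [phi] must be kept whole. The coefficients are
    constant in $(x,t)$, so translates of subsolutions are subsolutions.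

    The obstacle is that touching by test functions is not a linear condition, hence cannot be
    averaged. The statement that $w(\cdot+(0,s))$ lies below an average of spatial translates of
    [w], up to a small error, is linear in [w] and free of derivatives. It is obtained by comparing
    [w] over a short time with an explicit expansion $g+s\,k$, where [k] is the generator applied to
    a smooth [g]. The error of this expansion involves the generator of [k], whence the four orders
    of regularity asked of mollified functions.

    A step of duration $\omega^2$ costs $C\omega^3$, so $n$ steps with $n\omega^2=s$ cost
    $Cs\omega$, which vanishes provided that [C] does not deteriorate. Averages of translates do
    preserve Lipschitz constants of all derivatives; this is why smoothness is measured by explicit
    remainder bounds with one constant. *)

Lemma primitive_exists h : continuous h ->
  exists H : R -> R, forall x, is_derive x (1:R) H (h x).
Proof.
move=> ch.
have ih a b : mu.-integrable `[a, b] (EFin \o h).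
  apply: continuous_compact_integrable; first exact: segment_compact.
  exact: continuous_subspaceT.
pose G a x := \int[mu]_(t in `[a, x]) h t.
have GB a' a x : a' <= a -> a <= x -> a <= 0 ->
    G a' x - G a' 0 = G a x - G a 0.
  move=> a'a ax a0.
  have chasles y : a <= y -> G a' y = G a' a + G a y.
    move=> ay; apply/eqP; rewrite addrC -subr_eq.
    have := @Rintegral_itvB R h (BLeft a') (BRight y) a (ih _ _).
    rewrite !bnd_simp => /(_ a'a ay) ->.
    rewrite Rintegral_itv_obnd_cbnd//.
    by apply: integrableS (ih a y) => //; exact: subset_itv_oc_cc.
  by rewrite chasles// (chasles 0)// opprD addrACA subrr add0r.
(* The base point moves with [x] so that both [x] and 0 lie to its right. Subtracting the value at 0
   removes the dependence on the base point ([GB]), so near a given point one fixed base point [a]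
   serves. *)
exists (fun x => G (- (`|x| + 1)) x - G (- (`|x| + 1)) 0) => x.
pose a := - (`|x| + 2).
have ax : a + 1 < x.
  by have := ler_norm (- x); rewrite normrN /a; lra.
have a0 : a <= 0 by rewrite /a; have := normr_ge0 x; lra.
apply: (@near_eq_is_derive _ _ _ (fun y => G a y - G a 0)).
  near=> y.
  have ay : a <= y.
    by apply: ltW; near: y; apply: lt_nbhsr; lra.
  have := GB (Num.min a (- (`|y| + 1))) a y.
  have := GB (Num.min a (- (`|y| + 1))) (- (`|y| + 1)) y.
  have h1 : - (`|y| + 1) <= y by have := ler_norm (- y); rewrite normrN; lra.
  have h2 : - (`|y| + 1) <= 0 by have := normr_ge0 y; lra.
  rewrite ge_min lexx orbT ge_min lexx/= => -> // -> //.
have [dG GE] := @continuous_FTC1_closed _ h a x (x + 1) (ltac:(lra)) (ih _ _)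
  (ltac:(lra)) (ch x).
rewrite -[h x]subr0.
apply: is_deriveB.
by rewrite -GE derive1E; exact: derivableP.
Unshelve. all: by end_near. Qed.

Definition primitive h : R -> R :=
  xget (fun=> 0) [set H : R -> R | forall x, is_derive x (1 : R) H (h x)].

Lemma primitiveP h x : continuous h -> is_derive x (1 : R) (primitive h) (h x).
Proof.
by move=> /primitive_exists[H dH]; have := @xgetPex _ (fun=> 0)
  [set H : R -> R | forall x, is_derive x (1 : R) H (h x)] (ex_intro _ H dH); apply.
Qed.

Lemma mvt_primitive h H (a b : R) : (forall x, is_derive x (1 : R) H (h x)) ->
  a <= b -> exists2 c, a <= c <= b & H b - H a = h c * (b - a).
Proof.
move=> dH ab; have [] := @MVT_segment R H h a b ab.
- apply: continuous_subspaceT => x.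
  by apply: differentiable_continuous; apply/derivable1_diffP; case: (dH x).
- by move=> c; rewrite in_itv/= => ? ->; exists c.
Qed.

(** The average over $[0,r]$. Written with a primitive, its linearity follows from uniqueness of
    primitives and its monotonicity from the mean value theorem. *)
Definition mean (r : R) h : R := (primitive h r - primitive h 0) / r.

Lemma meanE (r : R) h H : continuous h ->
  (forall x, is_derive x (1 : R) H (h x)) -> mean r h = (H r - H 0) / r.
Proof.
move=> ch dH; rewrite /mean; congr (_ / _).
pose D x := primitive h x - H x.
have : D r = D 0.
  apply: is_derive_0_is_cst => x; rewrite -(subrr (h x)).
  by apply: is_deriveB => //; exact: primitiveP.
by rewrite /D; lra.
Qed.

Lemma mean_comb (r a b : R) h g : continuous h -> continuous g ->
  mean r (fun x => a * h x + b * g x) = a * mean r h + b * mean r g.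
Proof.
move=> ch cg.
have C : continuous (fun x => a * h x + b * g x).
  by move=> x; apply: cvgD; apply: cvgM; [exact: cvg_cst|exact: ch|exact: cvg_cst|exact: cg].
have D (x : R) : is_derive x (1 : R)
    (fun x => a * primitive h x + b * primitive g x) (a * h x + b * g x).
  by apply: is_deriveD; apply: is_deriveZ; exact: primitiveP.
by rewrite (meanE r C D) /mean; ring.
Qed.

Lemma mean_cst (r c : R) : r != 0 -> mean r (fun=> c) = c.
Proof.
move=> r0; have C : continuous (fun _ : R => c) by move=> x; exact: cvg_cst.
have D (x : R) : is_derive x (1 : R) (fun x : R => c * x) c.
  by rewrite -[X in is_derive _ _ _ X]mulr1; apply: is_deriveZ.
by rewrite (meanE r C D) mulr0 subr0 mulfK.
Qed.

Lemma mean_le (r : R) h g : 0 < r -> continuous h -> continuous g ->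
  (forall x, 0 <= x <= r -> h x <= g x) -> mean r h <= mean r g.
Proof.
move=> r0 ch cg hg; rewrite -subr_ge0.
have -> : mean r g - mean r h = mean r (fun x => 1 * g x + (-1) * h x).
  by rewrite mean_comb//; ring.
set f := (fun x => _).
have cf : continuous f.
  by move=> x; apply: cvgD; apply: cvgM; [exact: cvg_cst|exact: cg|exact: cvg_cst|exact: ch].
have [c c0r] := mvt_primitive (fun x => primitiveP x cf) (ltW r0).
rewrite /mean subr0 => ->; rewrite mulfK ?gt_eqF//.
by rewrite /f mul1r mulN1r subr_ge0 hg.
Qed.

(** Averaging gains a derivative: with [H] a primitive of [h], the shift changes [r] times the
    average by $(H(r+s)-H(r))-(H(s)-H(0))$, and each increment of [H] is linear in [s] up to
    $ks^2$. *)
Lemma mean_shift (r k s : R) h : 0 < r -> continuous h ->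
  (forall x y, `|h x - h y| <= k * `|x - y|) ->
  `|mean r (fun x => h (x + s)) - mean r h - s * ((h r - h 0) / r)|
     <= 2 * k / r * s ^+ 2.
Proof.
move=> r0 ch hk.
have cs : continuous (fun x => h (x + s)).
  move=> x; apply: (@continuous_comp _ _ _ (fun y : R => y + s) h); last exact: ch.
  by apply: cvgD; [exact: cvg_id|exact: cvg_cst].
have dH x := primitiveP x ch.
set H := primitive h in dH.
have D (x : R) : is_derive x (1 : R) (fun x => H (x + s)) (h (x + s)).
  have := @is_derive1_comp R H (fun y => y + s) x _ _ (dH (x + s)).
  move=> /(_ 1); rewrite mulr1; apply.
  by rewrite -[X in is_derive _ _ _ X]addr0; apply: is_deriveD.
rewrite (meanE r cs D).
have key a : `|H (a + s) - H a - s * h a| <= k * s ^+ 2.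
  have [c ca ->] : exists2 c, `|c - a| <= `|s| & H (a + s) - H a = s * h c.
    have [s0|s0] := leP 0 s.
      have [|c ca e] := @mvt_primitive h H a (a + s) dH; first by lra.
      exists c; first by rewrite (ger0_norm s0) ger0_norm; lra.
      by rewrite e; ring.
    have [|c ca e] := @mvt_primitive h H (a + s) a dH; first by lra.
    exists c; first by rewrite (ltr0_norm s0) ler0_norm; lra.
    by rewrite -[LHS]opprB e; ring.
  rewrite -mulrBr normrM expr2.
  have k0 : 0 <= k.
    by have := hk 1 0; rewrite subr0 normr1 mulr1; apply: le_trans.
  have -> : k * (s * s) = `|s| * (k * `|s|).
    by have := real_normK (num_real s); rewrite !expr2 => <-; ring.
  rewrite ler_wpM2l//; apply: le_trans (hk c a) _.
  by rewrite ler_wpM2l.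
set X := (X in `|X|).
have -> : X = ((H (r + s) - H r - s * h r) - (H (0 + s) - H 0 - s * h 0)) / r.
  by rewrite /X /mean -/H; field; rewrite gt_eqF.
rewrite normrM [`|r^-1|]ger0_norm ?invr_ge0 ?(ltW r0)//.
rewrite [leRHS]mulrAC ler_pM2r ?invr_gt0//.
by apply: le_trans (ler_normB _ _) _; have := key r; have := key 0; lra.
Qed.

End Primitive.

(** * Entrywise bounds for the matrix norm *)

Section MatrixNorm.
Context {R : realType}.

Lemma mx_coord_le m n (A : 'M[R]_(m, n)) i j : `|A i j| <= `|A|.
Proof.
by rewrite [leRHS]/Num.Def.normr/= mx_normrE (le_bigmax _ (fun ij => `|A ij.1 ij.2|) (i, j)).
Qed.

Lemma mx_norm_le m n (A : 'M[R]_(m, n)) (e : R) : 0 <= e ->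
  (forall i j, `|A i j| <= e) -> `|A| <= e.
Proof.
move=> e0 h; rewrite [`|A|]/Num.Def.normr/= mx_normrE.
by apply/bigmax_leP; split => // -[i j] _; exact: h.
Qed.

End MatrixNorm.

(** * Quantitative differentiability, and mollification by averages along the axes *)

Section Mollification.
Context {R : realType} {d : nat}.
Local Notation V := ('rV[R]_d * R)%type.
Local Notation I := (option 'I_d).
Implicit Types (f g : V -> R) (p z c : V) (i : I) (l : seq I).

(* Space-time axes are indexed by [option 'I_d]; [None] is the time axis. *)
Definition axis i : V := if i is Some j then (delta_mx 0 j, 0) else (0, 1).
Definition co z i : R := if i is Some j then z.1 0 j else z.2.

Lemma co_le z i : `|co z i| <= `|z|.
Proof.
case: i => [j|] /=; rewrite prod_normE le_max ?lexx ?orbT//.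
by rewrite mx_coord_le.
Qed.

Lemma norm_le_co z (e : R) : 0 <= e -> (forall i, `|co z i| <= e) -> `|z| <= e.
Proof.
move=> e0 h; rewrite prod_normE ge_max (h None) andbT.
by apply: mx_norm_le => // i j; rewrite ord1; exact: (h (Some j)).
Qed.

Lemma axis_le i : `|axis i| <= 1.
Proof.
apply: norm_le_co => // j; case: i j => [i|] [j|] /=; rewrite ?mxE ?normr0 ?normr1//.
by rewrite eqxx /=; case: eqP; rewrite ?normr0 ?normr1.
Qed.

Lemma coD z z' i : co (z + z') i = co z i + co z' i.
Proof. by case: i => [j|] //=; rewrite mxE. Qed.

Lemma coN z i : co (- z) i = - co z i.
Proof. by case: i => [j|] //=; rewrite mxE. Qed.

Lemma coZ a z i : co (a *: z) i = a * co z i.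
Proof. by case: i => [j|] //=; rewrite mxE. Qed.

Lemma co0 i : co 0 i = 0.
Proof. by case: i => [j|] //=; rewrite mxE. Qed.

Lemma co_axis i j : co (axis i) j = (i == j)%:R.
Proof.
by case: i j => [i|] [j|] //=; rewrite mxE ?eqxx//= eq_sym.
Qed.

Lemma co_sum (J : Type) (s : seq J) (F : J -> V) i :
  co (\sum_(j <- s) F j) i = \sum_(j <- s) co (F j) i.
Proof. by elim/big_rec2: _ => [|j y x _ <-]; rewrite ?co0// coD. Qed.

Lemma co_inj z z' : (forall i, co z i = co z' i) -> z = z'.
Proof.
case: z z' => [x t] [x' t'] h; congr pair; last exact: (h None).
by apply/rowP => j; exact: (h (Some j)).
Qed.

Lemma co_decomp z : z = \sum_i co z i *: axis i.
Proof.
apply: co_inj => j; rewrite co_sum (bigD1 j)//= coZ co_axis eqxx mulr1 big1 ?addr0//.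
by move=> i ij; rewrite coZ co_axis (negbTE ij) mulr0.
Qed.

Lemma sum_co_le z : \sum_i `|co z i| <= d.+1%:R * `|z|.
Proof.
apply: le_trans (ler_sum _ (fun i _ => co_le z i)) _.
by rewrite sumr_const card_option card_ord mulr_natl.
Qed.

Definition lip (k : R) f := forall p z, `|f (p + z) - f p| <= k * `|z|.

(* Partial derivatives up to order [m] exist and, like [f], are [L]-Lipschitz. *)
Fixpoint lip_jets (m : nat) (L : R) f : Prop :=
  lip L f /\ if m is m'.+1 then
    exists D : I -> V -> R, (forall i, lip_jets m' L (D i)) /\
      forall p z, `|f (p + z) - f p - \sum_i co z i * D i p| <= L * `|z| ^+ 2
  else True.

Lemma lip_jets_lip m L f : lip_jets m L f -> lip L f.
Proof. by case: m => [|m] []. Qed.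

Lemma lip_ge0 L f : lip L f -> 0 <= L.
Proof.
move=> /(_ 0 (0, 1)); rewrite prod_normE/= normr0 normr1 max_r// mulr1.
exact: le_trans.
Qed.

Lemma lip_jets_le m L L' f : L <= L' -> lip_jets m L f -> lip_jets m L' f.
Proof.
move=> LL'; elim: m f => [|m IH] f /=.
  move=> [lf _]; split=> // p z; apply: le_trans (lf p z) _; exact: ler_wpM2r.
move=> [lf [D [CD hD]]]; split.
  by move=> p z; apply: le_trans (lf p z) _; exact: ler_wpM2r.
exists D; split => [i|p z]; first exact: IH.
by apply: le_trans (hD p z) _; rewrite ler_wpM2r// exprn_ge0.
Qed.

Lemma lip_jets_pred m L f : lip_jets m.+1 L f -> lip_jets m L f.
Proof.
elim: m f => [|m IH] f; first by case.
move=> [lf [D [CD hD]]]; split => //; exists D; split => // i; exact: IH.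
Qed.

Lemma lip_jets_shift m L f c : lip_jets m L f -> lip_jets m L (fun p => f (p + c)).
Proof.
have ls g : lip L g -> lip L (fun p => g (p + c)).
  by move=> lg p z; rewrite addrAC; exact: lg.
elim: m f => [|m IH] f; first by case=> lf _; split => //; exact: ls.
move=> [lf [D [CD hD]]]; split; first exact: ls.
exists (fun i p => D i (p + c)); split => [i|p z]; first exact: (IH (D i) (CD i)).
by rewrite (addrAC p z c); exact: hD.
Qed.

Lemma norm_comb_le (J : finType) (w h : J -> R) (b : R) : (forall j, `|h j| <= b) ->
  `|\sum_j w j * h j| <= (\sum_j `|w j|) * b.
Proof.
move=> hb; apply: le_trans (ler_norm_sum _ _ _) _.
rewrite mulr_suml; apply: ler_sum => j _; rewrite normrM; exact: ler_wpM2l.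
Qed.

(** For an average the factor $\sum_j|w_j|$ is 1, so arbitrarily many steps of a random walk keep
    the constant [L]. *)
Lemma lip_jets_comb (J : finType) (w : J -> R) (F : J -> V -> R) m L :
  (forall j, lip_jets m L (F j)) ->
  lip_jets m ((\sum_j `|w j|) * L) (fun p => \sum_j w j * F j p).
Proof.
have ls (G : J -> V -> R) : (forall j, lip L (G j)) ->
    lip ((\sum_j `|w j|) * L) (fun p => \sum_j w j * G j p).
  move=> lG p z; rewrite -sumrB -mulrA.
  under eq_bigr => j _ do rewrite -mulrBr.
  by apply: norm_comb_le => j; exact: lG.
elim: m F => [|m IH] F CF.
  by split => //; apply: ls => j; exact: lip_jets_lip (CF j).
split; first by apply: ls => j; exact: lip_jets_lip (CF j).
have /choice[D hD] : forall j, exists D : I -> V -> R, (forall i, lip_jets m L (D i)) /\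
      forall p z, `|F j (p + z) - F j p - \sum_i co z i * D i p| <= L * `|z| ^+ 2.
  by move=> j; case: (CF j).
exists (fun i p => \sum_j w j * D j i p); split => [i|p z].
  by apply: IH => j; case: (hD j).
rewrite -mulrA.
under [X in _ - X]eq_bigr => i _ do rewrite mulr_sumr.
rewrite exchange_big -!sumrB.
rewrite (eq_bigr (fun j => w j *
    (F j (p + z) - F j p - \sum_i co z i * D j i p))).
  by apply: norm_comb_le => j; case: (hD j).
move=> j _; rewrite 2!mulrBr mulr_sumr; congr (_ - _).
by apply: eq_bigr => i _; rewrite mulrCA.
Qed.

Lemma lip_line L f p z : lip L f ->
  forall x y : R, `|f (p + x *: z) - f (p + y *: z)| <= L * `|z| * `|x - y|.
Proof.
move=> lf x y; have := lf (p + y *: z) ((x - y) *: z).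
by rewrite -addrA -scalerDl [y + _]addrC subrK normrZ mulrA mulrAC.
Qed.

Lemma lip_line_cont L f p z : lip L f -> continuous (fun s : R => f (p + s *: z)).
Proof.
move=> lf x.
have L0 := lip_ge0 lf.
have kp : 0 < L * `|z| + 1 by rewrite ltr_pwDr// mulr_ge0.
apply/cvgrPdist_le => e e0; near=> y.
apply: le_trans (lip_line _ _ lf x y) _.
apply: (@le_trans _ _ ((L * `|z| + 1) * `|x - y|)).
  by rewrite ler_wpM2r// lerDl.
rewrite mulrC -ler_pdivlMr//.
near: y; apply/nbhs_ballP; exists (e / (L * `|z| + 1)); first by rewrite /= divr_gt0.
by move=> y /ltW.
Unshelve. all: by end_near. Qed.

Lemma sum_option (M : nmodType) (J : finType) (G : option J -> M) :
  \sum_j G j = G None + \sum_j G (Some j).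
Proof.
rewrite (bigD1 None)//=; congr (_ + _); rewrite (reindex_omap Some id)/=; last by case.
by apply: eq_bigl => j; rewrite eqxx.
Qed.

Lemma cont_comb (J : Type) (s : seq J) (w : J -> R) (h : J -> R -> R) :
  (forall j, continuous (h j)) -> continuous (fun x => \sum_(j <- s) w j * h j x).
Proof.
move=> ch; elim: s => [|j s IH] x.
  by rewrite (_ : (fun x => _) = (fun=> 0)); [exact: cvg_cst|
    apply/funext => y; rewrite big_nil].
rewrite (_ : (fun x => _) = (fun y => w j * h j y + \sum_(i <- s) w i * h i y)).
  apply: cvgD; last exact: IH.
  by apply: cvgM; [exact: cvg_cst|exact: ch].
by apply/funext => y; rewrite big_cons.
Qed.

Lemma mean_sum (J : Type) (s : seq J) (w : J -> R) (h : J -> R -> R) (r : R) : r != 0 ->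
  (forall j, continuous (h j)) ->
  mean r (fun x => \sum_(j <- s) w j * h j x) = \sum_(j <- s) w j * mean r (h j).
Proof.
move=> r0 ch; elim: s => [|j s IH].
  rewrite big_nil -[RHS](mean_cst 0 r0); congr mean.
  by apply/funext => x; rewrite big_nil.
rewrite big_cons -IH -[X in _ = _ + X]mul1r -mean_comb//; last exact: cont_comb.
by congr mean; apply/funext => x; rewrite big_cons mul1r.
Qed.

Lemma mean_norm_le (r b : R) (h : R -> R) : 0 < r -> continuous h ->
  (forall x, 0 <= x <= r -> `|h x| <= b) -> `|mean r h| <= b.
Proof.
move=> r0 ch hb; rewrite ler_norml.
have cc (a : R) : continuous (fun _ : R => a) by move=> x; exact: cvg_cst.
rewrite -[- b](@mean_cst _ r) ?gt_eqF// -[X in _ && (_ <= X)](@mean_cst _ r b) ?gt_eqF//.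
by apply/andP; split; apply: mean_le => // x xr; have := hb x xr; rewrite ler_norml => /andP[].
Qed.

Definition axis_mean (r : R) i f p := mean r (fun s => f (p + s *: axis i)).

Lemma axis_mean_shift r i f c p : axis_mean r i (fun q => f (q + c)) p = axis_mean r i f (p + c).
Proof. by congr mean; apply/funext => s; rewrite addrAC. Qed.

Lemma axis_mean_comb (J : finType) (w : J -> R) (F : J -> V -> R) L r i p : 0 < r ->
  (forall j, lip L (F j)) ->
  axis_mean r i (fun q => \sum_j w j * F j q) p = \sum_j w j * axis_mean r i (F j) p.
Proof.
move=> r0 lF; apply: (mean_sum _ _ (h := fun j s => F j (p + s *: axis i))).
  by rewrite gt_eqF.
by move=> j; exact: lip_line_cont (lF j).
Qed.

Lemma axis_mean_lip r i L f : 0 < r -> lip L f -> lip L (axis_mean r i f).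
Proof.
move=> r0 lf p z.
rewrite -axis_mean_shift /axis_mean.
have cz : continuous (fun s : R => f (p + s *: axis i + z)).
  rewrite (_ : (fun s => _) = (fun s => f (p + z + s *: axis i))).
    exact: lip_line_cont lf.
  by apply/funext => s; rewrite addrAC.
have cp : continuous (fun s : R => f (p + s *: axis i)) by exact: lip_line_cont lf.
have -> : mean r (fun s => f (p + s *: axis i + z)) - mean r (fun s => f (p + s *: axis i))
   = mean r (fun s => 1 * f (p + s *: axis i + z) + (-1) * f (p + s *: axis i)).
  by rewrite mean_comb//; ring.
apply: mean_norm_le => //.
  by move=> x; apply: cvgD; apply: cvgM; [exact: cvg_cst|exact: cz|exact: cvg_cst|exact: cp].
by move=> x _; rewrite mul1r mulN1r; exact: lf.
Qed.

Lemma axis_mean_lip_jets r i m L f : 0 < r -> lip_jets m L f -> lip_jets m L (axis_mean r i f).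
Proof.
move=> r0; elim: m f => [|m IH] f; first by case=> lf _; split => //; exact: axis_mean_lip.
move=> [lf [D [CD hD]]]; split; first exact: axis_mean_lip.
exists (fun j => axis_mean r i (D j)); split => [j|p z]; first exact: (IH _ (CD j)).
(* The terms of the Taylor remainder are listed as one finite linear combination, so that [mean_sum]
   applies to all of them at once. *)
pose W (j : option (option I)) : R :=
  if j is Some j then (if j is Some j then - co z j else - 1) else 1.
pose H (j : option (option I)) (s : R) : R :=
  if j is Some j then
    (if j is Some j then D j (p + s *: axis i) else f (p + s *: axis i))
  else f (p + z + s *: axis i).
have cH j : continuous (H j).
  by case: j => [[j|]|]; [exact: lip_line_cont (lip_jets_lip (CD j))|exact: lip_line_cont lf..].
have sumE (G : option (option I) -> R) :
    \sum_j G j = G None + (G (Some None) + \sum_j G (Some (Some j))).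
  by rewrite !sum_option.
have -> : axis_mean r i f (p + z) - axis_mean r i f p - \sum_j co z j * axis_mean r i (D j) p =
    mean r (fun s => \sum_j W j * H j s).
  rewrite mean_sum ?gt_eqF// sumE /= mul1r mulN1r -addrA.
  by congr (_ + (_ + _)); rewrite -sumrN; apply: eq_bigr => j _; rewrite mulNr.
apply: mean_norm_le => //; first exact: cont_comb.
move=> s _; rewrite sumE /= mul1r mulN1r.
under eq_bigr => j _ do rewrite mulNr.
by rewrite sumrN addrA addrAC (addrAC p z) addrAC; exact: hD.
Qed.

Lemma axis_mean_near r i L f p : 0 < r -> lip L f -> `|axis_mean r i f p - f p| <= L * r.
Proof.
move=> r0 lf.
have cp : continuous (fun s : R => f (p + s *: axis i)) by exact: lip_line_cont lf.
have cc (a : R) : continuous (fun _ : R => a) by move=> x; exact: cvg_cst.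
have -> : axis_mean r i f p - f p = mean r (fun s => 1 * f (p + s *: axis i) + (-1) * f p).
  by rewrite (mean_comb r 1 (-1) cp (cc _)) mean_cst ?gt_eqF// mul1r mulN1r.
apply: mean_norm_le => //.
  by move=> x; apply: cvgD; apply: cvgM; [exact: cvg_cst|exact: cp|exact: cvg_cst|exact: cvg_cst].
move=> s /andP[s0 sr]; rewrite mul1r mulN1r; apply: le_trans (lf _ _) _.
rewrite ler_wpM2l ?(lip_ge0 lf)// normrZ ger0_norm//.
by apply: le_trans (ler_wpM2l s0 (axis_le i)) _; rewrite mulr1.
Qed.

Lemma axis_mean_le r i L L' f g p e : 0 < r -> lip L f -> lip L' g ->
  (forall s, 0 <= s -> f (p + s *: axis i) <= g (p + s *: axis i) + e) ->
  axis_mean r i f p <= axis_mean r i g p + e.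
Proof.
move=> r0 lf lg fg.
have cc (a : R) : continuous (fun _ : R => a) by move=> x; exact: cvg_cst.
have cg := lip_line_cont (p := p) (z := axis i) lg.
have -> : axis_mean r i g p + e = mean r (fun s => 1 * g (p + s *: axis i) + 1 * e).
  by rewrite (mean_comb r 1 1 cg (cc _)) mean_cst ?gt_eqF// !mul1r.
apply: mean_le => //; first exact: lip_line_cont lf.
  by move=> x; apply: cvgD; apply: cvgM; [exact: cvg_cst|exact: cg|exact: cvg_cst|exact: cvg_cst].
by move=> s /andP[s0 _]; rewrite !mul1r; exact: fg.
Qed.

(** This is the exact derivative of [axis_mean r i f] along the axis [i], so it inherits the
    regularity of [f] itself. *)
Definition diff_quotient (r : R) i f p := (f (p + r *: axis i) - f p) / r.

Lemma axis_mean_deriv r i L f p s : 0 < r -> lip L f ->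
  `|axis_mean r i f (p + s *: axis i) - axis_mean r i f p -
    s * diff_quotient r i f p| <= 2 * L / r * s ^+ 2.
Proof.
move=> r0 lf; have L0 := lip_ge0 lf.
have -> : axis_mean r i f (p + s *: axis i) = mean r (fun x => f (p + (x + s) *: axis i)).
  by rewrite /axis_mean; congr mean; apply/funext => x; rewrite scalerDl addrA addrAC.
have := @mean_shift _ r L s (fun s => f (p + s *: axis i)) r0.
rewrite scale0r addr0; apply; first exact: lip_line_cont lf.
move=> x y; apply: le_trans (lip_line p (axis i) lf x y) _.
by rewrite ler_wpM2r// ler_piMr// axis_le.
Qed.

Lemma diff_quotient_lip_jets r i m L f : 0 < r -> lip_jets m L f ->
  lip_jets m (2 / r * L) (diff_quotient r i f).
Proof.
move=> r0 Cf.
have -> : diff_quotient r i f = (fun p => \sum_(j : bool) (if j then r^-1 else - r^-1) *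
    (if j then f (p + r *: axis i) else f p)).
  by apply/funext => p; rewrite big_bool /= /diff_quotient; ring.
have -> : 2 / r = \sum_(j : bool) `|if j then r^-1 else - r^-1|.
  by rewrite big_bool /= normrN ger0_norm ?invr_ge0 ?(ltW r0)//; ring.
apply: (@lip_jets_comb _ _ (fun j p => if j then f (p + r *: axis i) else f p)) => -[] //.
exact: lip_jets_shift.
Qed.

Lemma le_inv_succ (a b c : R) : (forall n : nat, a <= b + c * n.+1%:R^-1) -> a <= b.
Proof.
move=> h; apply/ler_addgt0Pr => e e0.
have [n hn] : exists n : nat, c / e < n.+1%:R.
  by exists (Num.truncn (c / e)); exact: truncnS_gt.
apply: le_trans (h n) _; rewrite lerD2l ler_pdivrMr ?ltr0n// mulrC.
by rewrite -ler_pdivrMr// ltW.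
Qed.

Definition mollify (r : R) l f := foldr (axis_mean r) f l.

Lemma mollify_lip_jets r l m L f : 0 < r -> lip_jets m L f -> lip_jets m L (mollify r l f).
Proof. by move=> r0 Cf; elim: l => //= i l; exact: axis_mean_lip_jets. Qed.

Lemma mollify_lip r l L f : 0 < r -> lip L f -> lip L (mollify r l f).
Proof. by move=> r0 Cf; elim: l => //= i l; exact: axis_mean_lip. Qed.

Lemma mollify_near r l L f p : 0 < r -> lip L f ->
  `|mollify r l f p - f p| <= (size l)%:R * L * r.
Proof.
move=> r0 lf; elim: l p => [|i l IH] p /=.
  by rewrite subrr normr0 !mul0r.
have h1 := axis_mean_near i p r0 (mollify_lip l r0 lf).
rewrite -(subrK (mollify r l f p) (axis_mean _ _ _ _)) -addrA.
apply: le_trans (ler_normD _ _) _; have := IH p.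
by rewrite -[(size l).+1]addn1 natrD !mulrDl !mul1r; lra.
Qed.

Lemma mollify_comb r l (J : finType) (w : J -> R) (c : J -> V) L f : 0 < r -> lip L f ->
  mollify r l (fun p => \sum_j w j * f (p + c j)) =
  (fun p => \sum_j w j * mollify r l f (p + c j)).
Proof.
move=> r0 lf; elim: l => //= i l ->; apply/funext => p.
have lm := mollify_lip l r0 lf.
rewrite (@axis_mean_comb _ w (fun j q => mollify r l f (q + c j)) L)//.
  by apply: eq_bigr => j _; rewrite axis_mean_shift.
by move=> j q z; rewrite addrAC; exact: lm.
Qed.

Lemma mollify_shift r l c f : mollify r l (fun p => f (p + c)) = (fun p => mollify r l f (p + c)).
Proof. by elim: l => //= i l ->; apply/funext => p; rewrite axis_mean_shift. Qed.

(** The averages run over $[0,r]$ and thus look only forward in time; hence an inequality known only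
    from time [t] on survives. *)
Lemma mollify_le r l L L' f g e (t : R) : 0 < r -> lip L f -> lip L' g ->
  (forall p, t <= p.2 -> f p <= g p + e) ->
  forall p, t <= p.2 -> mollify r l f p <= mollify r l g p + e.
Proof.
move=> r0 lf lg fg; elim: l => //= i l IH p tp.
apply: axis_mean_le r0 (mollify_lip l r0 lf) (mollify_lip l r0 lg) _ => s s0.
apply: IH; rewrite /= (le_trans tp)// lerDl.
by case: i => [j|] /=; rewrite ?scaler0// /GRing.scale/= mulr1.
Qed.

(** An averaging along [i] supplies the partial derivative as a difference quotient, and the
    averagings applied after it merely average this derivative. *)
Lemma mollify_partial r l m L f i : 0 < r -> lip_jets m L f -> i \in l ->
  exists G : V -> R, lip_jets m ((2 / r + 1) * L) G /\
    forall p s, `|mollify r l f (p + s *: axis i) - mollify r l f p - s * G p|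
                  <= (2 / r + 1) * L * s ^+ 2.
Proof.
move=> r0 Cf; have L0 := lip_ge0 (lip_jets_lip Cf).
have le1 : 2 / r * L <= (2 / r + 1) * L by rewrite ler_wpM2r// lerDl.
elim: l => //= j l IH; rewrite inE => /orP[/eqP <-|/IH[G [CG hG]]].
  have lm := lip_jets_lip (mollify_lip_jets l r0 Cf).
  exists (diff_quotient r i (mollify r l f)); split.
    by apply: lip_jets_le le1 _; apply: diff_quotient_lip_jets => //; exact: mollify_lip_jets.
  move=> p s; apply: le_trans (axis_mean_deriv i p s r0 lm) _.
  by rewrite ler_wpM2r ?sqr_ge0// mulrAC.
exists (axis_mean r j G); split; first exact: axis_mean_lip_jets.
move=> p s; set F := mollify r l f in hG *.
have lF : lip L F by exact: lip_jets_lip (mollify_lip_jets l r0 Cf).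
have lG := lip_jets_lip CG.
pose w (k : 'I_3) : R := [:: 1; -1; - s]`_k.
pose H (k : 'I_3) (q : V) : R := if k == 0 :> nat then F (q + s *: axis i)
  else if k == 1 :> nat then F q else G q.
have cH k : continuous (fun x : R => H k (p + x *: axis j)).
  rewrite /H; case: k => -[|[|k]] ? /=.
  - have := lip_line_cont (p := p + s *: axis i) (z := axis j) lF.
    rewrite (_ : (fun s0 : R => _) = (fun x : R => F (p + x *: axis j + s *: axis i)))//.
    by apply/funext => x; rewrite addrAC.
  - exact: lip_line_cont lF.
  - exact: lip_line_cont lG.
have -> : axis_mean r j F (p + s *: axis i) - axis_mean r j F p - s * axis_mean r j G p =
    mean r (fun x => \sum_k w k * H k (p + x *: axis j)).
  rewrite (mean_sum _ _ (h := fun k x => H k (p + x *: axis j))) ?gt_eqF//.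
  rewrite !big_ord_recl big_ord0 /w /H /= -axis_mean_shift /axis_mean; ring.
apply: mean_norm_le => //; first by apply: (cont_comb (h := fun k x => H k (p + x *: axis j))).
move=> x _; rewrite !big_ord_recl big_ord0 /w /H /=.
rewrite mul1r mulN1r mulNr addr0 addrA; exact: hG.
Qed.

(** Moving one coordinate at a time keeps the remainder below $L(\sum_i|z_i|)^2$; then
    $\sum_i|z_i|\le(d+1)|z|$ gives the factor $(d+1)^2$. *)
Lemma lip_jets_of_partials m L f : lip L f ->
  (forall i, exists G : V -> R, lip_jets m L G /\
    forall p s, `|f (p + s *: axis i) - f p - s * G p| <= L * s ^+ 2) ->
  lip_jets m.+1 (d.+1%:R ^+ 2 * L) f.
Proof.
move=> lf /choice[G hG]; have L0 := lip_ge0 lf.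
have le1 : L <= d.+1%:R ^+ 2 * L.
  by rewrite ler_peMl// expr2 -natrM ler1n muln_gt0.
split; first by move=> p z; apply: le_trans (lf p z) _; exact: ler_wpM2r.
exists G; split; first by move=> i; apply: lip_jets_le le1 _; case: (hG i).
move=> p z.
have key (s : seq I) : `|f (p + \sum_(i <- s) co z i *: axis i) - f p -
    \sum_(i <- s) co z i * G i p| <= L * (\sum_(i <- s) `|co z i|) ^+ 2 /\
    `|\sum_(i <- s) co z i *: axis i| <= \sum_(i <- s) `|co z i|.
  elim: s => [|j s [IH IHn]].
    by rewrite !big_nil addr0 subrr subr0 !normr0 expr0n/= mulr0.
  rewrite !big_cons; set y := \sum_(_ <- _) _ in IH IHn *.
  set S := \sum_(i <- s) `|_| in IH IHn *; set a := co z j.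
  split; last first.
    apply: le_trans (ler_normD _ _) _; rewrite lerD// normrZ.
    by rewrite ler_piMr// axis_le.
  set B := (\sum_(i <- s) _) in IH *.
  have h1 := (hG j).2 (p + y) a.
  have h2 := lip_jets_lip (hG j).1 p y.
  have h3 : `|a * (G j (p + y) - G j p)| <= L * (`|a| * S).
    rewrite normrM mulrCA ler_wpM2l//; apply: le_trans h2 _.
    by rewrite ler_wpM2l.
  rewrite (addrC _ y) addrA; set X := (X in `|X|).
  have -> : X = (f (p + y + a *: axis j) - f (p + y) - a * G j (p + y)) +
     (a * (G j (p + y) - G j p)) + (f (p + y) - f p - B) by rewrite /X; ring.
  apply: le_trans (ler_normD _ _) _.
  apply: le_trans (lerD (ler_normD _ _) (lexx _)) _.
  have -> : L * (`|a| + S) ^+ 2 =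
    L * a ^+ 2 + L * (`|a| * S) + L * S ^+ 2 + L * (`|a| * S).
    by rewrite -[a ^+ 2]real_normK ?num_real//; ring.
  apply: le_trans (lerD (lerD h1 h3) IH) _; rewrite lerDl mulr_ge0// mulr_ge0//.
  by apply: le_trans IHn.
have [h _] := key (index_enum _); rewrite -co_decomp in h.
apply: le_trans h _; rewrite -mulrA [leRHS]mulrCA ler_wpM2l// -exprMn.
by rewrite ler_sqr ?nnegrE ?sum_co_le ?mulr_ge0// sumr_ge0.
Qed.

Lemma lip_le L L' f : L <= L' -> lip L f -> lip L' f.
Proof. by move=> LL' lf p z; apply: le_trans (lf p z) _; exact: ler_wpM2r. Qed.

Lemma mollify_smooth r m L f : 0 < r -> lip_jets m L f ->
  lip_jets m.+1 (d.+1%:R ^+ 2 * ((2 / r + 1) * L)) (mollify r (enum {: I}) f).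
Proof.
move=> r0 Cf; have L0 := lip_ge0 (lip_jets_lip Cf).
apply: lip_jets_of_partials.
  apply: lip_le (mollify_lip _ r0 (lip_jets_lip Cf)); rewrite ler_peMl// lerDr.
  by rewrite divr_ge0// ltW.
by move=> i; apply: mollify_partial => //; rewrite mem_enum.
Qed.

(* Each averaging over all the axes gains one order of differentiability. *)
Definition mollify_axes (n : nat) : seq I := flatten (nseq n (enum {: I})).

Lemma mollify_smooth_iter r n L f : 0 < r -> lip L f ->
  exists L', lip_jets n L' (mollify r (mollify_axes n) f).
Proof.
move=> r0 lf; elim: n => [|n [L' CL']]; first by exists L.
exists (d.+1%:R ^+ 2 * ((2 / r + 1) * L')).
by rewrite /mollify_axes /mollify /= foldr_cat; exact: mollify_smooth.
Qed.

(** The segment is cut into $n+1$ pieces of relative length $h$. Over each piece the remainder [ph]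
    changes by at most $hb+h^2c$, where [b] is the asserted bound, and the total $b+c/(n+1)$ tends
    to [b]. *)
Lemma taylor2 L f (D : I -> V -> R) (D2 : I -> I -> V -> R) p z :
  (forall p z, `|f (p + z) - f p - \sum_i co z i * D i p| <= L * `|z| ^+ 2) ->
  (forall i p z, `|D i (p + z) - D i p - \sum_j co z j * D2 i j p| <= L * `|z| ^+ 2) ->
  `|f (p + z) - f p - \sum_i co z i * D i p -
    2^-1 * \sum_i co z i * \sum_j co z j * D2 i j p| <= d.+1%:R * L * `|z| ^+ 3.
Proof.
move=> h1 h2.
have L0 : 0 <= L.
  have := h1 0 (0, 1); rewrite prod_normE/= normr0 normr1 max_r// expr1n mulr1.
  exact: le_trans.
set ell := \sum_i co z i * D i p; set Q := \sum_i co z i * \sum_j _.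
pose ph (s : R) := f (p + s *: z) - f p - s * ell - 2^-1 * s ^+ 2 * Q.
pose b := d.+1%:R * L * `|z| ^+ 3.
pose c := L * `|z| ^+ 2 + 2^-1 * `|Q|.
have step s h : 0 <= s <= 1 -> 0 <= h -> `|ph (s + h) - ph s| <= h * b + h ^+ 2 * c.
  move=> /andP[s0 s1] h0; set X := (X in `|X|).
  have -> : X = (f (p + s *: z + h *: z) - f (p + s *: z) -
        \sum_i co (h *: z) i * D i (p + s *: z)) +
      h * (\sum_i co z i * (D i (p + s *: z) - D i p -
             \sum_j co (s *: z) j * D2 i j p)) - 2^-1 * h ^+ 2 * Q.
    have -> : \sum_i co z i * (D i (p + s *: z) - D i p -
             \sum_j co (s *: z) j * D2 i j p) =
             \sum_i co z i * D i (p + s *: z) - ell - s * Q.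
      rewrite /ell /Q mulr_sumr -!sumrB; apply: eq_bigr => i _.
      rewrite 2!mulrBr; congr (_ - _); rewrite [RHS]mulrCA; congr (_ * _).
      by rewrite mulr_sumr; apply: eq_bigr => j _; rewrite coZ mulrA.
    have -> : \sum_i co (h *: z) i * D i (p + s *: z) =
              h * \sum_i co z i * D i (p + s *: z).
      by rewrite mulr_sumr; apply: eq_bigr => i _; rewrite coZ mulrA.
    by rewrite /X /ph scalerDl addrA; field.
  apply: le_trans (ler_normB _ _) _.
  apply: le_trans (lerD (ler_normD _ _) (lexx _)) _.
  have n1 := h1 (p + s *: z) (h *: z).
  rewrite normrZ (ger0_norm h0) exprMn in n1.
  have n2 : `|h * (\sum_i co z i * (D i (p + s *: z) - D i p -
             \sum_j co (s *: z) j * D2 i j p))| <= h * b.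
    rewrite normrM (ger0_norm h0) ler_wpM2l//.
    apply: le_trans (norm_comb_le (b := L * `|z| ^+ 2) _ _) _.
      move=> i; apply: le_trans (h2 i p (s *: z)) _.
      rewrite ler_wpM2l// normrZ ger0_norm// ler_sqr ?nnegrE ?mulr_ge0//.
      by rewrite ler_piMl.
    apply: le_trans (ler_wpM2r _ (sum_co_le z)) _; first by rewrite mulr_ge0// exprn_ge0.
    by rewrite /b le_eqVlt; apply/orP; left; apply/eqP; ring.
  have n3 : `|2^-1 * h ^+ 2 * Q| = h ^+ 2 * (2^-1 * `|Q|).
    by rewrite normrM ger0_norm ?mulr_ge0 ?sqr_ge0 ?invr_ge0//; ring.
  by rewrite n3 /c mulrDr; move: n1 n2; lra.
have -> : f (p + z) - f p - ell - 2^-1 * Q = ph 1 - ph 0.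
  by rewrite /ph scale1r scale0r addr0; ring.
apply: (@le_inv_succ _ _ c) => n.
pose h : R := n.+1%:R^-1.
have h0 : 0 <= h by rewrite invr_ge0.
have hn : n.+1%:R * h = 1 by rewrite mulfV// pnatr_eq0.
have tel k : (k <= n.+1)%N -> `|ph (k%:R * h) - ph 0| <= k%:R * (h * b + h ^+ 2 * c).
  elim: k => [_|k IH kn]; first by rewrite !mul0r subrr normr0.
  have := IH (ltnW kn).
  have := step (k%:R * h) h; rewrite mulr_ge0//= => /(_ _ h0) => st.
  have kh : k%:R * h <= n.+1%:R * h by rewrite ler_wpM2r// ler_nat ltnW.
  rewrite hn in kh; have {kh}st := st kh.
  rewrite -[k.+1%:R]natr1 !mulrDl !mul1r => IHk.
  rewrite -(subrK (ph (k%:R * h)) (ph _)) -addrA.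
  by apply: le_trans (ler_normD _ _) _; rewrite [leRHS]addrC; exact: lerD.
have := tel n.+1 (leqnn _); rewrite hn.
have -> : n.+1%:R * (h * b + h ^+ 2 * c) = (n.+1%:R * h) * b + (n.+1%:R * h) * (c * h).
  by ring.
by rewrite hn !mul1r.
Qed.
End Mollification.

(** * Quadratic test functions, superjets, and comparison of subsolutions with functions having
    superjets *)

Section Jets.
Context {R : realType} {d : nat}.
Local Notation V := ('rV[R]_d * R)%type.
Local Notation I := (option 'I_d).
Implicit Types (f g u G : V -> R) (p q z : V) (i j : I) (l : I -> R) (B : I -> I -> R).

(** The quadratic polynomials centred at [p]. The family is closed under directional derivatives, so
    smoothness follows by induction on the order. *)
Definition jet_poly p (c : R) l B q :=
  c + \sum_i co (q - p) i * (l i + \sum_j B i j * co (q - p) j).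

Lemma cont_sum (T : topologicalType) (J : Type) (s : seq J) (h : J -> T -> R) :
  (forall a, continuous (h a)) -> continuous (fun x => \sum_(a <- s) h a x).
Proof.
move=> ch; elim: s => [|a s IH] x.
  by rewrite (_ : (fun x => _) = (fun=> 0)); [exact: cvg_cst|
    apply/funext => y; rewrite big_nil].
rewrite (_ : (fun x => _) = (fun y => h a y + \sum_(a <- s) h a y)).
  by apply: cvgD; [exact: ch|exact: IH].
by apply/funext => y; rewrite big_cons.
Qed.

Lemma near_norm_le (W : normedModType R) (x : W) (e : R) : 0 < e ->
  \forall y \near x, `|y - x| <= e.
Proof.
move=> e0; apply: filterS (@nbhsx_ballx _ _ x e e0) => y.
by rewrite -ball_normE /= distrC => /ltW.
Qed.

Lemma lip_continuous L f : lip L f -> continuous f.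
Proof.
move=> lf p; have L0 := lip_ge0 lf.
have kp : 0 < L + 1 by rewrite ltr_pwDr.
apply/cvgrPdist_le => e e0; near=> q.
rewrite distrC; have := lf p (q - p); rewrite (addrC p) subrK => /le_trans; apply.
apply: (@le_trans _ _ ((L + 1) * `|q - p|)); first by rewrite ler_wpM2r// lerDl.
rewrite mulrC -ler_pdivlMr//.
by near: q; exact: (near_norm_le (p : V) (divr_gt0 e0 kp)).
Unshelve. all: by end_near. Qed.

Lemma co_lip p i : lip 1 (fun q => co (q - p) i).
Proof.
move=> q z; rewrite (addrAC q z) (coD (q - p) z) mul1r [X in `|X - _|]addrC addrK; exact: co_le.
Qed.

Lemma jet_poly_continuous p c l B : continuous (jet_poly p c l B).
Proof.
have cc i : continuous (fun q => co (q - p) i) by apply: lip_continuous (co_lip _ _).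
move=> q; apply: cvgD; first exact: cvg_cst.
apply: cont_sum => i {}q; apply: cvgM; first exact: cc.
apply: cvgD; first exact: cvg_cst.
apply: cont_sum => j {}q; apply: cvgM; first exact: cvg_cst.
exact: cc.
Qed.

Lemma is_derive_quadratic f p z (a b : R) :
  (forall h : R, f (h *: z + p) = f p + h * a + h ^+ 2 * b) -> is_derive p z f a.
Proof.
move=> fE.
have F : h^-1 *: (f (h *: z + p) - f p) @[h --> 0^'] --> a.
  have : (a + h * b) @[h --> 0^'] --> a.
    rewrite -[X in _ --> X]addr0 -[X in _ --> _ + X](mul0r b).
    apply: cvgD; first exact: cvg_cst.
    apply: cvgM; last exact: cvg_cst.
    exact: nbhs_dnbhs.
  apply: cvg_trans; apply: near_eq_cvg; near=> h.
  have h0 : h != 0 by near: h; exact: nbhs_dnbhs_neq.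
  by rewrite fE /GRing.scale/=; field.
apply: DeriveDef; first by apply/cvg_ex; exists a.
exact: cvg_lim F.
Unshelve. all: by end_near. Qed.

Definition jet_poly_slope l B (v : V) i := \sum_j (B i j + B j i) * co v j.

Lemma is_derive_jet_poly p c l B q v :
  is_derive q v (jet_poly p c l B)
    (jet_poly p (\sum_i co v i * l i) (jet_poly_slope l B v) (fun _ _ => 0) q).
Proof.
apply: (@is_derive_quadratic _ _ _ _ (\sum_i co v i * \sum_j B i j * co v j)) => h.
rewrite /jet_poly (_ : h *: v + q - p = (q - p) + h *: v); last first.
  by rewrite (addrC (h *: v)) addrAC.
set z := q - p.
have -> : \sum_i co (z + h *: v) i * (l i + \sum_j B i j * co (z + h *: v) j) =
  \sum_i co z i * (l i + \sum_j B i j * co z j) +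
  h * (\sum_i co v i * l i) +
  h * (\sum_i co v i * \sum_j B i j * co z j + \sum_i co z i * \sum_j B i j * co v j) +
  h ^+ 2 * (\sum_i co v i * \sum_j B i j * co v j).
  rewrite mulrDr !mulr_sumr -!big_split/=; apply: eq_bigr => i _.
  have -> : \sum_j B i j * co (z + h *: v) j =
            \sum_j B i j * co z j + h * \sum_j B i j * co v j.
    rewrite mulr_sumr -big_split/=; apply: eq_bigr => j _.
    by rewrite coD coZ; ring.
  by rewrite coD coZ; ring.
have -> : \sum_i co z i * (jet_poly_slope l B v i + \sum_j 0 * co z j) =
  \sum_i co v i * \sum_j B i j * co z j + \sum_i co z i * \sum_j B i j * co v j.
  under eq_bigr => i _.
    rewrite (eq_bigr (fun=> 0)) => [|j _]; last by rewrite mul0r.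
    rewrite big1// addr0 mulr_sumr.
    over.
  rewrite (eq_bigr (fun i => \sum_j co z i * (B i j * co v j) +
     \sum_j co z i * (B j i * co v j))); last first.
    by move=> i _; rewrite -big_split; apply: eq_bigr => j _ /=; ring.
  rewrite big_split/= addrC; congr (_ + _).
    rewrite exchange_big; apply: eq_bigr => i _; rewrite mulr_sumr.
    by apply: eq_bigr => j _; ring.
  by apply: eq_bigr => i _; rewrite mulr_sumr.
by ring.
Qed.

Lemma derive_jet_poly p c l B v : 'D_v (jet_poly p c l B) =
  jet_poly p (\sum_i co v i * l i) (jet_poly_slope l B v) (fun _ _ => 0).
Proof. by apply/funext => q; case: (is_derive_jet_poly p c l B q v). Qed.

Lemma derive_jet_polyE p c l B v q : 'D_v (jet_poly p c l B) q =
  jet_poly p (\sum_i co v i * l i) (jet_poly_slope l B v) (fun _ _ => 0) q.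
Proof. by case: (is_derive_jet_poly p c l B q v). Qed.

Lemma jet_poly_smooth p c l B : smooth (jet_poly p c l B).
Proof.
move=> k; elim: k c l B => [|k IH] c l B /=; first exact: jet_poly_continuous.
split => [q v|v]; first by case: (is_derive_jet_poly p c l B q v).
by rewrite derive_jet_poly.
Qed.

Lemma jet_poly0 p c l B : jet_poly p c l B p = c.
Proof. by rewrite /jet_poly subrr big1 ?addr0// => i _; rewrite co0 mul0r. Qed.

Lemma dt_jet_poly p c l B : dt (jet_poly p c l B) p = l None.
Proof.
rewrite /dt derive_jet_polyE jet_poly0 (bigD1 None)//= mul1r big1 ?addr0// => -[i|]//= _.
by rewrite mxE mul0r.
Qed.

Lemma sum_co_dir (j : 'I_d) (F : I -> R) :
  \sum_i co (space_dir j : V) i * F i = F (Some j).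
Proof.
rewrite (bigD1 (Some j))//= mxE !eqxx mul1r big1 ?addr0// => -[i|] ij /=.
  rewrite mxE eqxx/= (_ : i == j = false) ?mul0r//.
  by apply/negbTE; apply: contraNN ij => /eqP ->.
by rewrite mul0r.
Qed.

Lemma grad_jet_poly p c l B (i : 'I_d) : grad (jet_poly p c l B) p 0 i = l (Some i).
Proof. by rewrite mxE derive_jet_polyE jet_poly0 sum_co_dir. Qed.

Lemma hess_jet_poly p c l B (i j : 'I_d) :
  hess (jet_poly p c l B) p i j = B (Some i) (Some j) + B (Some j) (Some i).
Proof.
rewrite mxE derive_jet_poly derive_jet_polyE jet_poly0 sum_co_dir /jet_poly_slope.
under eq_bigr => k _ do rewrite mulrC.
by rewrite sum_co_dir addrC.
Qed.

Lemma jet_polyD p c l B c' l' B' q : jet_poly p c l B q + jet_poly p c' l' B' q =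
  jet_poly p (c + c') (fun i => l i + l' i) (fun i j => B i j + B' i j) q.
Proof.
rewrite /jet_poly addrACA -big_split/=; congr (_ + _); apply: eq_bigr => i _.
rewrite -mulrDr addrACA -big_split/=; congr (_ * (_ + _)); apply: eq_bigr => j _.
by rewrite mulrDl.
Qed.

Definition diag_form (e L : R) i j : R := if i == j then (if i is Some _ then e else L) else 0.

Lemma jet_poly_diag p e L q : jet_poly p 0 (fun=> 0) (diag_form e L) q =
  e * \sum_(i < d) (co (q - p) (Some i)) ^+ 2 + L * (q - p).2 ^+ 2.
Proof.
have dE i : \sum_j diag_form e L i j * co (q - p) j = diag_form e L i i * co (q - p) i.
  rewrite (bigD1 i)//= big1 ?addr0// => j ij.
  by rewrite /diag_form eq_sym (negbTE ij) mul0r.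
rewrite /jet_poly add0r sum_option add0r dE addrC mulr_sumr.
congr (_ + _); last by rewrite /diag_form eqxx /=; ring.
by apply: eq_bigr => i _; rewrite add0r dE /diag_form eqxx; ring.
Qed.

(* A superjet: the extra [diag_form e L] allows an arbitrarily small error in the
   second-order spatial terms and an arbitrary constant in front of the square of
   the time variable. *)
Definition upjet G p l B := forall e, 0 < e -> exists L : R,
  \forall q \near p, G q <= jet_poly p (G p) l (fun i j => B i j + diag_form e L i j) q.

(* The quadratic part of [jet_poly] carries no factor 1/2 and [B] need not be
   symmetric, so that its Hessian is [B + B^T]. *)
Definition ham (b : 'rV[R]_d) (a : 'M[R]_d) l B : R :=
  \sum_k b 0 k * l (Some k) +
  \sum_k \sum_m a k m * (B (Some m) (Some k) + B (Some k) (Some m)).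

(** Quantifying over the upper bounds [c] says that [l None] is at most the supremum over the
    controls without forming it. With [unit] as the control set this is the linear equation. *)
Definition jet_subsolution (E : Type) (b : E -> 'rV[R]_d) (a : E -> 'M[R]_d) (t0 : R) u :=
  forall p, t0 < p.2 -> forall l B, (\forall q \near p, u q <= jet_poly p (u p) l B q) ->
  forall c, (forall xi, ham (b xi) (a xi) l B <= c) -> l None <= c.

Lemma near_time (t0 : R) p : t0 < p.2 -> \forall q \near p, t0 < q.2.
Proof.
move=> tp.
have e0 : 0 < (p.2 - t0) / 2 by rewrite divr_gt0// subr_gt0.
apply: filterS (near_norm_le p e0) => q qp.
have := le_trans (co_le (q - p) None) qp; rewrite /= ler_norml => /andP[]; lra.
Qed.

Lemma cont_near f p (e : R) : continuous f -> 0 < e ->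
  \forall q \near p, `|f p - f q| <= e.
Proof. by move=> cf e0; have /cvgrPdist_le/(_ e e0) := cf p. Qed.

Lemma usc_max (F : V -> R) (t0 rho : R) p0 : t0 <= p0.2 ->
  (forall p, t0 <= p.2 -> forall e, 0 < e ->
     \forall q \near p, t0 <= q.2 -> F q <= F p + e) ->
  (forall q, t0 <= q.2 -> rho < `|q - p0| -> F q <= F p0) ->
  exists2 p, t0 <= p.2 & forall q, t0 <= q.2 -> F q <= F p.
Proof.
move=> tp0 uF Fco.
pose r := Num.max rho 0.
have r0 : 0 <= r by rewrite le_max lexx orbT.
pose K : set V := [set x | `|x - p0.1| <= r] `*` `[Num.max t0 (p0.2 - r), p0.2 + r].
have KP q : K q <-> (t0 <= q.2 /\ `|q - p0| <= r).
  rewrite /K /= prod_normE ge_max in_itv/= ge_max ler_norml.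
  split=> [[-> /andP[/andP[? ?] ?]]|[? /andP[-> /andP[? ?]]]]; split => //.
    by apply/andP; split; lra.
  by apply/andP; split; [apply/andP; split => //|]; lra.
have cK : compact K.
  apply: compact_setX; last exact: segment_compact.
  apply: bounded_closed_compact.
    exists (`|p0.1| + r); split; first exact: num_real.
    move=> M Mr x /= xr; apply/ltW; apply: le_lt_trans Mr.
    by rewrite -(subrK p0.1 x) addrC (le_trans (ler_normD _ _))// lerD2l.
  have := @closed_closed_ball_ R 'rV[R]_d p0.1 r.
  rewrite (_ : closed_ball_ _ _ _ = [set x | `|x - p0.1| <= r])//.
  by apply/seteqP; split => x; rewrite /closed_ball_/= distrC.
have Kp0 : K p0 by apply/KP; rewrite subrr normr0.
pose G := filter_from K (fun p => [set q | K q /\ F p <= F q]).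
have FG : ProperFilter G.
  apply: filter_from_proper; last by move=> p Kp; exists p.
  apply: filter_from_filter; first by exists p0.
  move=> p q Kp Kq; exists (if F p <= F q then q else p).
    by case: ifP.
  move=> x /= [Kx]; case: ifP => [pq qx|/negbT]; first by split; split => //; apply: le_trans qx.
  by rewrite -ltNge => /ltW qp px; split; split => //; apply: le_trans px.
have GK : G K by exists p0 => // q [].
have [p [Kp clp]] := cK G FG GK.
have [tp _] := (KP p).1 Kp.
have maxp q : K q -> F q <= F p.
  move=> Kq; rewrite leNgt; apply/negP => pq.
  have e0 : 0 < (F q - F p) / 2 by rewrite divr_gt0// subr_gt0.
  have GV : G [set x | K x /\ F q <= F x] by exists q.
  have [x [/= [Kx qx] /(_ ((KP x).1 Kx).1)]] := clp _ _ GV (uF p tp _ e0).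
  by move: qx pq; lra.
exists p => // q tq; have [qr|qr] := leP `|q - p0| r; first by apply/maxp/KP.
apply: le_trans (maxp _ Kp0); apply: Fco => //; apply: le_lt_trans qr.
by rewrite le_max lexx.
Qed.

(** The Euclidean square serves as penalty because, unlike the square of the maximum norm, it is a
    quadratic polynomial. *)
Definition sqnorm z := \sum_i co z i ^+ 2.

Lemma sqnorm_ge0 z : 0 <= sqnorm z.
Proof. by apply: sumr_ge0 => i _; exact: sqr_ge0. Qed.

Lemma co_sq_le z i : co z i ^+ 2 <= sqnorm z.
Proof. by rewrite /sqnorm (bigD1 i)//= lerDl sumr_ge0// => j _; exact: sqr_ge0. Qed.

Lemma norm_sq_le z : `|z| ^+ 2 <= sqnorm z.
Proof.
rewrite -[leRHS]sqr_sqrtr ?sqnorm_ge0// ler_sqr ?nnegrE ?sqrtr_ge0//.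
apply: norm_le_co; first exact: sqrtr_ge0.
by move=> i; rewrite -sqrtr_sqr ler_wsqrtr// co_sq_le.
Qed.

Lemma sqnorm_jet_poly p p0 q : sqnorm (q - p0) =
  jet_poly p (sqnorm (p - p0)) (fun i => 2 * co (p - p0) i) (diag_form 1 1) q.
Proof.
have -> : q - p0 = (q - p) + (p - p0) by rewrite addrA subrK.
have -> : jet_poly p (sqnorm (p - p0)) (fun i => 2 * co (p - p0) i) (diag_form 1 1) q =
  jet_poly p (sqnorm (p - p0)) (fun i => 2 * co (p - p0) i) (fun _ _ => 0) q +
  jet_poly p 0 (fun=> 0) (diag_form 1 1) q.
  rewrite jet_polyD addr0; congr jet_poly; first by apply/funext => i; rewrite addr0.
  by apply/funext => i; apply/funext => j; rewrite add0r.
rewrite jet_poly_diag !mul1r /jet_poly /sqnorm.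
have -> : \sum_(i < d) co (q - p) (Some i) ^+ 2 + (q - p).2 ^+ 2 = \sum_i co (q - p) i ^+ 2.
  by rewrite sum_option addrC.
rewrite -!big_split/=; apply: eq_bigr => i _.
rewrite (big1 _ _ (fun j => 0 * _)) => [|j _]; last by rewrite mul0r.
by rewrite coD; ring.
Qed.

Lemma ham_diag_le (b : 'rV[R]_d) (a : 'M[R]_d) l B (A Bb e : R) (l' : I -> R) (L : R) (m : R) :
  0 <= e -> 0 <= m -> (forall k, `|b 0 k| <= Bb) -> (forall k, `|a k k| <= A) ->
  (forall i, `|l' i| <= m) ->
  ham b a (fun i => l i + l' i) (fun i j => B i j + diag_form e L i j) <=
  ham b a l B + d%:R * Bb * m + 2 * d%:R * A * e.
Proof.
move=> e0 m0 hb ha hl.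
have -> : ham b a (fun i => l i + l' i) (fun i j => B i j + diag_form e L i j) =
  ham b a l B + \sum_k b 0 k * l' (Some k) + \sum_k a k k * (2 * e).
  rewrite /ham.
  under eq_bigr => k _ do rewrite mulrDr.
  rewrite big_split/=.
  under [X in _ + X]eq_bigr => k _ do under eq_bigr => n _ do rewrite addrACA mulrDr.
  under [X in _ + X]eq_bigr => k _ do rewrite big_split/=.
  rewrite big_split/= -!addrA; congr (_ + _).
  rewrite addrCA; congr (_ + (_ + _)).
  apply: eq_bigr => k _; rewrite (bigD1 k)//= big1 ?addr0.
    by rewrite /diag_form eqxx; ring.
  move=> n nk; rewrite /diag_form.
  have -> : (Some n == Some k) = false by apply/negbTE; apply: contraNN nk => /eqP[->].
  have -> : (Some k == Some n) = false by apply/negbTE; apply: contraNN nk => /eqP[->].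
  by rewrite addr0 mulr0.
move: (ham b a l B) => h0; rewrite -!addrA lerD2l; apply: lerD.
  rewrite -mulrA.
  apply: (@le_trans _ _ (\sum_(k < d) Bb * m)); last by rewrite sumr_const card_ord mulr_natl.
  apply: ler_sum => k _; apply: le_trans (ler_norm _) _; rewrite normrM.
  by apply: ler_pM.
apply: (@le_trans _ _ (\sum_(k < d) A * (2 * e))).
  apply: ler_sum => k _; rewrite ler_wpM2r ?mulr_ge0//.
  exact: le_trans (ler_norm _) (ha k).
by rewrite sumr_const card_ord -mulr_natl; lra.
Qed.

(* At a maximum point [p] of [u - G - eta |. - p0|^2], [eta |p - p0|^2] is bounded
   uniformly in [eta], so the penalisation disappears from the equation as
   [eta -> 0]. *)
Lemma jet_comparison (E : Type) (b : E -> 'rV[R]_d) (a : E -> 'M[R]_d) (A Bb M t0 th : R) u G :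
  inhabited E -> 0 < th ->
  (forall xi k, `|b xi 0 k| <= Bb) -> (forall xi k, `|a xi k k| <= A) ->
  jet_subsolution b a t0 u ->
  (forall p, t0 <= p.2 -> forall e, 0 < e -> \forall q \near p, t0 <= q.2 -> u q <= u p + e) ->
  (forall p, t0 <= p.2 -> u p - G p <= M) ->
  continuous G ->
  (forall p, t0 < p.2 -> exists l B, upjet G p l B /\
     forall xi, ham (b xi) (a xi) l B + th <= l None) ->
  (forall p, p.2 = t0 -> u p <= G p) ->
  forall p, t0 <= p.2 -> u p <= G p.
Proof.
move=> [xi0] th0 hb ha ju uu uM cG jG u0 p0 tp0; rewrite leNgt; apply/negP => Gu.
have k0 : d%:R * Bb >= 0 :> R.
  case: (posnP d) => [->|d0]; first by rewrite mul0r.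
  by rewrite mulr_ge0// (le_trans _ (hb xi0 (Ordinal d0))).
have kA : d%:R * A >= 0 :> R.
  case: (posnP d) => [->|d0]; first by rewrite mul0r.
  by rewrite mulr_ge0// (le_trans _ (ha xi0 (Ordinal d0))).
have M0 : 0 < M by have := uM p0 tp0; lra.
(* The parameters give $c_1\gamma M=\theta/4$ and $c_2\eta=\theta/2$. The penalty and the superjet
   error together will cost at most $c_1\gamma M+(c_2-1)\eta<\theta$, against a strictness of
   $\theta$. The 1 in [c1] pays for the time component of the gradient of the penalty. *)
pose c1 := d%:R * Bb + 1.
pose gam := th / (4 * c1 * M).
have c10 : 0 < c1 by rewrite /c1 ltr_pwDr.
have gam0 : 0 < gam by rewrite divr_gt0// mulr_gt0// mulr_gt0.
pose c2 := c1 / gam + 4 * (d%:R * A) + 1.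
have q0 : 0 < c1 / gam by exact: divr_gt0.
have c20 : 0 < c2 by rewrite /c2; move: kA; lra.
pose eta := th / (2 * c2).
have eta0 : 0 < eta by rewrite divr_gt0// mulr_gt0.
pose F q := u q - G q - eta * sqnorm (q - p0).
have N00 : sqnorm (p0 - p0) = 0.
  by rewrite subrr /sqnorm big1// => i _; rewrite co0 expr0n.
have cN : continuous (fun q => sqnorm (q - p0)).
  by move=> q; rewrite (_ : (fun q => _) = jet_poly p0 (sqnorm (p0 - p0))
      (fun i => 2 * co (p0 - p0) i) (diag_form 1 1));
    [exact: jet_poly_continuous|apply/funext => x; exact: sqnorm_jet_poly].
have [p tp maxp] : exists2 p, t0 <= p.2 & forall q, t0 <= q.2 -> F q <= F p.
  apply: (@usc_max F t0 (M / eta + 1) p0) => //.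
    move=> p tp e e0; have e3 : 0 < e / 3 by rewrite divr_gt0.
    have h1 := uu p tp _ e3.
    have h2 := cont_near p cG e3.
    have h3 : \forall q \near p, `|eta * sqnorm (p - p0) - eta * sqnorm (q - p0)| <= e / 3.
      apply: (@cont_near (fun q => eta * sqnorm (q - p0))) => // q.
      by apply: cvgM; [exact: cvg_cst|exact: cN].
    apply: filterS3 h1 h2 h3 => q h1 h2 h3 tq; move/(_ tq) in h1.
    by rewrite /F; move: h1 h2 h3; rewrite !ler_norml => ? /andP[? ?] /andP[? ?]; lra.
  move=> q tq qr; have := uM q tq; rewrite /F N00 mulr0 subr0.
  suff : M <= eta * sqnorm (q - p0) by lra.
  rewrite mulrC -ler_pdivrMr//; apply: le_trans (norm_sq_le _).
  have r0 : 0 <= M / eta by apply/ltW/divr_gt0.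
  apply: (@le_trans _ _ ((M / eta + 1) ^+ 2)).
    by rewrite sqrrD1 -addrA -[leLHS]add0r lerD ?sqr_ge0//; lra.
  by rewrite ler_sqr ?nnegrE ?(ltW qr)// addr_ge0.
have Fp0 : 0 < F p.
  by apply: lt_le_trans (maxp p0 tp0); rewrite /F N00 mulr0 subr0 subr_gt0.
have etaN : eta * sqnorm (p - p0) <= M by have := uM p tp; move: Fp0; rewrite /F; lra.
have {}tp : t0 < p.2.
  rewrite lt_neqAle tp andbT; apply/eqP => tpE.
  have := u0 p (esym tpE); have := sqnorm_ge0 (p - p0); move: Fp0; rewrite /F.
  by move=> h1 /(mulr_ge0 (ltW eta0)); lra.
have [l [B [jGp hl]]] := jG p tp.
have [L hL] := jGp _ eta0.
pose l' i := eta * (2 * co (p - p0) i).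
pose m := gam * M + eta / gam.
have l'm i : `|l' i| <= m.
  rewrite /l' normrM gtr0_norm// normrM ger0_norm//.
  set y := `|_|.
  have y2 : eta * y ^+ 2 <= M.
    apply: le_trans etaN; rewrite ler_pM2l// /y real_normK ?num_real//.
    exact: co_sq_le.
  (* Young's inequality $2\eta y\le\gamma\eta y^2+\eta/\gamma$, to be combined with $\eta y^2\le
     M$. *)
  have : 0 <= eta / gam * (gam * y - 1) ^+ 2.
    by rewrite mulr_ge0 ?sqr_ge0//; apply/ltW/divr_gt0.
  have -> : eta / gam * (gam * y - 1) ^+ 2 = gam * (eta * y ^+ 2) - eta * (2 * y) + eta / gam.
    by field; rewrite gt_eqF.
  have : gam * (eta * y ^+ 2) <= gam * M by rewrite ler_pM2l.
  by rewrite /m; lra.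
have m0 : 0 <= m by exact: le_trans (normr_ge0 _) (l'm None).
(* On the spatial diagonal one [eta] comes from the superjet of [G], the other from the penalty. *)
have := ju p tp (fun i => l i + l' i) (fun i j => B i j + diag_form (eta + eta) (L + eta) i j).
have touch : \forall q \near p, u q <= jet_poly p (u p) (fun i => l i + l' i)
    (fun i j => B i j + diag_form (eta + eta) (L + eta) i j) q.
  near=> q.
  have tq : t0 < q.2 by near: q; exact: near_time.
  have GL : G q <= jet_poly p (G p) l (fun i j => B i j + diag_form eta L i j) q by near: q.
  have := maxp q (ltW tq); rewrite /F (sqnorm_jet_poly p p0 q).
  have -> : jet_poly p (u p) (fun i => l i + l' i)
     (fun i j => B i j + diag_form (eta + eta) (L + eta) i j) q =
     (u p - G p - eta * sqnorm (p - p0)) +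
     jet_poly p (G p) l (fun i j => B i j + diag_form eta L i j) q +
     eta * jet_poly p (sqnorm (p - p0)) (fun i => 2 * co (p - p0) i) (diag_form 1 1) q.
    have -> : eta * jet_poly p (sqnorm (p - p0)) (fun i => 2 * co (p - p0) i) (diag_form 1 1) q =
      jet_poly p (eta * sqnorm (p - p0)) l' (diag_form eta eta) q.
      rewrite /jet_poly mulrDr mulr_sumr; congr (_ + _); apply: eq_bigr => i _.
      rewrite mulrCA mulrDr mulr_sumr; congr (_ * (_ + _)).
      by apply: eq_bigr => j _; rewrite /diag_form; case: eqP; case: i => *; ring.
    rewrite -addrA jet_polyD /jet_poly addrA; congr (_ + _); first by ring.
    apply: eq_bigr => i _; congr (_ * (_ + _)); apply: eq_bigr => j _; congr (_ * _).
    by rewrite /diag_form -addrA; congr (_ + _); case: eqP; case: i => *; ring.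
  by move: GL; lra.
move=> /(_ touch (l None - th + d%:R * Bb * m + 2 * d%:R * A * (eta + eta))).
have hc xi : ham (b xi) (a xi) (fun i => l i + l' i)
    (fun i j => B i j + diag_form (eta + eta) (L + eta) i j) <=
    l None - th + d%:R * Bb * m + 2 * d%:R * A * (eta + eta).
  apply: le_trans (@ham_diag_le _ _ _ _ A Bb _ _ _ m _ m0 (hb xi) (ha xi) l'm) _.
    by rewrite addr_ge0// ltW.
  by have := hl xi; lra.
move=> /(_ hc).
have := l'm None; rewrite ler_norml => /andP[h _] h2.
have : th <= c1 * m + 4 * (d%:R * A) * eta by move: h h2; rewrite /c1; lra.
have -> : c1 * m + 4 * (d%:R * A) * eta = c1 * gam * M + (c2 - 1) * eta.
  by rewrite /m /c2; field; rewrite gt_eqF.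
have -> : c1 * gam * M = th / 4.
  by rewrite /gam; field; rewrite !gt_eqF.
have : c2 * eta = th / 2 by rewrite /eta; field; rewrite gt_eqF.
by move: eta0 th0; lra.
Unshelve. all: by end_near. Qed.

End Jets.

(** * Real-valued envelopes, and the passage from viscosity inequalities to jets *)

Section Envelopes.
Context {R : realType} {d : nat}.
Local Notation V := ('rV[R]_d * R)%type.
Implicit Types (f g : V -> R) (p q : V).

(** [fine] sends infinite values to 0; by [uenvE] this does not occur in the half-space when [f] is
    bounded there. *)
Definition uenv f p : R := fine (usc_env f p).
Definition lenv f p : R := - uenv (fun q => - f q) p.

Lemma lsc_envE f p : lsc_env f p = (- usc_env (fun q => - f q)%R p)%E.
Proof. by []. Qed.

Section Bounded.
Variables (f : V -> R) (M : R).
Hypothesis fM : forall p, halfspace p -> `|f p| <= M.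

Lemma usc_env_le p (A : set V) (c : R) : nbhs p A ->
  (forall q, halfspace q -> A q -> f q <= c) -> (usc_env f p <= c%:E)%E.
Proof.
move=> Ap Ac; apply: (@le_trans _ _ (ereal_sup ((EFin \o f) @` (A `&` halfspace)))).
  by apply: ereal_inf_lbound; exists (A `&` halfspace) => //; apply: filterS Ap => q; split.
by apply: ge_ereal_sup => _ [q [Aq hq] <-]; rewrite lee_fin Ac.
Qed.

Lemma usc_env_ge p : halfspace p -> ((f p)%:E <= usc_env f p)%E.
Proof.
move=> hp; apply: le_ereal_inf_tmp => _ [A pA <-].
by apply: ereal_sup_ubound; exists p => //; exact: (nbhs_singleton pA).
Qed.

Lemma uenvE p : halfspace p -> usc_env f p = (uenv f p)%:E.
Proof.
move=> hp; rewrite fineK// fin_numElt; apply/andP; split.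
  by apply: lt_le_trans (usc_env_ge hp); rewrite ltNyr.
apply: le_lt_trans (ltry M); apply: (@usc_env_le p setT); first exact: filterT.
by move=> q hq _; have := fM hq; rewrite ler_norml => /andP[].
Qed.

Lemma uenv_ge p : halfspace p -> f p <= uenv f p.
Proof. by move=> hp; rewrite -lee_fin -uenvE//; exact: usc_env_ge. Qed.

Lemma uenv_le p (A : set V) (c : R) : halfspace p -> nbhs p A ->
  (forall q, halfspace q -> A q -> f q <= c) -> uenv f p <= c.
Proof. by move=> hp pA h; rewrite -lee_fin -uenvE//; exact: usc_env_le h. Qed.

Lemma uenv_bound p : halfspace p -> `|uenv f p| <= M.
Proof.
move=> hp; rewrite ler_norml; apply/andP; split.
  by apply: le_trans (uenv_ge hp); have := fM hp; rewrite ler_norml => /andP[].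
apply: (@uenv_le p setT) => //; first exact: filterT.
by move=> q hq _; have := fM hq; rewrite ler_norml => /andP[].
Qed.

(** A neighbourhood of [p] is also one of each point of its interior, so a bound that it gives for
    the envelope at [p] holds at nearby points too. *)
Lemma uenv_usc p (e : R) : halfspace p -> 0 < e ->
  \forall q \near p, halfspace q -> uenv f q <= uenv f p + e.
Proof.
move=> hp e0.
have : (usc_env f p < (uenv f p + e)%:E)%E by rewrite uenvE// lte_fin ltrDl.
move=> /ereal_inf_lt[_ [A pA <-] Ac].
have pA' : nbhs p [set q | halfspace q -> A q] by exact: pA.
apply: filterS (nbhs_interior pA') => q qA hq.
apply: (@uenv_le q [set q | halfspace q -> A q]) => // q' hq' /(_ hq') Aq'.
rewrite -lee_fin; apply: le_trans (ltW Ac).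
by apply: ereal_sup_ubound; exists q'.
Qed.

End Bounded.

Lemma jet_polyN p c l B q : jet_poly p (- c) (fun i => - l i) (fun i j => - B i j) q =
  - jet_poly p c l B q :> R.
Proof.
rewrite /jet_poly opprD -sumrN; congr (_ + _); apply: eq_bigr => i _.
rewrite -mulrN opprD -sumrN; congr (_ * (_ + _)).
by apply: eq_bigr => j _; rewrite mulNr.
Qed.

Lemma tr_mul_hess (a : 'M[R]_d) (H : 'M[R]_d) : \tr (a *m H) = \sum_k \sum_m a k m * H m k.
Proof. by rewrite /mxtrace; apply: eq_bigr => k _; rewrite mxE. Qed.

Lemma viscosity_jet_subsolution (E : Type) (b : E -> 'rV[R]_d) (a : E -> 'M[R]_d) f M :
  (forall p, halfspace p -> `|f p| <= M) ->
  viscosity_subsolution b a f -> jet_subsolution b a 0 (uenv f).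
Proof.
move=> fM [_ vf] p p0 l B touch c hc.
have := vf _ (jet_poly_smooth p (uenv f p) l B) p p0.
rewrite dt_jet_poly -lee_fin => h; apply: le_trans (h _) _.
  have hp : halfspace p by exact: ltW.
  apply: filterS touch => q uq hq.
  by rewrite (uenvE fM hq) (uenvE fM hp) jet_poly0 -!EFinB lee_fin subrr subr_le0.
apply: ge_ereal_sup => _ [xi _ <-]; rewrite lee_fin; apply: le_trans (hc xi).
rewrite tr_mul_hess /ham le_eqVlt; apply/orP; left; apply/eqP; congr (_ + _).
  by apply: eq_bigr => k _; rewrite grad_jet_poly.
by apply: eq_bigr => k _; apply: eq_bigr => m _; rewrite hess_jet_poly.
Qed.

(** A supremum below the time derivative bounds the term of each control separately; changing signs
    leaves a linear equation for the chosen [xi]. *)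
Lemma viscosity_jet_supersolution (E : Type) (b : E -> 'rV[R]_d) (a : E -> 'M[R]_d) g M xi :
  (forall p, halfspace p -> `|g p| <= M) ->
  viscosity_supersolution b a g ->
  jet_subsolution (fun _ : unit => b xi) (fun _ => a xi) 0 (uenv (fun q => - g q)).
Proof.
move=> gM [_ vg] p p0 l B touch c hc.
have fM q : halfspace q -> `|- g q| <= M by move=> hq; rewrite normrN gM.
have := vg _ (jet_poly_smooth p (lenv g p) (fun i => - l i) (fun i j => - B i j)) p p0.
rewrite dt_jet_poly => h; apply: le_trans (hc tt); rewrite -lerN2 -lee_fin.
apply: le_trans (h _).
  apply: (@ereal_sup_ubound _ _ (- ham (b xi) (a xi) l B)%:E); exists xi => //.
  congr EFin; rewrite tr_mul_hess /ham opprD -!sumrN; congr (_ + _).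
    by apply: eq_bigr => k _; rewrite grad_jet_poly mulrN.
  apply: eq_bigr => k _; rewrite -sumrN; apply: eq_bigr => m _.
  by rewrite hess_jet_poly -opprD mulrN.
have hp : halfspace p by exact: ltW.
apply: filterS touch => q uq hq.
rewrite !lsc_envE (uenvE fM hq) (uenvE fM hp) jet_poly0 -!EFinN -!EFinB lee_fin subrr.
by rewrite /lenv jet_polyN opprK addrC subr_ge0.
Qed.

End Envelopes.

(** * Sup-convolution with a cone in space-time *)

Section SupConvolution.
Context {R : realType} {d : nat}.
Local Notation V := ('rV[R]_d * R)%type.
Implicit Types (f g w : V -> R) (p q z : V).

(** The penalty is a cone and not a paraboloid: only a Lipschitz bound is wanted here, since
    second-order regularity will come from mollification. *)
Definition sconv (k : R) w p : R := sup [set w q - k * `|p - q| | q in halfspace].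

Section Props.
Variables (w : V -> R) (M k : R).
Hypotheses (k0 : 0 < k) (wM : forall p, halfspace p -> `|w p| <= M).

Let hs0 : halfspace (0 : V). Proof. by rewrite /halfspace /=. Qed.

Lemma sconv_set_ub p : ubound [set w q - k * `|p - q| | q in halfspace] M.
Proof.
move=> _ [q hq <-]; rewrite lerBlDr.
have := wM hq; rewrite ler_norml => /andP[_ /le_trans]; apply.
by rewrite lerDl mulr_ge0// ltW.
Qed.

Lemma sconv_set_sup p : has_sup [set w q - k * `|p - q| | q in halfspace].
Proof.
split; last by exists M; exact: sconv_set_ub.
by exists (w 0 - k * `|p - 0|); exists 0.
Qed.

Lemma sconv_ge p q : halfspace q -> w q - k * `|p - q| <= sconv k w p.
Proof. by move=> hq; apply: sup_upper_bound; [exact: sconv_set_sup|exists q]. Qed.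

Lemma sconv_le p (c : R) : (forall q, halfspace q -> w q - k * `|p - q| <= c) ->
  sconv k w p <= c.
Proof.
move=> h; apply: ge_sup; first by case: (sconv_set_sup p).
by move=> _ [q hq <-]; exact: h.
Qed.

Lemma sconv_ge_self p : halfspace p -> w p <= sconv k w p.
Proof.
by move=> hp; have := sconv_ge p hp; rewrite subrr normr0 mulr0 subr0.
Qed.

Lemma sconv_bound p : halfspace p -> `|sconv k w p| <= M.
Proof.
move=> hp; rewrite ler_norml; apply/andP; split.
  by apply: le_trans (sconv_ge_self hp); have := wM hp; rewrite ler_norml => /andP[].
by apply: sconv_le => q hq; apply: (sconv_set_ub (p := p)); exists q.
Qed.

Lemma sconv_lip : lip k (sconv k w).
Proof.
have half p z : sconv k w (p + z) <= sconv k w p + k * `|z|.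
  apply: sconv_le => q hq; have := sconv_ge p hq => h.
  rewrite -lerBlDr; apply: le_trans h; rewrite -addrA lerD2l -opprD lerN2 -mulrDr.
  rewrite ler_pM2l// -(normrN z); apply: le_trans (ler_normD _ _).
  by rewrite -addrA -addrA (addrCA z) addrA addrK.
move=> p z; rewrite ler_norml; apply/andP; split; last by rewrite lerBlDl half.
have := half (p + z) (- z); rewrite addrK normrN; lra.
Qed.

Hypothesis w_usc : forall p, 0 <= p.2 -> forall e, 0 < e ->
  \forall q \near p, 0 <= q.2 -> w q <= w p + e.

Lemma sconv_attained p : halfspace p -> exists q, [/\ halfspace q,
  k * `|p - q| <= 2 * M & sconv k w p = w q - k * `|p - q|].
Proof.
move=> hp.
have M0 : 0 <= M by exact: le_trans (wM hp).
have [q hq maxq] : exists2 q, 0 <= q.2 & forall q', 0 <= q'.2 ->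
    w q' - k * `|p - q'| <= w q - k * `|p - q|.
  apply: (@usc_max R d (fun q => w q - k * `|p - q|) 0 (2 * M / k) p hp).
    move=> q hq e e0; have e2 : 0 < e / 2 by rewrite divr_gt0.
    have e2k : 0 < e / 2 / k by rewrite divr_gt0.
    apply: filterS2 (w_usc hq e2) (near_norm_le q e2k) => q' h1 h2 tq'.
    have := h1 tq'; rewrite ler_pdivlMr// mulrC in h2.
    have : k * `|p - q| <= k * `|p - q'| + k * `|q' - q|.
      rewrite -mulrDr ler_pM2l//; apply: le_trans (ler_normD _ _).
      by rewrite addrA subrK.
    by lra.
  move=> q hq; rewrite ltr_pdivrMr// distrC mulrC => h.
  rewrite subrr normr0 mulr0 subr0.
  have := wM hq; have := wM hp; rewrite !ler_norml => /andP[? ?] /andP[? ?]; lra.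
exists q; split => //.
  have := maxq p hp; rewrite subrr normr0 mulr0 subr0.
  have := wM hq; have := wM hp; rewrite !ler_norml => /andP[? ?] /andP[? ?]; lra.
by apply/eqP; rewrite eq_le sconv_ge// andbT; exact: sconv_le.
Qed.

(** A test polynomial touching at [p] is translated to a maximiser [q]; its coefficients do not
    change, nor do those of the equation. As $k|p-q|\le2M$, times beyond $2M/k$ keep [q] at positive
    time. *)
Lemma sconv_jet (E : Type) (b : E -> 'rV[R]_d) (a : E -> 'M[R]_d) :
  jet_subsolution b a 0 w -> jet_subsolution b a (2 * M / k) (sconv k w).
Proof.
move=> jw p; rewrite ltr_pdivrMr// => tp l B touch c hc.
have M0 : 0 <= M by exact: le_trans (wM (p := 0) (lexx 0)).
have hp : halfspace p.
  by rewrite /halfspace/= -(pmulr_lge0 _ k0); apply: le_trans (ltW tp); rewrite mulr_ge0.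
have [q [hq kpq eq]] := sconv_attained hp.
have tq : 0 < q.2.
  have : k * (p.2 - q.2) <= 2 * M.
    apply: le_trans kpq; rewrite ler_pM2l//.
    exact: le_trans (ler_norm _) (co_le (p - q) None).
  by rewrite -(pmulr_lgt0 _ k0) mulrBr mulrC (mulrC k q.2); lra.
apply: (jw q tq l B _ c hc).
have sh : \forall q' \near q, sconv k w (q' + (p - q)) <= jet_poly p (sconv k w p) l B (q' + (p - q)).
  by move: touch; rewrite (near_shift q).
near=> q'.
have h1 : sconv k w (q' + (p - q)) <= jet_poly p (sconv k w p) l B (q' + (p - q)) by near: q'.
have hq' : halfspace q'.
  have : 0 < q'.2 by near: q'; exact: near_time.
  exact: ltW.
have h2 := sconv_ge (q' + (p - q)) hq'.
have := le_trans h2 h1.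
have -> : q' + (p - q) - q' = p - q by rewrite addrAC subrr add0r.
rewrite /jet_poly eq; have -> : q' + (p - q) - p = q' - q by rewrite addrA addrAC addrK.
by lra.
Unshelve. all: by end_near. Qed.

End Props.
End SupConvolution.

(** * Random walks along the drift and noise directions, and linear subsolutions *)

Section RandomWalk.
Context {R : realType} {d : nat}.
Local Notation V := ('rV[R]_d * R)%type.
Local Notation I := (option 'I_d).
Implicit Types (f g w : V -> R) (p q z : V) (i j : I) (L : R).

Lemma partial_bound L f (D : I -> V -> R) i p : lip L f ->
  (forall p z, `|f (p + z) - f p - \sum_j co z j * D j p| <= L * `|z| ^+ 2) ->
  `|D i p| <= L.
Proof.
move=> lf hD; apply: (@le_inv_succ _ _ _ L) => n.
have L0 := lip_ge0 lf.
pose s : R := n.+1%:R^-1; have s0 : 0 < s by rewrite invr_gt0.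
have ns : `|s *: axis i : V| <= s.
  by rewrite normrZ gtr0_norm// ler_piMr ?(ltW s0)// axis_le.
have h1 := hD p (s *: axis i); have h2 := lf p (s *: axis i).
have sE : \sum_j co (s *: axis i) j * D j p = s * D i p.
  rewrite (bigD1 i)//= coZ co_axis eqxx mulr1 big1 ?addr0// => j ji.
  by rewrite coZ co_axis eq_sym (negbTE ji) mulr0 mul0r.
rewrite sE in h1.
have : `|s * D i p| <= L * s ^+ 2 + L * s.
  have -> : s * D i p = (f (p + s *: axis i) - f p) -
    (f (p + s *: axis i) - f p - s * D i p) by ring.
  apply: le_trans (ler_normB _ _) _; rewrite addrC; apply: lerD.
    apply: le_trans h1 _; rewrite ler_wpM2l// ler_sqr ?nnegrE//; exact: ltW.
  by apply: le_trans h2 _; rewrite ler_wpM2l.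
rewrite normrM gtr0_norm//.
have -> : L * s ^+ 2 + L * s = s * (L + L * s) by ring.
by rewrite ler_pM2l.
Qed.

Definition c2_data L f (D : I -> V -> R) (D2 : I -> I -> V -> R) :=
  [/\ forall i p, `|D i p| <= L, forall i j p, `|D2 i j p| <= L &
   forall p z, `|f (p + z) - f p - \sum_i co z i * D i p -
    2^-1 * \sum_i co z i * \sum_j co z j * D2 i j p| <= d.+1%:R * L * `|z| ^+ 3].

Lemma lip_jets_c2_data m L f : lip_jets m.+2 L f -> exists (D : I -> V -> R) (D2 : I -> I -> V -> R),
  [/\ c2_data L f D D2, forall i, lip_jets m.+1 L (D i), forall i j, lip_jets m L (D2 i j) &
   forall p z, `|f (p + z) - f p - \sum_i co z i * D i p| <= L * `|z| ^+ 2].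
Proof.
move=> [lf [D [CD hD]]]; exists D.
have /choice[D2 hD2] : forall i, exists D2 : I -> V -> R, (forall j, lip_jets m L (D2 j)) /\
   forall p z, `|D i (p + z) - D i p - \sum_j co z j * D2 j p| <= L * `|z| ^+ 2.
  by move=> i; case: (CD i) => _.
exists D2; split => //.
- split.
  + by move=> i p; exact: partial_bound hD.
  + by move=> i j p; apply: partial_bound (hD2 i).2; case: (CD i).
  + by move=> p z; apply: taylor2 => // i; exact: (hD2 i).2.
- by move=> i j; exact: (hD2 i).1.
Qed.

Lemma c2_upjet L f D D2 p : c2_data L f D D2 ->
  upjet f p (D ^~ p) (fun i j => 2^-1 * D2 i j p).
Proof.
move=> [hD _ hT] e e0; exists e.
have L0 : 0 <= L by exact: le_trans (normr_ge0 _) (hD None p).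
pose c := d.+1%:R * L + 1.
have c0 : 0 < c by rewrite /c ltr_pwDr// mulr_ge0.
near=> q; have := hT p (q - p); rewrite (addrC p) subrK => h.
have -> : jet_poly p (f p) (D ^~ p) (fun i j => 2^-1 * D2 i j p + diag_form e e i j) q =
  jet_poly p (f p) (D ^~ p) (fun i j => 2^-1 * D2 i j p) q + jet_poly p 0 (fun=> 0) (diag_form e e) q.
  by rewrite jet_polyD addr0; congr jet_poly; apply/funext => i; rewrite addr0.
have -> : jet_poly p 0 (fun=> 0) (diag_form e e) q = e * sqnorm (q - p).
  by rewrite jet_poly_diag -mulrDr /sqnorm sum_option addrC.
have -> : jet_poly p (f p) (D ^~ p) (fun i j => 2^-1 * D2 i j p) q =
  f p + \sum_i co (q - p) i * D i p +
  2^-1 * \sum_i co (q - p) i * \sum_j co (q - p) j * D2 i j p.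
  rewrite /jet_poly -addrA mulr_sumr -big_split/=; congr (_ + _).
  apply: eq_bigr => i _; rewrite mulrDr; congr (_ + _).
  rewrite [RHS]mulrCA; congr (_ * _); rewrite mulr_sumr.
  by apply: eq_bigr => j _; ring.
have nq : `|q - p| <= e / c by near: q; exact: (near_norm_le p (divr_gt0 e0 c0)).
have : d.+1%:R * L * `|q - p| ^+ 3 <= e * sqnorm (q - p).
  apply: (@le_trans _ _ (e * `|q - p| ^+ 2)); last by rewrite ler_pM2l// norm_sq_le.
  rewrite exprS mulrA ler_wpM2r ?sqr_ge0//.
  apply: (@le_trans _ _ (c * `|q - p|)); first by rewrite ler_wpM2r// /c lerDl.
  by rewrite mulrC -ler_pdivlMr.
by move: h; rewrite ler_norml => /andP[_]; lra.
Unshelve. all: by end_near. Qed.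

Section Linear.
Variables (K : nat) (b : 'rV[R]_d) (sigma : 'M[R]_(d, K)).
Hypothesis K0 : (0 < K)%N.
Let a := sigma *m sigma^T.

Definition driftV : V := (b, 0).
Definition noiseV (k : 'I_K) : V := (\row_i sigma i k, 0).
(** The two signs cancel the odd powers of the noise. The factor $\sqrt{2K}$ compensates the weights
    $1/(2K)$ and the $1/2$ of Taylor's formula, so that the columns of [sigma] contribute
    $\omega^2\,\mathrm{tr}(aD^2f)$. Jumps stay in their time slice. *)
Definition jump (om : R) (ks : 'I_K * bool) : V :=
  om ^+ 2 *: driftV + ((if ks.2 then 1 else -1) * (Num.sqrt (2 * K%:R) * om)) *: noiseV ks.1.

(* One step of the random walk that approximates, over the time [om ^ 2], the
   diffusion with drift [b] and covariance [2 a]. *)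
Definition walk om f p := \sum_(ks : 'I_K * bool) (2 * K%:R)^-1 * f (p + jump om ks).

Definition generator (D : I -> V -> R) (D2 : I -> I -> V -> R) p :=
  \sum_k b 0 k * D (Some k) p +
  \sum_k \sum_m a k m * D2 (Some k) (Some m) p.

Lemma generator_ham D D2 p : generator D D2 p = ham b a (D ^~ p) (fun i j => 2^-1 * D2 i j p).
Proof.
rewrite /generator /ham; congr (_ + _).
under [RHS]eq_bigr => k _ do under eq_bigr => m _ do rewrite mulrDr.
under [RHS]eq_bigr => k _ do rewrite big_split/=.
rewrite big_split/= [X in X + _]exchange_big/= -big_split/=; apply: eq_bigr => k _.
rewrite -big_split/=; apply: eq_bigr => m _.
have -> : a m k = a k m.
  by rewrite /a !mxE; apply: eq_bigr => n _; rewrite !mxE mulrC.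
by field.
Qed.

Lemma walk_weights : \sum_(ks : 'I_K * bool) (2 * K%:R)^-1 = 1 :> R.
Proof.
rewrite sumr_const card_prod card_ord card_bool -[LHS]mulr_natr natrM [K%:R * _]mulrC mulVf//.
by rewrite mulf_neq0// pnatr_eq0// -lt0n.
Qed.

Lemma walk_lip_jets om m L f : lip_jets m L f -> lip_jets m L (walk om f).
Proof.
move=> Cf.
have := @lip_jets_comb _ _ _ (fun _ : 'I_K * bool => (2 * K%:R)^-1)
  (fun ks p => f (p + jump om ks)) m L (fun ks => lip_jets_shift _ Cf).
by under eq_bigr => ks _ do rewrite ger0_norm ?invr_ge0 ?mulr_ge0//;
  rewrite walk_weights mul1r.
Qed.

Lemma walk_le om f g e (t : R) : (forall p, p.2 = t -> f p <= g p + e) ->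
  forall p, p.2 = t -> walk om f p <= walk om g p + e.
Proof.
move=> fg p tp.
have ee : \sum_(ks : 'I_K * bool) (2 * K%:R)^-1 * e = e.
  by rewrite -mulr_suml walk_weights mul1r.
rewrite /walk -[X in _ <= _ + X]ee -big_split/=.
apply: ler_sum => ks _; rewrite -mulrDr ler_wpM2l ?invr_ge0 ?mulr_ge0//.
by apply: fg; rewrite /jump /= !scaler0 !addr0.
Qed.

Definition rate : R := \sum_k `|b 0 k| + Num.sqrt (2 * K%:R) * \sum_n \sum_k `|sigma k n|.

Lemma rate_ge0 : 0 <= rate.
Proof.
rewrite addr_ge0//; first exact: sumr_ge0.
rewrite mulr_ge0 ?sqrtr_ge0//; apply: sumr_ge0 => n _; exact: sumr_ge0.
Qed.

Lemma jump_le om ks : 0 <= om <= 1 -> `|jump om ks| <= rate * om.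
Proof.
move=> /andP[om0 om1]; apply: norm_le_co => [|i]; first by rewrite mulr_ge0 ?rate_ge0.
rewrite /jump coD !coZ; apply: le_trans (ler_normD _ _) _.
rewrite /rate [leRHS]mulrDl; apply: lerD.
  rewrite normrM (ger0_norm (sqr_ge0 om)) mulrC; apply: ler_pM; rewrite ?sqr_ge0//.
    case: i => [k|] /=; last by rewrite normr0 sumr_ge0.
    by rewrite (bigD1 k)//= lerDl sumr_ge0.
  by rewrite expr2 ler_piMr.
rewrite !normrM (_ : `|if _ then _ else _| = 1); last first.
  by case: ifP; rewrite ?normrN normr1.
rewrite mul1r (ger0_norm (sqrtr_ge0 _)) (ger0_norm om0) -!mulrA ler_wpM2l ?sqrtr_ge0//.
rewrite mulrC ler_wpM2r//.
case: i => [k|] /=; last by rewrite normr0 sumr_ge0// => n _; exact: sumr_ge0.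
rewrite mxE (bigD1 ks.1)//= (bigD1 k)//= -addrA lerDl addr_ge0 ?sumr_ge0// => n _.
exact: sumr_ge0.
Qed.

Lemma sum_bool_pair (F : 'I_K * bool -> R) :
  \sum_ks F ks = \sum_k (F (k, true) + F (k, false)).
Proof.
rewrite (eq_bigr (fun ks => F (ks.1, ks.2))) => [|[]//].
rewrite -(pair_bigA _ (fun k s => F (k, s)))/=.
by apply: eq_bigr => k _; rewrite big_bool.
Qed.

Definition quad (B : I -> I -> R) z z' := \sum_i co z i * \sum_j co z' j * B i j.

Lemma quad_comb (B : I -> I -> R) z (y : V) (s : R) :
  quad B (z + s *: y) (z + s *: y) + quad B (z - s *: y) (z - s *: y) =
  2 * quad B z z + 2 * s ^+ 2 * quad B y y.
Proof.
rewrite /quad !mulr_sumr -!big_split/=; apply: eq_bigr => i _.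
rewrite !coD !coN !coZ.
have E c : \sum_j co (z + c *: y) j * B i j =
  \sum_j co z j * B i j + c * \sum_j co y j * B i j.
  by rewrite mulr_sumr -big_split; apply: eq_bigr => j _ /=; rewrite coD coZ; ring.
have := E (- s); rewrite scaleNr => ->; by rewrite E; ring.
Qed.

Lemma quad_noise (B : I -> I -> R) :
  \sum_k quad B (noiseV k) (noiseV k) = \sum_k \sum_m a k m * B (Some k) (Some m).
Proof.
have E k : quad B (noiseV k) (noiseV k) =
  \sum_i \sum_j (sigma i k * sigma j k) * B (Some i) (Some j).
  rewrite /quad sum_option mul0r add0r; apply: eq_bigr => i _.
  rewrite sum_option mul0r add0r mulr_sumr; apply: eq_bigr => j _ /=.
  by rewrite !mxE mulrA.
under eq_bigr => k _ do rewrite E.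
rewrite exchange_big; apply: eq_bigr => i _; rewrite exchange_big; apply: eq_bigr => j _ /=.
by rewrite -mulr_suml /a mxE; congr (_ * _); apply: eq_bigr => k _; rewrite mxE.
Qed.

(** The order $\omega^3$ is that of the cubic Taylor remainder, jumps having size $O(\omega)$; the
    drift adds only a term in $\omega^4$. [C] is fixed before [f], which matters for iteration. *)
Lemma walk_consistent L : exists2 C, 0 <= C & forall f D D2, c2_data L f D D2 ->
  forall om p, 0 <= om <= 1 ->
  `|walk om f p - f p - om ^+ 2 * generator D D2 p| <= C * om ^+ 3.
Proof.
pose Q := (\sum_k `|b 0 k|) ^+ 2 * L.
have [L0|L0] := leP 0 L; last first.
  exists 0 => // f D D2 [/(_ None 0)] hD _ _.
  by have := le_lt_trans (le_trans (normr_ge0 _) hD) L0; rewrite ltxx.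
exists (d.+1%:R * L * rate ^+ 3 + 2^-1 * Q).
  by rewrite addr_ge0 ?mulr_ge0 ?exprn_ge0 ?rate_ge0 ?invr_ge0 ?sumr_ge0.
move=> f D D2 [hD hD2 hT] om p om01; have /andP[om0 om1] := om01.
pose B i j := D2 i j p; pose ell z := \sum_i co z i * D i p.
pose wt : R := (2 * K%:R)^-1.
have wt0 : 0 <= wt by rewrite invr_ge0 mulr_ge0.
have Kn0 : K%:R != 0 :> R by rewrite pnatr_eq0 -lt0n.
have main : \sum_ks wt * (ell (jump om ks) + 2^-1 * quad B (jump om ks) (jump om ks)) =
   om ^+ 2 * generator D D2 p + 2^-1 * om ^+ 4 * quad B driftV driftV.
  rewrite sum_bool_pair.
  pose z := om ^+ 2 *: driftV; pose s := Num.sqrt (2 * K%:R) * om.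
  have s2 : s ^+ 2 = 2 * K%:R * om ^+ 2 by rewrite exprMn sqr_sqrtr ?mulr_ge0.
  have lin k c : ell (z + c *: noiseV k) = ell z + c * ell (noiseV k).
    rewrite /ell mulr_sumr -big_split; apply: eq_bigr => i _ /=.
    by rewrite coD coZ; ring.
  have qz : quad B z z = om ^+ 4 * quad B driftV driftV.
    rewrite /quad mulr_sumr; apply: eq_bigr => i _; rewrite coZ -mulrA mulrCA.
    rewrite [RHS]mulrCA; congr (_ * _); rewrite !mulr_sumr; apply: eq_bigr => j _.
    by rewrite coZ; ring.
  have ez : ell z = om ^+ 2 * \sum_k b 0 k * D (Some k) p.
    rewrite /ell sum_option coZ mulr0 mul0r add0r mulr_sumr; apply: eq_bigr => k _.
    by rewrite coZ mulrA.
  under eq_bigr => k _.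
    rewrite /jump /= mul1r mulN1r -/z -/s scaleNr -mulrDr.
    have -> : ell (z + s *: noiseV k) + 2^-1 * quad B (z + s *: noiseV k) (z + s *: noiseV k) +
      (ell (z - s *: noiseV k) + 2^-1 * quad B (z - s *: noiseV k) (z - s *: noiseV k)) =
      2 * ell z + 2^-1 * (2 * quad B z z + 2 * s ^+ 2 * quad B (noiseV k) (noiseV k)).
      by rewrite -quad_comb -scaleNr !lin; ring.
    rewrite s2 mulrDr.
    have -> : wt * (2^-1 * (2 * quad B z z + 2 * (2 * K%:R * om ^+ 2) *
         quad B (noiseV k) (noiseV k))) =
      wt * quad B z z + om ^+ 2 * quad B (noiseV k) (noiseV k).
      by rewrite /wt; field.
    over.
  rewrite /= !big_split/= !sumr_const card_ord -mulr_sumr quad_noise.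
  rewrite -[X in X + _ = _]mulr_natr -[X in _ + (X + _) = _]mulr_natr qz ez /generator.
  by rewrite /wt; field.
have -> : walk om f p - f p - om ^+ 2 * generator D D2 p =
   \sum_ks wt * (f (p + jump om ks) - f p - ell (jump om ks) -
      2^-1 * quad B (jump om ks) (jump om ks)) + 2^-1 * om ^+ 4 * quad B driftV driftV.
  have -> : \sum_ks wt * (f (p + jump om ks) - f p - ell (jump om ks) -
      2^-1 * quad B (jump om ks) (jump om ks)) = walk om f p - f p -
      \sum_ks wt * (ell (jump om ks) + 2^-1 * quad B (jump om ks) (jump om ks)).
    have ff : \sum_(ks : 'I_K * bool) wt * f p = f p.
      by rewrite -mulr_suml walk_weights mul1r.
    rewrite -[X in _ - X - _]ff /walk -!sumrB.
    by apply: eq_bigr => ks _; rewrite /wt; ring.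
  by rewrite main; ring.
apply: le_trans (ler_normD _ _) _; rewrite mulrDl; apply: lerD.
  apply: le_trans (norm_comb_le (b := d.+1%:R * L * rate ^+ 3 * om ^+ 3) _ _) _.
    move=> ks; apply: le_trans (hT p (jump om ks)) _.
    rewrite -[leRHS]mulrA ler_wpM2l ?mulr_ge0// -exprMn.
    by rewrite lerXn2r ?nnegrE ?mulr_ge0 ?rate_ge0// jump_le.
  under eq_bigr => ks _ do rewrite ger0_norm//.
  by rewrite [X in X * _](walk_weights : _ = 1) mul1r.
have qb : `|quad B driftV driftV| <= Q.
  rewrite /quad sum_option mul0r add0r.
  apply: le_trans (norm_comb_le (b := (\sum_k `|b 0 k|) * L) _ _) _.
    move=> k; rewrite sum_option mul0r add0r.
    by apply: norm_comb_le => m; exact: hD2.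
  by rewrite /Q expr2 mulrA.
have o4 : om ^+ 4 <= om ^+ 3 by rewrite exprSr ler_piMr ?exprn_ge0.
have o40 : 0 <= om ^+ 4 by rewrite exprn_ge0.
rewrite normrM (@ger0_norm _ (2^-1 * om ^+ 4)) ?mulr_ge0 ?invr_ge0//.
have := ler_pM o40 (normr_ge0 _) o4 qb; rewrite [om ^+ 3 * Q]mulrC.
by rewrite -!mulrA ler_pM2l.
Qed.

(** Indexing first- and second-order coefficients by one sum type makes the generator a single
    finite combination, ready for [lip_jets_comb] and [norm_comb_le]. *)
Definition generator_weight (x : 'I_d + 'I_d * 'I_d) : R :=
  match x with inl k => b 0 k | inr km => a km.1 km.2 end.

Lemma generatorE (D : I -> V -> R) (D2 : I -> I -> V -> R) p : generator D D2 p =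
  \sum_x generator_weight x *
    (match x with inl k => D (Some k) | inr km => D2 (Some km.1) (Some km.2) end) p.
Proof.
rewrite big_sumType /= /generator; congr (_ + _).
by rewrite pair_bigA.
Qed.

Definition generator_norm : R := \sum_x `|generator_weight x|.

Lemma generator_norm_ge0 : 0 <= generator_norm. Proof. exact: sumr_ge0. Qed.

Lemma generator_lip_jets m L D D2 : (forall i, lip_jets m L (D i)) ->
  (forall i j, lip_jets m L (D2 i j)) ->
  lip_jets m (generator_norm * L) (generator D D2).
Proof.
move=> hD hD2; rewrite (_ : generator D D2 = fun p => \sum_x generator_weight x *
  (match x with inl k => D (Some k) | inr km => D2 (Some km.1) (Some km.2) end) p).
  by apply: lip_jets_comb => -[k|km].
by apply/funext => p; rewrite generatorE.
Qed.

Lemma generator_bound L D D2 p : (forall i, `|D i p| <= L) -> (forall i j, `|D2 i j p| <= L) ->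
  `|generator D D2 p| <= generator_norm * L.
Proof. by move=> hD hD2; rewrite generatorE; apply: norm_comb_le => -[k|km]. Qed.

Lemma ham_add b' (a' : 'M[R]_d) l1 B1 l2 B2 :
  ham b' a' (fun i => l1 i + l2 i) (fun i j => B1 i j + B2 i j) =
  ham b' a' l1 B1 + ham b' a' l2 B2.
Proof.
rewrite /ham [RHS]addrACA; congr (_ + _); rewrite -big_split; apply: eq_bigr => k _ /=.
  by rewrite mulrDr.
rewrite -big_split; apply: eq_bigr => m _ /=.
by rewrite -mulrDr addrACA.
Qed.

Lemma ham_scale b' (a' : 'M[R]_d) c l B :
  ham b' a' (fun i => c * l i) (fun i j => c * B i j) = c * ham b' a' l B.
Proof.
rewrite /ham mulrDr !mulr_sumr; congr (_ + _).
  by apply: eq_bigr => k _; rewrite mulrCA.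
apply: eq_bigr => k _; rewrite mulr_sumr; apply: eq_bigr => m _.
by rewrite -mulrDr mulrCA.
Qed.

Lemma upjet_add f g p l1 B1 l2 B2 : upjet f p l1 B1 -> upjet g p l2 B2 ->
  upjet (fun q => f q + g q) p (fun i => l1 i + l2 i) (fun i j => B1 i j + B2 i j).
Proof.
move=> hf hg e e0; have e2 : 0 < e / 2 by rewrite divr_gt0.
have [L1 h1] := hf _ e2; have [L2 h2] := hg _ e2; exists (L1 + L2).
apply: filterS2 h1 h2 => q h1 h2; apply: le_trans (lerD h1 h2) _.
rewrite jet_polyD le_eqVlt; apply/orP; left; apply/eqP; congr (jet_poly _ _ _ _ _).
apply/funext => i; apply/funext => j; rewrite addrACA; congr (_ + _).
by rewrite /diag_form; case: eqP => // _; case: i => [i|]; lra.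
Qed.

Lemma diag_pol_ge0 p e (L : R) q : 0 <= e -> 0 <= L ->
  0 <= jet_poly p 0 (fun=> 0) (diag_form e L) q.
Proof.
move=> e0 L0; rewrite jet_poly_diag addr_ge0// mulr_ge0 ?sqr_ge0//.
by apply: sumr_ge0 => i _; exact: sqr_ge0.
Qed.

Lemma jet_poly_diagD p c l B e (L : R) q : jet_poly p c l (fun i j => B i j + diag_form e L i j) q =
  jet_poly p c l B q + jet_poly p 0 (fun=> 0) (diag_form e L) q.
Proof. by rewrite jet_polyD addr0; congr jet_poly; apply/funext => i; rewrite addr0. Qed.

Lemma near_all p (P : V -> Prop) : (forall q, P q) -> \forall q \near p, P q.
Proof. by move=> h; near=> q; exact: h. Unshelve. all: by end_near. Qed.

Lemma jet_poly_time p c (m C : R) q : jet_poly p c (fun i => if i is None then m else 0)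
    (fun i j => if (i, j) is (None, None) then C else 0) q =
  c + (q.2 - p.2) * (m + C * (q.2 - p.2)).
Proof.
rewrite /jet_poly; congr (_ + _).
have E (i : I) : \sum_j (if (i, j) is (None, None) then C else 0) * co (q - p) j =
    if i is None then C * co (q - p) None else 0.
  case: i => [i|]; first by rewrite big1// => j _; rewrite mul0r.
  by rewrite sum_option big1 ?addr0// => j _; rewrite mul0r.
under eq_bigr => i _ do rewrite E.
by rewrite sum_option big1 ?addr0// => i _; rewrite ?addr0 mulr0.
Qed.

Lemma upjet_addc f p l B e : upjet f p l B -> upjet (fun q => f q + e) p l B.
Proof.
move=> hf e' e0; have [L h] := hf _ e0; exists L; apply: filterS h => q h.
by rewrite /jet_poly addrAC lerD2r.
Qed.

Lemma ham_zero b' (a' : 'M[R]_d) l B : (forall k, l (Some k) = 0) ->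
  (forall k m, B (Some k) (Some m) = 0) -> ham b' a' l B = 0.
Proof.
move=> l0 B0; rewrite /ham !big1 ?addr0// => k _; last by rewrite l0 mulr0.
by rewrite big1// => m _; rewrite !B0 addr0 mulr0.
Qed.

Lemma upjet_jet_poly f p l B : (forall q, f q = jet_poly p (f p) l B q) -> upjet f p l B.
Proof.
move=> fE e e0; exists 0; apply: near_all => q.
by rewrite jet_poly_diagD -fE lerDl diag_pol_ge0// ltW.
Qed.

Lemma upjet_scale f p l B c : 0 < c -> upjet f p l B ->
  upjet (fun q => c * f q) p (fun i => c * l i) (fun i j => c * B i j).
Proof.
move=> c0 hf e e0; have ec : 0 < e / c by rewrite divr_gt0.
have [L h] := hf _ ec; exists (c * L); apply: filterS h => q.
rewrite -(ler_pM2l c0) => /le_trans; apply.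
rewrite !jet_poly_diagD mulrDr; apply: lerD.
  rewrite /jet_poly mulrDr mulr_sumr lerD2l le_eqVlt; apply/orP; left; apply/eqP.
  apply: eq_bigr => i _; rewrite mulrCA mulrDr mulr_sumr; congr (_ * (_ + _)).
  by apply: eq_bigr => j _; rewrite mulrA.
have ce : c * (e / c) = e by field; rewrite gt_eqF.
by rewrite !jet_poly_diag mulrDr mulrA ce mulrA.
Qed.

(** The mixed term $(q_t-p_t)(f(q)-f(p))$ is at most $L|q_t-p_t||q-p|$, hence at most $e|q-p|^2$
    plus $L^2/(4e)$ times the square of the time increment. The free constant in front of that
    square in [upjet] exists to absorb it. *)
Lemma upjet_time_mul f p l B L (t : R) : t < p.2 -> lip L f -> upjet f p l B ->
  upjet (fun q => (q.2 - t) * f q) p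
    (fun i => (p.2 - t) * l i + if i is None then f p else 0)
    (fun i j => (p.2 - t) * B i j + 0).
Proof.
move=> tp lf jf; have s0 : 0 < p.2 - t by rewrite subr_gt0.
have -> : (fun q => (q.2 - t) * f q) = (fun q => (p.2 - t) * f q + (q.2 - p.2) * f q).
  by apply/funext => q; ring.
apply: (upjet_add (upjet_scale s0 jf)) => e e0.
have L0 := lip_ge0 lf.
exists (e + L ^+ 2 / (4 * e)); apply: near_all => q.
rewrite jet_poly_diagD subrr mul0r.
have -> : jet_poly p 0 (fun i : I => if i is None then f p else 0) (fun _ _ => 0) q =
   (q.2 - p.2) * f p.
  rewrite /jet_poly sum_option big1 ?add0r ?addr0 => [|i _].
    by rewrite big1 ?addr0// => j _; rewrite mulr0.
  by rewrite mul0r.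
rewrite jet_poly_diag /=; set y := q.2 - p.2.
have : y * (f q - f p) <= `|y| * (L * `|q - p|).
  apply: le_trans (ler_norm _) _; rewrite normrM ler_wpM2l//.
  by have := lf p (q - p); rewrite (addrC p) subrK.
have : `|y| * (L * `|q - p|) <= e * `|q - p| ^+ 2 + L ^+ 2 / (4 * e) * y ^+ 2.
  have : 0 <= e * (`|q - p| - L / (2 * e) * `|y|) ^+ 2.
    by rewrite mulr_ge0 ?sqr_ge0// ltW.
  have -> : y ^+ 2 = `|y| ^+ 2 by rewrite real_normK ?num_real.
  have -> : e * (`|q - p| - L / (2 * e) * `|y|) ^+ 2 = e * `|q - p| ^+ 2 +
     L ^+ 2 / (4 * e) * `|y| ^+ 2 - `|y| * (L * `|q - p|).
    by field; rewrite gt_eqF.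
  by lra.
have : e * `|q - p| ^+ 2 <= e * (\sum_(i < d) co (q - p) (Some i) ^+ 2 + y ^+ 2).
  by rewrite ler_pM2l//; have := norm_sq_le (q - p); rewrite /sqnorm sum_option addrC.
rewrite mulrDr [(e + _) * _]mulrDl mulrBr /=; lra.
Qed.

Definition freeze (t0 : R) f p := f (p.1, t0).

Lemma freeze_lip t0 L f : lip L f -> lip L (freeze t0 f).
Proof.
move=> lf p z; have := lf (p.1, t0) (z.1, 0).
rewrite /freeze (_ : (p.1, t0) + (z.1, 0) = ((p + z).1, t0)); last first.
  by congr pair; rewrite /= addr0.
move=> /le_trans; apply; rewrite ler_wpM2l ?(lip_ge0 lf)// prod_normE/= normr0 ge_max.
by rewrite normr_ge0 andbT prod_normE le_max lexx.
Qed.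

Lemma freeze_c2 t0 L f D D2 : c2_data L f D D2 ->
  c2_data L (freeze t0 f) (fun i p => if i is Some _ then D i (p.1, t0) else 0)
    (fun i j p => if (i, j) is (Some _, Some _) then D2 i j (p.1, t0) else 0).
Proof.
move=> [hD hD2 hT].
have L0 : 0 <= L by exact: le_trans (normr_ge0 _) (hD None 0).
split=> [[i|] p|[i|] [j|] p|p z]; rewrite ?normr0//.
have := hT (p.1, t0) (z.1, 0).
rewrite /freeze (_ : (p.1, t0) + (z.1, 0) = ((p + z).1, t0)); last first.
  by congr pair; rewrite /= addr0.
have E (F : I -> R) : \sum_i co z i * (if i is Some _ then F i else 0) =
    \sum_i co (z.1, 0) i * F i.
  by rewrite !sum_option /= mul0r mulr0.
have -> : \sum_i co z i * \sum_j co z j *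
    (if (i, j) is (Some _, Some _) then D2 i j (p.1, t0) else 0) =
    \sum_i co (z.1, 0) i * \sum_j co (z.1, 0) j * D2 i j (p.1, t0).
  rewrite -[RHS]E; apply: eq_bigr => -[i|] _; first by rewrite -E.
  by congr (_ * _); rewrite big1// => j _; rewrite mulr0.
rewrite E.
move=> /le_trans; apply; rewrite ler_wpM2l ?mulr_ge0// lerXn2r ?nnegrE//.
by rewrite prod_normE/= normr0 ge_max normr_ge0 andbT prod_normE le_max lexx.
Qed.

Section Subsolution.
Variables (w : V -> R) (M kk tau : R).
Hypotheses (w_lip : lip kk w) (w_bound : forall p, tau <= p.2 -> `|w p| <= M).
Hypothesis w_sub : jet_subsolution (fun _ : unit => b) (fun _ => a) tau w.

(** With $s$ the time elapsed since [t] and [k] the generator of [g], both frozen at [t0], the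
    function $g+e+sk+C_2s^2+\theta s$ is a strict supersolution: the generator of $sk$ is at most
    $2C_2s$. Comparison at $s=\omega^2$ and consistency of the walk conclude. The slice [t0] stays
    fixed while [t] advances, because the walk does not move in time. *)
Lemma one_step L : exists2 C, 0 <= C & forall g, lip_jets 4 L g -> forall t0 t e, tau <= t ->
  (forall p, p.2 = t -> w p <= g (p.1, t0) + e) ->
  forall om p, 0 <= om <= 1 -> p.2 = t + om ^+ 2 ->
  w p <= walk om g (p.1, t0) + e + C * om ^+ 3.
Proof.
have [C1 C10 hC1] := walk_consistent L.
pose Lk := generator_norm * L.
(* The summand 1 ensures $C_2\ge1$: then $C_2s^2$ absorbs $sk\ge-sL_k$, and $w-G$ is bounded above
   at all later times, as [jet_comparison] requires. *)
pose C2 := generator_norm * `|Lk| + 1.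
have C20 : 1 <= C2 by rewrite /C2 lerDr mulr_ge0// generator_norm_ge0.
exists (C1 + C2); first by rewrite addr_ge0// (le_trans _ C20).
move=> g Cg t0 t e htt gw om p om01 tp.
have [D [D2 [hDD CD CD2 _]]] := lip_jets_c2_data Cg.
pose k := generator D D2.
have Ck : lip_jets 2 Lk k by apply: generator_lip_jets => // i; exact: lip_jets_pred (CD i).
have [K1 [K2 [hKK _ _ _]]] := lip_jets_c2_data Ck.
have lk := freeze_lip t0 (lip_jets_lip Ck).
have lg := freeze_lip t0 (lip_jets_lip Cg).
pose D' (i : I) (p : V) := if i is Some _ then D i (p.1, t0) else 0.
pose D2' (i j : I) (p : V) := if (i, j) is (Some _, Some _) then D2 i j (p.1, t0) else 0.
pose K1' (i : I) (p : V) := if i is Some _ then K1 i (p.1, t0) else 0.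
pose K2' (i j : I) (p : V) := if (i, j) is (Some _, Some _) then K2 i j (p.1, t0) else 0.
have hD' : c2_data L (freeze t0 g) D' D2' by exact: freeze_c2.
have hK' : c2_data Lk (freeze t0 k) K1' K2' by exact: freeze_c2.
have Lk0 : 0 <= Lk by exact: lip_ge0 (lip_jets_lip Ck).
have kb q : `|freeze t0 k q| <= Lk.
  by case: hDD => hD hD2 _; exact: generator_bound.
have kkb q : generator K1' K2' q <= 2 * C2.
  case: hK' => hD hD2 _; have := generator_bound (hD ^~ q) (fun i j => hD2 i j q).
  rewrite ler_norml => /andP[_]; rewrite /C2 (ger0_norm Lk0).
  by move: C20; rewrite /C2 (ger0_norm Lk0); lra.
have main th : 0 < th -> w p <= freeze t0 g p + e + (p.2 - t) * freeze t0 k p +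
    (C2 * (p.2 - t) ^+ 2 + th * (p.2 - t)).
  move=> th0.
  pose G q := freeze t0 g q + e + (q.2 - t) * freeze t0 k q +
    (C2 * (q.2 - t) ^+ 2 + th * (q.2 - t)).
  have abnd : exists A : R, forall xi : unit, forall k, `|a k k| <= A.
    exists (\sum_k `|a k k|) => _ j; rewrite (bigD1 j)//= lerDl sumr_ge0//.
  have [A hA] := abnd.
  have hb : forall xi : unit, forall j : 'I_d, `|b 0 j| <= \sum_j `|b 0 j|.
    by move=> _ j; rewrite [leRHS](bigD1 j)//= lerDl sumr_ge0.
  apply: (@jet_comparison R d unit (fun=> b) (fun=> a) A (\sum_j `|b 0 j|)
    (2 * M + Lk ^+ 2) t th w G (inhabits tt) th0 hb hA) => //.
  - by move=> q tq; exact: w_sub (le_lt_trans htt tq).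
  - move=> q tq f f0; apply: filterS (cont_near q (lip_continuous w_lip) f0) => q'.
    by rewrite ler_norml => /andP[? ?] _; lra.
  - move=> q tq.
    have := w_bound (le_trans htt tq); rewrite ler_norml => /andP[_ wq].
    have := gw (q.1, t) erefl => /= gq.
    have := w_bound (p := (q.1, t)) htt; rewrite ler_norml => /andP[wt _].
    have s0 : 0 <= q.2 - t by rewrite subr_ge0.
    have := ler_wpM2l s0 (kb q) => _.
    have sk : - ((q.2 - t) * freeze t0 k q) <= (q.2 - t) * Lk.
      rewrite -mulrN ler_wpM2l//; have := kb q; rewrite ler_norml => /andP[? _]; lra.
    have s2 : (q.2 - t) ^+ 2 <= C2 * (q.2 - t) ^+ 2 by rewrite ler_peMl// sqr_ge0.
    have ths : 0 <= th * (q.2 - t) by rewrite mulr_ge0// ltW.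
    have : 0 <= (q.2 - t - Lk / 2) ^+ 2 by exact: sqr_ge0.
    have : 0 <= Lk ^+ 2 by exact: sqr_ge0.
    by rewrite /G /freeze; rewrite /freeze in sk; move: sk s2 ths wq gq wt; nra.
  - have ct : continuous (fun q : V => q.2 - t).
      move=> q; apply: cvgB; [exact: cvg_snd|exact: cvg_cst].
    move=> q; apply: cvgD; [apply: cvgD; [apply: cvgD|]|].
    + exact: (lip_continuous lg).
    + exact: cvg_cst.
    + by apply: cvgM; [exact: ct|exact: (lip_continuous lk)].
    + apply: cvgD; apply: cvgM; [exact: cvg_cst| |exact: cvg_cst|exact: ct].
      rewrite expr2.
      by apply: cvgM; exact: ct.
  - move=> q tq.
    pose s := q.2 - t.
    have s0 : 0 < s by rewrite subr_gt0.
    pose l1 := (D' ^~ q); pose B1 i j := 2^-1 * D2' i j q.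
    pose l2 i := s * K1' i q + if i is None then freeze t0 k q else 0.
    pose B2 i j := s * (2^-1 * K2' i j q) + 0.
    pose l3 (i : I) := if i is None then 2 * C2 * s + th else 0.
    pose B3 (i j : I) := if (i, j) is (None, None) then C2 else 0.
    exists (fun i => l1 i + l2 i + l3 i), (fun i j => B1 i j + B2 i j + B3 i j).
    split.
      apply: upjet_add; first apply: upjet_add.
      + by apply: upjet_addc; exact: c2_upjet hD'.
      + by apply: upjet_time_mul tq lk _; exact: c2_upjet hK'.
      + by apply: upjet_jet_poly => q'; rewrite jet_poly_time /s; ring.
    move=> _; rewrite !ham_add -generator_ham ham_scale -generator_ham.
    rewrite !ham_zero//.
    have := ler_wpM2l (ltW s0) (kkb q).
    rewrite /l1 /l2 /l3 /D' /K1' (_ : generator D' D2' q = freeze t0 k q)//.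
    by lra.
  - by move=> q qt; rewrite /G qt subrr mul0r expr0n/= !mulr0 !addr0; exact: gw.
  - by rewrite tp lerDl sqr_ge0.
have o2 : p.2 - t = om ^+ 2 by rewrite tp addrAC subrr add0r.
have {main} : w p <= freeze t0 g p + e + om ^+ 2 * freeze t0 k p + C2 * om ^+ 4.
  (* The strictness [th] tends to 0 along $1/(n+1)$. *)
  apply: (@le_inv_succ _ _ _ (om ^+ 2)) => n.
  have := main n.+1%:R^-1; rewrite o2 invr_gt0 ltr0n => /(_ isT).
  have -> : (om ^+ 2) ^+ 2 = om ^+ 4 by rewrite -exprM.
  by rewrite (mulrC n.+1%:R^-1) addrA.
have /andP[om0 om1] := om01.
have o4 : om ^+ 4 <= om ^+ 3 by rewrite exprSr ler_piMr ?exprn_ge0.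
have C2o : C2 * om ^+ 4 <= C2 * om ^+ 3 by rewrite ler_wpM2l// (le_trans _ C20).
have := hC1 g D D2 hDD om (p.1, t0) om01; rewrite ler_norml => /andP[h _].
have fk : freeze t0 k p = generator D D2 (p.1, t0) by [].
have fg : freeze t0 g p = g (p.1, t0) by [].
rewrite fk fg; move: (generator D D2 _) h => X h hw; apply: (le_trans hw).
rewrite [(C1 + C2) * _]mulrDl.
clear -C2o h.
move: (walk _ _ _) (g _) (C2 * om ^+ 4) (C2 * om ^+ 3) (C1 * om ^+ 3)
  (om ^+ 2 * X) C2o h => A1 A2 A3 A4 A5 A6.

lra.
Qed.

Lemma small_step (s dl C : R) : 0 < s <= 1 -> 0 < dl -> 0 <= C -> exists2 N, (0 < N)%N &
  forall n, (N <= n)%N -> let om := Num.sqrt (s / n%:R) in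
  [/\ 0 <= om <= 1, n%:R * om ^+ 2 = s & C * om <= dl].
Proof.
move=> /andP[s0 s1] dl0 C0; pose N := (Num.truncn ((C / dl) ^+ 2)).+1.
exists N => // n Nn om.
have n0 : 0 < n%:R :> R by rewrite ltr0n (leq_trans _ Nn).
have om2 : om ^+ 2 = s / n%:R by apply/sqr_sqrtr/ltW/divr_gt0.
have om0 : 0 <= om by exact: sqrtr_ge0.
split.
- rewrite om0/= -(@ler_sqr _ om) ?nnegrE// expr1n om2 ler_pdivrMr// mul1r.
  by rewrite (le_trans s1)// ler1n (leq_trans _ Nn).
- by rewrite om2 mulrC divfK// gt_eqF.
- rewrite -(@ler_sqr _ (C * om)) ?nnegrE ?mulr_ge0// ?(ltW dl0)//.
  rewrite exprMn om2 mulrA ler_pdivrMr//.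
  have h : (C / dl) ^+ 2 <= n%:R.
    by apply/ltW/(lt_le_trans (truncnS_gt _)); rewrite ler_nat.
  apply: (@le_trans _ _ (dl ^+ 2 * (C / dl) ^+ 2)).
    have -> : dl ^+ 2 * (C / dl) ^+ 2 = C ^+ 2 by field; rewrite gt_eqF.
    by rewrite ler_piMr// sqr_ge0.
  by rewrite ler_wpM2l// sqr_ge0.
Qed.

Definition walks om n f := iter n (walk om) f.

Lemma walks_lip_jets om n m L f : lip_jets m L f -> lip_jets m L (walks om n f).
Proof. by move=> Cf; elim: n => //= n IH; exact: walk_lip_jets. Qed.

Lemma walks_le om n f g e (t : R) : (forall p, p.2 = t -> f p <= g p + e) ->
  forall p, p.2 = t -> walks om n f p <= walks om n g p + e.
Proof. by move=> fg; elim: n => //= n IH; exact: walk_le. Qed.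

Lemma mollify_walks r l om n L f : 0 < r -> lip L f ->
  mollify r l (walks om n f) = walks om n (mollify r l f).
Proof.
move=> r0 lf; elim: n => //= n IH.
have lw : lip L (walks om n f) by apply: (lip_jets_lip (m := 0)); exact: walks_lip_jets.
by rewrite /walk (mollify_comb l _ _ r0 lw) IH.
Qed.

(** The walk preserves [lip_jets 4 L], so [one_step] has the same constant at every iteration and
    the errors simply add up. *)
Lemma iterate_step L : exists2 C, 0 <= C & forall g, lip_jets 4 L g -> forall t0 e, tau <= t0 ->
  (forall p, p.2 = t0 -> w p <= g p + e) ->
  forall n om p, 0 <= om <= 1 -> p.2 = t0 + n%:R * om ^+ 2 ->
  w p <= walks om n g (p.1, t0) + e + n%:R * (C * om ^+ 3).
Proof.
have [C C0 hC] := one_step L; exists C => // g Cg t0 e ht gw.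
elim=> [|n IH] om p om01 tp.
  rewrite mul0r addr0; rewrite mul0r addr0 in tp.
  by rewrite (_ : (p.1, t0) = p); [exact: gw|rewrite -tp; case: (p)].
rewrite -natr1 mulrDl mul1r addrA -(addrA (walks om n.+1 g _) e).
apply: (hC (walks om n g) _ t0 (t0 + n%:R * om ^+ 2)).
- exact: walks_lip_jets.
- by rewrite (le_trans ht)// lerDl mulr_ge0// sqr_ge0.
- by move=> q tq; rewrite addrA; exact: IH.
- exact: om01.
- by rewrite tp -natr1; ring.
Qed.

(* [w] lies below the time-[s] value of the discrete heat flow started from [w]:
   after mollification each of the [n] steps costs only [O((s / n)^(3/2))]. *)
Lemma subsolution_le_walks (s dl : R) : 0 < s <= 1 -> 0 < dl -> exists2 N, (0 < N)%N &
  forall n, (N <= n)%N -> forall p, tau <= p.2 ->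
  w (p + (0, s)) <= walks (Num.sqrt (s / n%:R)) n w p + dl.
Proof.
move=> s01 dl0.
have kk0 := lip_ge0 w_lip.
pose c := (size (@mollify_axes d 4))%:R * kk + 1.
have c0 : 0 < c by rewrite /c ltr_pwDr// mulr_ge0.
(* The error [dl] is shared out: [dl / 4] for mollifying [w], [dl / 4] for returning to [w] under
   the walk, and [dl / 2] for the iteration. *)
pose r := dl / (4 * c).
have r0 : 0 < r by rewrite divr_gt0// mulr_gt0.
have [L CL] := mollify_smooth_iter 4 r0 w_lip.
have [C C0 hC] := iterate_step L.
pose e := dl / 4.
have e0 : 0 < e by rewrite divr_gt0.
have near_w p : `|mollify r (mollify_axes 4) w p - w p| <= e.
  apply: le_trans (mollify_near _ p r0 w_lip) _.
  apply: (@le_trans _ _ (c * r)); first by rewrite ler_wpM2r ?(ltW r0)// lerDl.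
  by rewrite /e /r le_eqVlt; apply/orP; left; apply/eqP; field; rewrite gt_eqF.
have dl2 : 0 < dl / 2 by rewrite divr_gt0.
have [N N0 hN] := small_step s01 dl2 C0.
exists N => // n Nn p tp.
have [om01 nom Com] := hN n Nn; set om := Num.sqrt _ in om01 nom Com *.
have /andP[om0 om1] := om01; have /andP[s0 s1] := s01.
have h1 q : q.2 = p.2 -> w q <= mollify r (mollify_axes 4) w q + e.
  by move=> _; have := near_w q; rewrite ler_norml => /andP[+ _]; lra.
have h2 q : q.2 = p.2 -> mollify r (mollify_axes 4) w q <= w q + e.
  by move=> _; have := near_w q; rewrite ler_norml => /andP[_]; lra.
have := hC _ CL p.2 e tp h1 n om (p + (0, s)).
rewrite om01 /= nom => /(_ isT erefl) h3.
have := walks_le om n h2 (p := p) erefl => h4.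
(* As $n\omega^2=s\le1$, the accumulated error is $Cs\omega\le C\omega$. *)
have h5 : n%:R * (C * om ^+ 3) <= dl / 2.
  have -> : n%:R * (C * om ^+ 3) = C * (n%:R * om ^+ 2) * om by ring.
  by rewrite nom; apply: le_trans Com; rewrite ler_wpM2r// ler_piMr.
have eE : e = dl / 4 by [].
rewrite (_ : (p.1 + 0, p.2) = p) in h3; last by rewrite addr0; case: (p).
by lra.
Qed.

(** Each step adds $\omega^2k$ up to $O(\omega^3)$, while averaging raises [k] itself by at most
    $C_3\omega^2$. Accumulated over $n$ steps, this second effect is of order $(n\omega^2)^2$. *)
Lemma walks_growth L f D D2 : c2_data L f D D2 ->
  (exists Lk, lip_jets 2 Lk (generator D D2)) ->
  exists2 C, 0 <= C & forall om n p, 0 <= om <= 1 ->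
  walks om n f p <= f p + n%:R * om ^+ 2 * generator D D2 p + n%:R * C * om ^+ 3
    + (n%:R * om ^+ 2) ^+ 2 * C.
Proof.
move=> hf [Lk Ck]; set k := generator D D2 in Ck *.
have [C1 C10 h1] := walk_consistent L.
have [C2 C20 h2] := walk_consistent Lk.
have [K1 [K2 [hK _ _ _]]] := lip_jets_c2_data Ck.
have [hK1 hK2 _] := hK.
have Lk0 := lip_ge0 (lip_jets_lip Ck).
pose C3 := C2 + generator_norm * Lk.
have C30 : 0 <= C3 by rewrite addr_ge0// mulr_ge0// generator_norm_ge0.
exists (C1 + C3); first by rewrite addr_ge0.
move=> om n p om01; have /andP[om0 om1] := om01.
have o2 : 0 <= om ^+ 2 by rewrite sqr_ge0.
have wk q : walk om k q <= k q + C3 * om ^+ 2.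
  have := h2 _ _ _ hK om q om01; rewrite ler_norml => /andP[_].
  have := generator_bound (hK1 ^~ q) (fun i j => hK2 i j q); rewrite ler_norml => /andP[_] h.
  have : om ^+ 2 * generator K1 K2 q <= om ^+ 2 * (generator_norm * Lk) by rewrite ler_wpM2l.
  have : C2 * om ^+ 3 <= C2 * om ^+ 2 by rewrite ler_wpM2l// exprSr ler_piMr.
  by rewrite /C3 mulrDl; lra.
have wf q : walk om f q <= f q + om ^+ 2 * k q + C1 * om ^+ 3.
  by have := h1 _ _ _ hf om q om01; rewrite ler_norml -/k => /andP[_]; lra.
have key q : walks om n f q <= f q + n%:R * om ^+ 2 * k q +
    (n%:R * C1 * om ^+ 3 + (n%:R * om ^+ 2) ^+ 2 * C3).
  elim: n q => [|n IH] q; first by rewrite !mul0r expr0n/= mul0r !addr0.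
  pose g q := f q + n%:R * om ^+ 2 * k q.
  have := @walk_le om (walks om n f) g _ q.2 (fun q' _ => IH q') q erefl.
  have -> : walk om g q = walk om f q + n%:R * om ^+ 2 * walk om k q.
    rewrite /walk mulr_sumr -big_split; apply: eq_bigr => ks _ /=.
    by rewrite /g; ring.
  have := wf q; have : n%:R * om ^+ 2 * walk om k q <= n%:R * om ^+ 2 * (k q + C3 * om ^+ 2).
    by rewrite ler_wpM2l// mulr_ge0.
  have : (n%:R * om ^+ 2) ^+ 2 * C3 + n%:R * om ^+ 2 * (C3 * om ^+ 2) <=
         (n.+1%:R * om ^+ 2) ^+ 2 * C3.
    rewrite -subr_ge0 -natr1.
    have -> : ((n%:R + 1) * om ^+ 2) ^+ 2 * C3 - ((n%:R * om ^+ 2) ^+ 2 * C3 +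
      n%:R * om ^+ 2 * (C3 * om ^+ 2)) = (n%:R + 1) * (om ^+ 2 * om ^+ 2 * C3) by ring.
    by rewrite mulr_ge0// ?addr_ge0// mulr_ge0// mulr_ge0.
  by rewrite /= -natr1; move: (walk om (walks om n f) q) => X; lra.
apply: le_trans (key p) _; rewrite -!addrA lerD2l lerD2l; apply: lerD.
  by rewrite ler_wpM2r ?exprn_ge0// ler_wpM2l// lerDl.
by rewrite ler_wpM2l ?sqr_ge0// lerDr.
Qed.

(* Being dominated by averages of translates is preserved by mollification, and for
   the smooth [W] it yields the differential inequality in the limit [s -> 0]. *)
Lemma mollified_subsolution r D D2 L : 0 < r ->
  let W := mollify r (mollify_axes 4) w in
  c2_data L W D D2 -> (forall i, lip_jets 2 L (D i)) -> (forall i j, lip_jets 2 L (D2 i j)) ->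
  (forall p z, `|W (p + z) - W p - \sum_i co z i * D i p| <= L * `|z| ^+ 2) ->
  forall p, tau <= p.2 -> D None p <= ham b a (D ^~ p) (fun i j => 2^-1 * D2 i j p).
Proof.
move=> r0 W hW CD CD2 hD1 p tp; rewrite -generator_ham.
have kC : exists Lk, lip_jets 2 Lk (generator D D2).
  by exists (generator_norm * L); exact: generator_lip_jets.
have [C C0 hC] := walks_growth hW kC.
set k := generator D D2 in hC *.
have lW : lip kk W by exact: mollify_lip.
have main s : 0 < s <= 1 -> W (p + (0, s)) <= W p + s * k p + s ^+ 2 * C.
  move=> s01; have /andP[s0 s1] := s01.
  apply/ler_addgt0Pr => e e0; have e2 : 0 < e / 2 by rewrite divr_gt0.
  have [N N0 hN] := subsolution_le_walks s01 e2.
  have [N' N'0 hN'] := small_step s01 e2 C0.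
  (* One number of steps must serve both the domination by walks and the bound on the growth
     error. *)
  pose n := maxn N N'.
  have Nn : (N <= n)%N by rewrite leq_maxl.
  have N'n : (N' <= n)%N by rewrite leq_maxr.
  have [om01 nom Com] := hN' n N'n; set om := Num.sqrt _ in om01 nom Com *.
  have /andP[om0 om1] := om01.
  have lsh : lip kk (fun q => w (q + (0, s))).
    by move=> q z; rewrite (addrAC q z); exact: w_lip.
  have lws : lip kk (walks om n w) by apply: (lip_jets_lip (m := 0)); exact: walks_lip_jets.
  have := @mollify_le _ _ r (mollify_axes 4) kk kk _ _ (e / 2) tau r0 lsh lws (hN n Nn) p tp.
  rewrite mollify_shift (mollify_walks _ _ _ r0 w_lip) -/W.
  have := hC om n p om01; rewrite nom.
  have : n%:R * C * om ^+ 3 <= e / 2.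
    have -> : n%:R * C * om ^+ 3 = C * (n%:R * om ^+ 2) * om by ring.
    by rewrite nom; apply: le_trans Com; rewrite ler_wpM2r// ler_piMr.
  by lra.
(* Division by $s=1/(n+1)$: [C] bounds the quadratic error of the walks, [L] that of the time
   derivative. *)
apply: (@le_inv_succ _ _ _ (C + L)) => n.
pose s : R := n.+1%:R^-1.
have s0 : 0 < s by rewrite invr_gt0 ltr0n.
have s1 : s <= 1 by rewrite invf_le1 ?ltr0n// ler1n.
have := main s; rewrite s0 s1 => /(_ isT).
have := hD1 p (0, s).
rewrite prod_normE/= normr0 (max_r (normr_ge0 s)) (gtr0_norm s0) sum_option big1 => [|i _]; last first.
  by rewrite /= mxE mul0r.
rewrite /= addr0 ler_norml => /andP[h1 _] h2.
rewrite -/s -(ler_pM2l s0); move: h1 h2; lra.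
Qed.

End Subsolution.
End Linear.
End RandomWalk.

(** * Comparison of the sum of the two subsolutions with a supersolution *)

Section Comparison.
Context {R : realType} {d : nat}.
Local Notation V := ('rV[R]_d * R)%type.
Local Notation I := (option 'I_d).
Implicit Types (p q z : V).

Lemma near_closed_ball p (P : V -> Prop) : (\forall q \near p, P q) ->
  exists2 r : R, 0 < r & forall q, `|q - p| <= r -> P q.
Proof.
move=> /nbhs_ballP[e /= e0 h]; exists (e / 2); first by rewrite divr_gt0.
move=> q qp; apply: h; rewrite -ball_normE /= distrC.
by apply: le_lt_trans qp _; rewrite ltr_pdivrMr// ltr_pMr// ltr1n.
Qed.

Lemma c2_neg L (f : V -> R) D D2 : c2_data L f D D2 ->
  c2_data L (fun p => - f p) (fun i p => - D i p) (fun i j p => - D2 i j p).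
Proof.
move=> [hD hD2 hT]; split=> [i p|i j p|p z]; rewrite ?normrN//.
rewrite -[leLHS]normrN; have := hT p z.
set X := (X in `|X| <= _ -> _); set Y := (Y in _ -> `|Y| <= _).
suff -> : Y = X by [].
have E1 : \sum_i co z i * - D i p = - \sum_i co z i * D i p.
  by rewrite -sumrN; apply: eq_bigr => i _; rewrite mulrN.
have E2 : \sum_i co z i * \sum_j co z j * - D2 i j p =
   - \sum_i co z i * \sum_j co z j * D2 i j p.
  rewrite -sumrN; apply: eq_bigr => i _; rewrite -mulrN -sumrN; congr (_ * _).
  by apply: eq_bigr => j _; rewrite mulrN.
by rewrite /Y /X E1 E2; ring.
Qed.

Variables (u w S : V -> R) (M rho : R).
Hypotheses (M0 : 0 < M) (u_bound : forall p, halfspace p -> `|u p| <= M)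
  (w_bound : forall p, halfspace p -> `|w p| <= M).
Hypothesis u_usc : forall p, 0 <= p.2 -> forall e, 0 < e ->
  \forall q \near p, 0 <= q.2 -> u q <= u p + e.
Hypothesis w_usc : forall p, 0 <= p.2 -> forall e, 0 < e ->
  \forall q \near p, 0 <= q.2 -> w q <= w p + e.
Hypothesis S_cont : continuous S.
Hypothesis S_init : forall p, p.2 = 0 -> u p + w p <= S p.
Hypothesis S_ge0 : forall p, 0 <= S p.
Hypothesis S_far : forall p, 0 <= p.2 -> rho < `|p.1| -> 2 * M <= S p.

(** Two points occur because the sup-convolution at [q] takes its value from [w] at a maximiser
    [q']. Semicontinuity gives a radius around each initial point, compactness a common one for
    $|x|\le\rho$, and [S_far] settles the rest. *)
Lemma initial_layer e : 0 < e -> exists2 r : R, 0 < r & forall q q',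
  halfspace q -> halfspace q' -> q.2 <= r -> `|q - q'| <= r -> u q + w q' <= S q + e.
Proof.
move=> e0; have e3 : 0 < e / 3 by rewrite divr_gt0.
pose P (r : R) (x : 'rV[R]_d) := forall q q', halfspace q -> halfspace q' ->
  q.1 = x -> q.2 <= r -> `|q - q'| <= r -> u q + w q' <= S q + e.
have cK : compact (closed_ball_ (fun y => `|y|) (0 : 'rV[R]_d) rho).
  apply: bounded_closed_compact; last exact: closed_closed_ball_.
  exists rho; split; first exact: num_real.
  by move=> y ry x; rewrite /closed_ball_/= sub0r normrN => /le_trans; apply; exact: ltW.
have cov : forall x, closed_ball_ (fun y => `|y|) (0 : 'rV[R]_d) rho x ->
    \forall x' \near x & r \near 0^'+, P r x'.
  move=> x _; pose p : V := (x, 0).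
  have p0 : 0 <= p.2 by [].
  have [r1 r10 h1] := near_closed_ball (u_usc p0 e3).
  have [r2 r20 h2] := near_closed_ball (w_usc p0 e3).
  have [r3 r30 h3] := near_closed_ball (cont_near p S_cont e3).
  pose r := Num.min r1 (Num.min r2 r3) / 2.
  have r0 : 0 < r by rewrite divr_gt0// !lt_min r10 r20.
  have rr : r + r <= Num.min r1 (Num.min r2 r3) by rewrite /r -splitr.
  move: rr; rewrite !le_min => /and3P[rr1 rr2 rr3].
  exists (closed_ball_ (fun y => `|y|) x r, [set r' | r' <= r]) => /=.
    split; last first.
      by apply: nbhs_right_le.
    apply: filterS (near_norm_le x r0) => y; rewrite /closed_ball_/= distrC.
    exact.
  move=> [x' r'] [/= xx' rr'] q q' hq hq' qx q2 qq'.
  have qp : `|q - p| <= r.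
    rewrite prod_normE ge_max /= qx subr0; apply/andP; split.
      by rewrite distrC.
    by rewrite ger0_norm// (le_trans q2).
  have qp' : `|q' - p| <= r + r.
    rewrite -(subrK q q') -addrA; apply: le_trans (ler_normD _ _) _; apply: lerD => //.
    by rewrite distrC (le_trans qq').
  have rrr : r <= r + r by rewrite lerDl ltW.
  have i1 := h1 q (le_trans qp (le_trans rrr rr1)) hq.
  have i2 := h2 q' (le_trans qp' rr2) hq'.
  have i3 := h3 q (le_trans qp (le_trans rrr rr3)).
  have := S_init (p := p) erefl; move: i3; rewrite ler_norml => /andP[_].
  by move: i1 i2; lra.
have /(compact_near_coveringP _).1 /(_ _ _ P _ cov) hP := cK.
have pos : \forall r \near 0^'+, (0 < r :> R) /\
    closed_ball_ (fun y => `|y|) (0 : 'rV[R]_d) rho `<=` P r.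
  by apply: filterS2 (nbhs_right_gt (0 : R)) hP => r.
have [r [r0 hr]] := @filter_ex R _ (at_right_proper_filter (0 : R)) _ pos.
exists r => // q q' hq hq' q2 qq'.
have [qr|qr] := leP `|q.1| rho.
  by apply: (hr q.1) => //; rewrite /closed_ball_/= sub0r normrN.
have := S_far hq qr; have := u_bound hq; have := w_bound hq'.
by rewrite !ler_norml => /andP[_ ?] /andP[_ ?]; lra.
Qed.

Variables (E : Type) (K : nat) (b : E -> 'rV[R]_d) (sigma : E -> 'M[R]_(d, K)) (Bb A : R).
Hypothesis K0 : (0 < K)%N.
Let a xi := sigma xi *m (sigma xi)^T.
Hypothesis E0 : inhabited E.
Hypothesis b_bound : forall xi k, `|b xi 0 k| <= Bb.
Hypothesis a_bound : forall xi k, `|a xi k k| <= A.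
Hypothesis u_sub : jet_subsolution b a 0 u.
Hypothesis w_sub : forall xi, jet_subsolution (fun _ : unit => b xi) (fun _ => a xi) 0 w.
Hypothesis S_super : forall p, exists l B, upjet S p l B /\
  forall xi, ham (b xi) (a xi) l B <= l None.

Lemma sum_subsolutions_le p : 0 <= p.2 -> u p + w p <= S p.
Proof.
rewrite le_eqVlt => /orP[/eqP/esym/S_init//|p0].
(* Of the three [e], one comes from the initial layer and two from replacing the sup-convolution by
   its mollification, at time [tau] and at [p]. The multiple of [p.2] comes from the strictness [e]
   per unit of time. *)
suff main e : 0 < e -> u p + w p <= S p + e * (3 + p.2).
  apply/ler_addgt0Pr => e e0; have q0 : 0 < 3 + p.2 by rewrite addr_gt0.
  have := main (e / (3 + p.2)); rewrite divr_gt0// => /(_ isT).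
  by rewrite divfK// gt_eqF.
move=> e0.
have [r r0 hr] := initial_layer e0.
(* This slope makes $2M/k=\min(r,p_t)$: the sup-convolution is a subsolution after a time not later
   than that of [p], and from that time its maximisers lie within [r], inside the initial layer. *)
pose k := 2 * M / Num.min r p.2.
have m0 : 0 < Num.min r p.2 by rewrite lt_min r0.
have k0 : 0 < k by rewrite divr_gt0// mulr_gt0.
pose tau := 2 * M / k.
have tauE : tau = Num.min r p.2.
  by rewrite /tau /k; field; rewrite !gt_eqF// mulr_gt0.
have tau0 : 0 < tau by rewrite tauE.
have taur : tau <= r by rewrite tauE ge_min lexx.
have taup : tau <= p.2 by rewrite tauE ge_min lexx orbT.
pose f := sconv k w.
have lf : lip k f by exact: sconv_lip w_bound.
have fb q : tau <= q.2 -> `|f q| <= M.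
  by move=> tq; apply: sconv_bound => //; exact: le_trans (ltW tau0) tq.
pose c := (size (@mollify_axes d 4))%:R * k + 1.
have c0 : 0 < c by rewrite /c ltr_pwDr// mulr_ge0// ltW.
pose s := e / c.
have s0 : 0 < s by rewrite divr_gt0.
pose W := mollify s (mollify_axes 4) f.
have Wf q : `|W q - f q| <= e.
  apply: le_trans (mollify_near _ q s0 lf) _.
  apply: (@le_trans _ _ (c * s)); first by rewrite ler_wpM2r ?(ltW s0)// lerDl.
  by rewrite /s mulrC divfK// gt_eqF.
have [L CL] := mollify_smooth_iter 4 s0 lf.
have [D [D2 [hD CD CD2 hD1]]] := lip_jets_c2_data CL.
have Wsub xi q : tau <= q.2 ->
    D None q <= ham (b xi) (a xi) (D ^~ q) (fun i j => 2^-1 * D2 i j q).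
  have jf := sconv_jet k0 w_bound w_usc (@w_sub xi).
  by apply: (mollified_subsolution K0 lf fb jf s0 hD) => // i; exact: lip_jets_pred (CD i).
(* The slope [e] in time is the strictness needed by [jet_comparison]; the null term gives the last
   summand the shape of [jet_poly_time]. *)
pose G q := S q + - W q + (2 * e + (q.2 - tau) * (e + 0 * (q.2 - tau))).
have uG q : tau <= q.2 -> u q <= G q.
  have usc q' : tau <= q'.2 -> forall e', 0 < e' ->
      \forall q'' \near q', tau <= q''.2 -> u q'' <= u q' + e'.
    move=> tq e' e'0; apply: filterS (u_usc (le_trans (ltW tau0) tq) e'0) => q'' h tq''.
    by apply: h; exact: le_trans (ltW tau0) tq''.
  apply: (@jet_comparison R d E b a A Bb (2 * M + e) tau e u G E0 e0 b_bound a_bound) => //.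
  - by move=> q' tq; apply: u_sub; exact: lt_trans tau0 tq.
  - move=> q' tq; have := u_bound (le_trans (ltW tau0) tq); have := fb q' tq.
    have := Wf q'; have := S_ge0 q'.
    have : 0 <= (q'.2 - tau) * e by rewrite mulr_ge0 ?(ltW e0)// subr_ge0.
    rewrite /G mul0r addr0 !ler_norml; move: ((q'.2 - tau) * e) => y.
    by move=> ? ? /andP[? ?] /andP[? ?] /andP[? ?]; lra.
  - have ct : continuous (fun q : V => q.2 - tau).
      by move=> q'; apply: cvgB; [exact: cvg_snd|exact: cvg_cst].
    have cW : continuous W by exact: lip_continuous (lip_jets_lip CL).
    move=> q'; apply: cvgD; [apply: cvgD|apply: cvgD].
    + exact: S_cont.
    + by apply: cvgN; exact: cW.
    + exact: cvg_cst.
    + apply: cvgM; first exact: ct.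
      apply: cvgD; first exact: cvg_cst.
      by apply: cvgM; [exact: cvg_cst|exact: ct].
  - move=> q' tq; have [lS [BS [jS hS]]] := S_super q'.
    have jW := c2_upjet q' (c2_neg hD).
    pose lt (i : I) := if i is None then e else 0.
    pose Bt (i j : I) : R := if (i, j) is (None, None) then 0 else 0.
    exists (fun i => lS i + - D i q' + lt i), (fun i j => BS i j + 2^-1 * - D2 i j q' + Bt i j).
    split.
      apply: upjet_add; first exact: upjet_add.
      apply: upjet_jet_poly => q''.
      by rewrite /Bt /lt jet_poly_time; ring.
    move=> xi; rewrite !ham_add [ham _ _ lt Bt]ham_zero// addr0.
    have := hS xi; have := Wsub xi q' (ltW tq).
    have -> : ham (b xi) (a xi) (fun i => - D i q') (fun i j => 2^-1 * - D2 i j q') =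
      - ham (b xi) (a xi) (D ^~ q') (fun i j => 2^-1 * D2 i j q').
      rewrite -mulN1r -ham_scale; congr ham; first by apply/funext => i; rewrite mulN1r.
      by apply/funext => i; apply/funext => j; ring.
    by rewrite /lt; lra.
  - move=> q' tq; rewrite /G tq subrr mul0r addr0.
    have hq' : halfspace q' by rewrite /halfspace/= tq ltW.
    have [q'' [hq'' kq fE]] := sconv_attained k0 w_bound w_usc hq'.
    have diff_quotient : `|q' - q''| <= tau by rewrite /tau ler_pdivlMr// mulrC.
    have := hr q' q'' hq' hq'' (ltac:(by rewrite tq)) (le_trans diff_quotient taur).
    have : 0 <= k * `|q' - q''| by rewrite mulr_ge0// ltW.
    have := Wf q'; rewrite ler_norml /f fE => /andP[_].
    by move: (k * _) => y; lra.
have hp : halfspace p by exact: ltW.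
have := uG p taup; have := sconv_ge_self k0 w_bound hp; have := Wf p.
rewrite /G mul0r addr0 ler_norml => /andP[h1 _] h2 h3.
rewrite mulrBl in h3; have : 0 <= tau * e by rewrite mulr_ge0// ltW.
rewrite -/f in h2; rewrite mulrDr (mulrC e p.2); move: (tau * e) (p.2 * e) h3 => y z; lra.
Qed.

End Comparison.

(** * Supersolutions built from exponentials *)

Section Barriers.
Context {R : realType} {d : nat}.
Local Notation V := ('rV[R]_d * R)%type.
Local Notation I := (option 'I_d).
Implicit Types (p q z : V) (f g S : V -> R).

(** From $e^{-r}\ge1-r$ and $(1+r+2r^2)(1-r)=1+r^2(1-2r)\ge1$. *)
Lemma expR_le_quadratic (r : R) : r <= 2^-1 -> expR r <= 1 + r + 2 * r ^+ 2.
Proof.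
move=> r2; have h := expR_ge1Dx (- r).
have r1 : 0 < 1 - r by lra.
have {}h : expR r * (1 - r) <= 1.
  by have := ler_wpM2l (expR_ge0 r) h; rewrite expRxMexpNx_1.
rewrite -(ler_pM2r r1); apply: le_trans h _.
by rewrite -subr_ge0 (_ : _ - 1 = r ^+ 2 * (1 - 2 * r)); [rewrite mulr_ge0 ?sqr_ge0//; lra|ring].
Qed.

Lemma co_continuous (i : I) : continuous (fun q : V => co q i).
Proof.
by apply: (@lip_continuous R d 1) => q z; rewrite coD addrAC subrr add0r mul1r co_le.
Qed.

Lemma upjet_touch f g p l B : upjet g p l B -> f p = g p -> (forall q, f q <= g q) ->
  upjet f p l B.
Proof.
move=> hg fgp fg e e0; have [L h] := hg e e0; exists L; apply: filterS h => q.
by rewrite fgp; exact: le_trans.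
Qed.

(** The Hessian $B+B^T$ is four times the true one: this is the price of a quadratic upper bound
    valid in a whole neighbourhood, with no error term. *)
Lemma upjet_exp (c : R) (lam : I -> R) p :
  let f q := expR (c + \sum_i lam i * co q i) in
  upjet f p (fun i => f p * lam i) (fun i j => 2 * f p * lam i * lam j).
Proof.
move=> f e e0; exists 0.
have cl : continuous (fun q : V => \sum_i lam i * co q i).
  apply: cont_sum => i q; apply: cvgM; first exact: cvg_cst.
  exact: co_continuous.
have h2 : 0 < 2^-1 :> R by rewrite invr_gt0.
apply: filterS (cont_near p cl h2) => q; rewrite ler_norml => /andP[h _].
pose r := \sum_i lam i * co (q - p) i.
have rE : r = \sum_i lam i * co q i - \sum_i lam i * co p i.
  by rewrite -sumrB; apply: eq_bigr => i _; rewrite coD coN; ring.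
have fE : f q = f p * expR r by rewrite /f -expRD rE; congr expR; ring.
rewrite jet_poly_diagD fE.
have -> : jet_poly p (f p) (fun i => f p * lam i) (fun i j => 2 * f p * lam i * lam j) q =
    f p * (1 + r + 2 * r ^+ 2).
  rewrite /jet_poly (eq_bigr (fun i => f p * (lam i * co (q - p) i) +
      2 * f p * r * (lam i * co (q - p) i))); last first.
    move=> i _; rewrite [X in _ * (_ + X)](_ : _ = 2 * f p * lam i * r).
      by ring.
    by rewrite /r mulr_sumr; apply: eq_bigr => j _; ring.
  by rewrite big_split -!mulr_sumr -/r /=; ring.
apply: (@le_trans _ _ (f p * (1 + r + 2 * r ^+ 2))).
  rewrite ler_pM2l ?expR_gt0//; apply: expR_le_quadratic.
  by rewrite rE; lra.
by rewrite lerDl diag_pol_ge0// ltW.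
Qed.

Variables (E : Type) (b : E -> 'rV[R]_d) (a : E -> 'M[R]_d) (Bb A : R).
Hypothesis b_bound : forall xi k, `|b xi 0 k| <= Bb.
Hypothesis a_bound : forall xi k m, `|a xi k m| <= A.

Definition supersol S := forall p, exists l B, upjet S p l B /\
  forall xi, ham (b xi) (a xi) l B <= l None.

(** A growth rate in time that beats drift and diffusion for all slopes at most 1 per coordinate;
    the 4 is the overestimate made in [upjet_exp]. *)
Definition kappa : R := d%:R * Bb + 4 * (d%:R ^+ 2 * A).

Lemma supersol_exp_jet c (lam : I -> R) p :
  (forall k, `|lam (Some k)| <= 1) -> lam None = kappa ->
  let f q := expR (c + \sum_i lam i * co q i) in
  forall xi, ham (b xi) (a xi) (fun i => f p * lam i)
    (fun i j => 2 * f p * lam i * lam j) <= f p * lam None.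
Proof.
move=> lam1 -> f xi.
have -> : ham (b xi) (a xi) (fun i => f p * lam i) (fun i j => 2 * f p * lam i * lam j) =
  f p * (\sum_k b xi 0 k * lam (Some k) +
    4 * \sum_k \sum_m a xi k m * (lam (Some k) * lam (Some m))).
  rewrite /ham mulrDr !mulr_sumr; congr (_ + _).
    by apply: eq_bigr => k _; ring.
  apply: eq_bigr => k _; rewrite !mulr_sumr; apply: eq_bigr => m _; ring.
rewrite ler_pM2l ?expR_gt0// /kappa; apply: lerD.
  apply: (@le_trans _ _ (\sum_(k < d) Bb)); last by rewrite sumr_const card_ord mulr_natl.
  apply: ler_sum => k _; apply: le_trans (ler_norm _) _; rewrite normrM -[Bb]mulr1.
  by apply: ler_pM.
rewrite ler_pM2l//.
apply: (@le_trans _ _ (\sum_(k < d) \sum_(m < d) A)); last first.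
  by rewrite !sumr_const card_ord -mulrnA -[leLHS]mulr_natl natrM expr2.
apply: ler_sum => k _; apply: ler_sum => m _; apply: le_trans (ler_norm _) _.
rewrite normrM -[A]mulr1; apply: ler_pM => //.
by rewrite normrM mulr_ile1.
Qed.

Lemma supersol_exp c (lam : I -> R) :
  (forall k, `|lam (Some k)| <= 1) -> lam None = kappa ->
  supersol (fun q => expR (c + \sum_i lam i * co q i)).
Proof.
move=> lam1 lamN p; eexists; eexists; split; first exact: upjet_exp.
by move=> xi; exact: supersol_exp_jet.
Qed.

(** The kinks at $x_k=y_k$ are concave: the exponential of a linear function, with either sign of
    the slope there, touches from above and provides the superjet. This allows the 1-norm without
    smoothing. *)
Lemma supersol_peak (y : 'rV[R]_d) :
  supersol (fun q => expR (kappa * q.2 - \sum_k `|q.1 0 k - y 0 k|)).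
Proof.
move=> p.
pose s k : R := if 0 <= p.1 0 k - y 0 k then 1 else -1.
pose lam (i : I) := if i is Some k then - s k else kappa.
pose c := \sum_k s k * y 0 k.
have E1 q : c + \sum_i lam i * co q i = kappa * q.2 - \sum_k s k * (q.1 0 k - y 0 k).
  rewrite sum_option addrCA; congr (_ + _); rewrite /c -sumrN -big_split.
  by apply: eq_bigr => k _ /=; ring.
have lam1 k : `|lam (Some k)| <= 1.
  by rewrite /= normrN /s; case: ifP; rewrite ?normrN normr1.
have := supersol_exp_jet c p lam1 erefl => /= H.
eexists; eexists; split; last exact: H.
apply: (upjet_touch (upjet_exp c lam p)) => [|q].
  rewrite E1; congr (expR (_ - _)); apply: eq_bigr => k _.
  by rewrite /s; case: ifPn => [h|]; [rewrite mul1r ger0_norm|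
    rewrite -ltNge => h; rewrite mulN1r ltr0_norm].
rewrite E1 ler_expR lerD2l lerN2; apply: ler_sum => k _.
apply: le_trans (ler_norm _) _; rewrite normrM.
by rewrite /s; case: ifP; rewrite ?normrN normr1 mul1r.
Qed.

Lemma supersol_growth (k : 'I_d) (s : bool) :
  supersol (fun q => expR (kappa * q.2 + (-1) ^+ s * q.1 0 k)).
Proof.
pose lam (i : I) : R := if i is Some m then (-1) ^+ s * (m == k)%:R else kappa.
rewrite (_ : (fun q => _) = (fun q => expR (0 + \sum_i lam i * co q i))).
  apply: supersol_exp => // m; rewrite /lam normrM normrX normrN normr1 expr1n mul1r.
  by case: eqP; rewrite ?normr1 ?normr0.
apply/funext => q; rewrite add0r sum_option; congr (expR (_ + _)).
rewrite (bigD1 k)//= eqxx mulr1 big1 ?addr0// => m mk.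
by rewrite /lam (negbTE mk) mulr0 mul0r.
Qed.

Lemma supersol0 : supersol (fun=> 0).
Proof.
move=> p; exists (fun=> 0), (fun _ _ => 0); split; last first.
  by move=> xi; rewrite ham_zero.
apply: upjet_jet_poly => q; rewrite /jet_poly big1 ?addr0// => i _.
by rewrite big1 ?addr0 ?mulr0// => j _; rewrite mul0r.
Qed.

Lemma supersolD S1 S2 : supersol S1 -> supersol S2 -> supersol (fun q => S1 q + S2 q).
Proof.
move=> h1 h2 p; have [l1 [B1 [j1 i1]]] := h1 p; have [l2 [B2 [j2 i2]]] := h2 p.
eexists; eexists; split; first exact: upjet_add j1 j2.
by move=> xi; rewrite ham_add; exact: lerD.
Qed.

Lemma supersolZ c S : 0 <= c -> supersol S -> supersol (fun q => c * S q).
Proof.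
rewrite le_eqVlt => /orP[/eqP <- _|c0 h p].
  by rewrite (_ : (fun q => _) = fun=> 0); [exact: supersol0|apply/funext => q; rewrite mul0r].
have [l [B [j i]]] := h p.
eexists; eexists; split; first exact: upjet_scale j.
by move=> xi; rewrite ham_scale ler_pM2l.
Qed.

Lemma supersol_sum (J : Type) (s : seq J) (c : J -> R) (F : J -> V -> R) :
  (forall j, 0 <= c j) -> (forall j, supersol (F j)) ->
  supersol (fun q => \sum_(j <- s) c j * F j q).
Proof.
move=> c0 hF; elim: s => [|j s IH].
  by rewrite (_ : (fun q => _) = fun=> 0); [exact: supersol0|apply/funext => q; rewrite big_nil].
rewrite (_ : (fun q => _) = fun q => c j * F j q + \sum_(j <- s) c j * F j q).
  by apply: supersolD => //; exact: supersolZ.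
by apply/funext => q; rewrite big_cons.
Qed.

Definition barrier (J : finType) (y : J -> 'rV[R]_d) (m : J -> R) (eta : R) q :=
  \sum_j m j * expR (kappa * q.2 - \sum_k `|q.1 0 k - y j 0 k|) +
  eta * \sum_k (expR (kappa * q.2 + q.1 0 k) + expR (kappa * q.2 - q.1 0 k)).

Lemma barrier_supersol (J : finType) (y : J -> 'rV[R]_d) (m : J -> R) (eta : R) :
  (forall j, 0 <= m j) -> 0 <= eta -> supersol (barrier y m eta).
Proof.
move=> m0 eta0; apply: supersolD.
  by apply: (supersol_sum _ (F := fun j q => expR (kappa * q.2 -
    \sum_k `|q.1 0 k - y j 0 k|))) => // j; exact: supersol_peak.
apply: supersolZ => //.
rewrite (_ : (fun q => _) = (fun q => \sum_k 1 * (expR (kappa * q.2 + (-1) ^+ false * q.1 0 k) +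
    expR (kappa * q.2 + (-1) ^+ true * q.1 0 k)))).
  apply: (supersol_sum _ (F := fun k q => expR (kappa * q.2 + (-1) ^+ false * q.1 0 k) +
    expR (kappa * q.2 + (-1) ^+ true * q.1 0 k))) => // k.
  by apply: supersolD; exact: supersol_growth.
by apply/funext => q; apply: eq_bigr => k _; rewrite mul1r expr0 expr1 mul1r mulN1r.
Qed.

Lemma barrier_continuous (J : finType) (y : J -> 'rV[R]_d) (m : J -> R) (eta : R) :
  continuous (barrier y m eta).
Proof.
have c1 (k : 'I_d) : continuous (fun q : V => q.1 0 k : R) := @co_continuous (Some k).
have c2 : continuous (fun q : V => kappa * q.2).
  by move=> q; apply: cvgM; [exact: cvg_cst|exact: cvg_snd].
have ce (f : V -> R) : continuous f -> continuous (fun q => expR (f q)).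
  by move=> cf q; apply: (@continuous_comp _ _ _ f expR); [exact: cf|exact: continuous_expR].
move=> q; apply: cvgD.
  apply: cont_sum => j {}q; apply: cvgM; first exact: cvg_cst.
  apply: ce => {}q; apply: cvgB; first exact: c2.
  apply: cont_sum => k {}q; apply: cvg_norm; apply: cvgB; [exact: c1|exact: cvg_cst].
apply: cvgM; first exact: cvg_cst.
apply: cont_sum => k {}q; apply: cvgD; apply: ce => {}q.
  by apply: cvgD; [exact: c2|exact: c1].
by apply: cvgB; [exact: c2|exact: c1].
Qed.

Lemma barrier_ge0 (J : finType) (y : J -> 'rV[R]_d) (m : J -> R) (eta : R) q :
  (forall j, 0 <= m j) -> 0 <= eta -> 0 <= barrier y m eta q.
Proof.
move=> m0 eta0; rewrite addr_ge0//.
  by apply: sumr_ge0 => j _; rewrite mulr_ge0// expR_ge0.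
by rewrite mulr_ge0// sumr_ge0// => k _; rewrite addr_ge0// expR_ge0.
Qed.

(** By $e^r\ge1+r$, one of the two exponentials in the coordinate [k] already exceeds [rho]. *)
Lemma barrier_far (J : finType) (y : J -> 'rV[R]_d) (m : J -> R) (eta rho : R) q :
  0 <= kappa -> (forall j, 0 <= m j) -> 0 < eta -> 0 <= rho -> 0 <= q.2 ->
  (exists k, rho <= `|q.1 0 k|) -> eta * rho <= barrier y m eta q.
Proof.
move=> k0 m0 eta0 rho0 q0 [k qk]; rewrite /barrier.
apply: (@le_trans _ _ (eta * (expR (kappa * q.2 + q.1 0 k) + expR (kappa * q.2 - q.1 0 k)))).
  rewrite ler_pM2l//; apply: (le_trans qk).
  have kq : 0 <= kappa * q.2 by rewrite mulr_ge0.
  have := expR_ge0 (kappa * q.2 + q.1 0 k); have := expR_ge0 (kappa * q.2 - q.1 0 k).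
  have := expR_ge1Dx (kappa * q.2 + q.1 0 k); have := expR_ge1Dx (kappa * q.2 - q.1 0 k).
  by case: (ger0P (q.1 0 k)); lra.
apply: (@le_trans _ _ (eta *
  \sum_k (expR (kappa * q.2 + q.1 0 k) + expR (kappa * q.2 - q.1 0 k)))).
  rewrite ler_pM2l// [leRHS](bigD1 k)//= lerDl sumr_ge0// => j _.
by rewrite lerDr; apply: sumr_ge0 => j _; rewrite mulr_ge0// expR_ge0.
Qed.

End Barriers.

(** * Unit cells, sums over lattice points, and the bound cell by cell *)

Section Lattice.
Context {R : realType}.

Lemma sum_expR_dist (c : R) n : \sum_(i < n) expR (- `|i%:R - c|) <= 5.
Proof.
(* A potential for telescoping: it lies below 5 and increases by at least $e^{-|r|}$ over a unit
   step. The constant 5 is dictated by the step across 0, where $3e^r+2e^{-(r+1)}\le3+2$. *)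
pose Phi (r : R) := if r < 0 then 2 * expR r else 5 - 2 * expR (- r).
have half (r : R) : 2 * expR r <= expR (r + 1).
  by rewrite expRD mulrC ler_pM2l ?expR_gt0//; have := expR_ge1Dx (1 : R); lra.
have Phi5 r : Phi r <= 5.
  rewrite /Phi; case: ltP => r0; last by have := expR_ge0 (- r); lra.
  have : expR r <= 1 by rewrite -expR0 ler_expR ltW.
  by lra.
have step (r : R) : Phi r + expR (- `|r|) <= Phi (r + 1).
  rewrite /Phi; have e0 := expR_gt0 r; have h1 := half r.
  case: ltP => r0.
    rewrite ltr0_norm// opprK; case: ltP => r1; first by lra.
    have h2 : expR r <= 1 by rewrite -expR0 ler_expR ltW.
    have h3 : expR (- (r + 1)) <= 1 by rewrite -[leRHS]expR0 ler_expR oppr_le0.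
    by lra.
  rewrite ger0_norm// ltNge (_ : 0 <= r + 1) /=; last by lra.
  have := half (- (r + 1)); rewrite (_ : - (r + 1) + 1 = - r); last by ring.
  by lra.
suff h : \sum_(i < n) expR (- `|i%:R - c|) <= Phi (n%:R - c).
  exact: le_trans h (Phi5 _).
elim: n => [|n IH].
  rewrite big_ord0 /Phi; case: ltP => r0; first by rewrite mulr_ge0// expR_ge0.
  have : expR (- (0%:R - c)) <= 1 by rewrite -[leRHS]expR0 ler_expR oppr_le0.
  by lra.
rewrite big_ord_recr /=; apply: (le_trans (lerD IH (lexx _))).
rewrite -natr1 addrAC; exact: step.
Qed.

(** The lattice points of $\{-N,\dots,N-1\}^d$; as finite functions they let a sum of products
    factor over the coordinates. *)
Definition corner d N (j : {ffun 'I_d -> 'I_(N.*2)}) : 'rV[R]_d :=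
  \row_i ((j i)%:R - N%:R).

Lemma sum_corner_le d N (y : 'rV[R]_d) :
  \sum_(z : {ffun 'I_d -> 'I_(N.*2)}) expR (- \sum_k `|corner z 0 k - y 0 k|) <= 5 ^+ d.
Proof.
under eq_bigr => z _.
  rewrite -sumrN expR_sum.
  under eq_bigr => k _ do rewrite mxE -addrA -opprD.
  over.
rewrite -(bigA_distr_bigA (fun k (i : 'I_(N.*2)) => expR (- `|i%:R - (N%:R + y 0 k)|))).
rewrite -[X in 5 ^+ X]card_ord -prodr_const; apply: ler_prod => k _.
by rewrite sum_expR_dist andbT; apply: sumr_ge0 => i _; exact: expR_ge0.
Qed.

(** Half-open, so that the cells are disjoint and tile $[-N,N)^d$. *)
Definition cell d N (j : {ffun 'I_d -> 'I_(N.*2)}) : set 'rV[R]_d :=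
  [set x | forall i, corner j 0 i <= x 0 i < corner j 0 i + 1].

Lemma corner_cell d N (j : {ffun 'I_d -> 'I_(N.*2)}) : cell j (corner j).
Proof. by move=> i; rewrite lexx ltrDl ltr01. Qed.

Lemma cell_cover d N (x : 'rV[R]_d) : (forall i, - N%:R <= x 0 i < N%:R) ->
  exists j : {ffun 'I_d -> 'I_(N.*2)}, cell j x.
Proof.
move=> xN.
have h i : exists k : 'I_(N.*2), k%:R - N%:R <= x 0 i < k%:R - N%:R + 1.
  have /andP[x1 x2] := xN i.
  have x0 : 0 <= x 0 i + N%:R by lra.
  have /andP[t1 t2] := truncn_itv x0.
  have tN : (Num.trunc (x 0 i + N%:R)%R < N.*2)%N.
    by rewrite -(ltr_nat R) -addnn natrD; apply: le_lt_trans t1 _; lra.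
  by exists (Ordinal tN) => /=; move: t1 t2; rewrite -natr1; lra.
have [k kP] := choice h; exists [ffun i => k i] => i.
by rewrite !mxE ffunE.
Qed.

Lemma cell_dist d N (j : {ffun 'I_d -> 'I_(N.*2)}) x : cell j x ->
  forall i, `|x 0 i - corner j 0 i| <= 1.
Proof. by move=> jx i; have /andP[h1 h2] := jx i; rewrite ger0_norm; lra. Qed.

(** This is the use of cubes of half-width 1: the supremum over a whole cell is bounded by the
    right-hand integrand at every point of that cell. *)
Lemma cell_sub d N (j : {ffun 'I_d -> 'I_(N.*2)}) x : cell j x ->
  cell j `<=` closed_unit_cube x.
Proof.
move=> jx y jy i; have /andP[h1 h2] := jx i; have /andP[h3 h4] := jy i.
by rewrite ler_norml; lra.
Qed.

Lemma cell_inj d N (j k : {ffun 'I_d -> 'I_(N.*2)}) x : cell j x -> cell k x -> j = k.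
Proof.
move=> jx kx; apply/ffunP => i; apply: val_inj => /=.
have := jx i; have := kx i; rewrite !mxE => /andP[h1 h2] /andP[h3 h4].
have : (k i)%:R < (j i)%:R + 1 :> R by lra.
have : (j i)%:R < (k i)%:R + 1 :> R by lra.
rewrite !natr1 !ltr_nat !ltnS => h5 h6.
by apply/eqP; rewrite eqn_leq h5.
Qed.

Section Tiles.
Context {d : nat}.
Local Notation V := ('rV[R]_d * R)%type.
Variables (E : Type) (b : E -> 'rV[R]_d) (a : E -> 'M[R]_d) (Bb A : R).
Hypotheses (Bb_ge0 : 0 <= Bb) (A_ge0 : 0 <= A).
Hypothesis b_bound : forall xi k, `|b xi 0 k| <= Bb.
Hypothesis a_bound : forall xi k m, `|a xi k m| <= A.
Variables (v : V -> R) (M : R).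
Hypothesis M0 : 0 < M.
Hypothesis v_le : forall p : V, 0 <= p.2 -> v p <= M.
Hypothesis cmp : forall (S : V -> R) (rho : R), continuous S -> (forall p : V, 0 <= S p) ->
  (forall p : V, p.2 = 0 -> v p <= S p) ->
  (forall p : V, 0 <= p.2 -> rho < `|p.1| -> M <= S p) ->
  supersol b a S -> forall p : V, 0 <= p.2 -> v p <= S p.

Let kap := @kappa R d Bb A.
Let kap_ge0 : 0 <= kap.
Proof. by rewrite addr_ge0 ?mulr_ge0 ?exprn_ge0 ?ler0n. Qed.

Definition cell_sup N (j : {ffun 'I_d -> 'I_(N.*2)}) : R :=
  sup [set Num.max (v (x, 0)) 0 | x in cell j].

Let cell_has_sup N (j : {ffun 'I_d -> 'I_(N.*2)}) :
  has_sup [set Num.max (v (x, 0)) 0 | x in cell j].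
Proof.
split; first by exists (Num.max (v (corner j, 0)) 0), (corner j) => //; exact: corner_cell.
by exists M => _ [x _ <-]; rewrite ge_max v_le/= ?lexx ?(ltW M0).
Qed.

Lemma cell_sup_ub N (j : {ffun 'I_d -> 'I_(N.*2)}) x : cell j x ->
  Num.max (v (x, 0)) 0 <= cell_sup j.
Proof. by move=> jx; apply: sup_upper_bound; [exact: cell_has_sup|exists x]. Qed.

Lemma cell_sup_lub N (j : {ffun 'I_d -> 'I_(N.*2)}) r :
  (forall x, cell j x -> Num.max (v (x, 0)) 0 <= r) -> cell_sup j <= r.
Proof.
move=> h; apply: ge_sup; first by have [] := cell_has_sup j.
by move=> _ [x jx <-]; exact: h.
Qed.

Lemma cell_sup_ge0 N (j : {ffun 'I_d -> 'I_(N.*2)}) : 0 <= cell_sup j.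
Proof. by apply: le_trans (cell_sup_ub (corner_cell j)); rewrite le_max lexx orbT. Qed.

(** On a cell $|x-y_j|_1\le d$, so the factor $e^d$ lifts its own peak above [cell_sup j] at time 0.
    The weight $M/N$ makes the growth term reach [M] as soon as some $|x_k|\ge N$. *)
Lemma barrier_dominates N (p : V) : (0 < N)%N -> 0 <= p.2 ->
  v p <= barrier Bb A (@corner d N) (fun j => expR d%:R * cell_sup j) (M / N%:R) p.
Proof.
move=> N0; have N1 : 0 < N%:R :> R by rewrite ltr0n.
have eta0 : 0 < M / N%:R by rewrite divr_gt0.
have m0 (j : {ffun 'I_d -> 'I_(N.*2)}) : 0 <= expR d%:R * cell_sup j.
  by rewrite mulr_ge0 ?expR_ge0// cell_sup_ge0.
have far (q : V) : 0 <= q.2 -> (exists k, N%:R <= `|q.1 0 k|) ->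
    M <= barrier Bb A (@corner d N) (fun j => expR d%:R * cell_sup j) (M / N%:R) q.
  move=> q0 qk; rewrite -[M in leLHS](@divfK _ N%:R) ?gt_eqF//.
  by apply: barrier_far => //; exact: ltW.
apply: (cmp (rho := N%:R)).
- exact: barrier_continuous.
- by move=> q; apply: barrier_ge0 => //; exact: ltW.
- move=> q q0.
  have [h|/existsNP[k]] := pselect (forall i, - N%:R <= q.1 0 i < N%:R); last first.
    move=> qk; apply: le_trans (v_le _) (far q _ _); rewrite ?q0//.
    exists k; apply: contra_notT qk; rewrite -ltNge ltr_norml => /andP[h1 h2].
    by rewrite (ltW h1).
  have [j jq] := cell_cover h.
  have vq : v q <= cell_sup j.
    by apply: le_trans (cell_sup_ub jq); rewrite -q0 -surjective_pairing le_max lexx.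
  apply: (le_trans vq); rewrite /barrier q0 mulr0 (bigD1 j)//= -!addrA -[leLHS]addr0.
  apply: lerD; last first.
    apply: addr_ge0; first by apply: sumr_ge0 => i _; rewrite mulr_ge0 ?expR_ge0.
    by rewrite mulr_ge0 ?(ltW eta0)// sumr_ge0// => i _; rewrite addr_ge0 ?expR_ge0.
  rewrite mulrAC -expRD -[leLHS]mul1r ler_wpM2r ?cell_sup_ge0// -[X in X <= _]expR0 ler_expR.
  rewrite add0r subr_ge0; apply: (@le_trans _ _ (\sum_(k < d) 1)).
    by apply: ler_sum => i _; exact: cell_dist.
  by rewrite sumr_const card_ord.
- move=> q q0 qN; apply: far => //; apply: contrapT => /forallNP h.
  move: qN; rewrite ltNge => /negP; apply; apply: mx_norm_le => [|i k]; first exact: ltW.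
  by rewrite ord1; have /negP := h k; rewrite -ltNge => /ltW.
- by apply: barrier_supersol => //; exact: ltW.
Qed.

(** The factor $e^{3d}$ is $e^d$ from the barrier times $e^{2d}$ for moving [y] to the corner of the
    cell [z], at most 2 in each coordinate. Summing over [z] before [j] gives $5^d$. *)
Lemma tiles_bound T I N e : 0 <= T -> 0 < e ->
  (forall n, \sum_(j : {ffun 'I_d -> 'I_(n.*2)}) cell_sup j <= I) ->
  exists c : {ffun 'I_d -> 'I_(N.*2)} -> R, [/\ forall z, 0 <= c z,
    (forall z x y s, cell z x -> closed_unit_cube x y -> 0 <= s <= T -> v (y, s) <= c z) &
    \sum_z c z <= expR (kap * T) * expR (3 * d%:R) * 5 ^+ d * I + e].
Proof.
move=> T0 e0 hI.
pose D := \sum_(z : {ffun 'I_d -> 'I_(N.*2)}) \sum_k 2 * expR (kap * T + (`|corner z 0 k| + 2)).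
have D0 : 0 <= D by do 2 (apply: sumr_ge0 => ? _); rewrite mulr_ge0// expR_ge0.
(* The barrier lives on a box of size [n] chosen after [N], so large that its growth term, summed
   over the [N]-cells, costs at most [e]. *)
pose n := (Num.trunc (M * D / e)).+1.
have n0 : 0 < n%:R :> R by rewrite ltr0n.
have hn : M / n%:R * D <= e.
  rewrite mulrAC ler_pdivrMr// mulrC -ler_pdivrMl// mulrC.
  have : 0 <= M * D / e by rewrite !mulr_ge0 ?invr_ge0 ?(ltW M0) ?(ltW e0).
  by move/truncn_itv => /andP[_ /ltW]; rewrite [e^-1 * _]mulrC.
pose c (z : {ffun 'I_d -> 'I_(N.*2)}) := \sum_(j : {ffun 'I_d -> 'I_(n.*2)})
  expR (kap * T) * expR (3 * d%:R) * cell_sup j *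
    expR (- \sum_k `|corner z 0 k - corner j 0 k|) +
  M / n%:R * \sum_k 2 * expR (kap * T + (`|corner z 0 k| + 2)).
exists c; split => [z|z x y s zx xy /andP[s0 sT]|].
- apply: addr_ge0.
    by apply: sumr_ge0 => j _; rewrite !mulr_ge0 ?expR_ge0 ?cell_sup_ge0.
  rewrite mulr_ge0 ?divr_ge0 ?(ltW M0) ?(ltW n0)//.
  by apply: sumr_ge0 => k _; rewrite mulr_ge0 ?expR_ge0.
- apply: (le_trans (@barrier_dominates n (y, s) isT s0)).
  have yz k : `|y 0 k - corner z 0 k| <= 2.
    rewrite -(subrK (x 0 k) (y 0 k)) -addrA; apply: le_trans (ler_normD _ _) _.
    have := cell_dist zx k; have := xy k; lra.
  have ks : kap * s <= kap * T by rewrite ler_wpM2l.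
  rewrite /barrier /=; apply: lerD.
    apply: ler_sum => j _.
    rewrite mulrAC -expRD [leRHS]mulrAC -!expRD ler_wpM2r ?cell_sup_ge0// ler_expR.
    have h : \sum_k `|corner z 0 k - corner j 0 k| <=
        \sum_k `|y 0 k - corner j 0 k| + 2 * d%:R.
      rewrite (_ : 2 * d%:R = \sum_(k < d) 2 :> R); last first.
        by rewrite sumr_const card_ord mulr_natr.
      rewrite -big_split; apply: ler_sum => k _ /=.
      rewrite -(subrK (y 0 k) (corner z 0 k)) -addrA addrC.
      by apply: le_trans (ler_normD _ _) _; rewrite lerD2l distrC.
    rewrite -/kap; lra.
  apply: ler_wpM2l; first by rewrite divr_ge0 ?(ltW M0) ?(ltW n0).
  apply: ler_sum => k _; rewrite mulr_natl mulr2n -/kap.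
  have := yz k; rewrite ler_norml => /andP[h1 h2].
  have := ler_norm (corner z 0 k); have := ler_norm (- corner z 0 k); rewrite normrN.
  by move=> h3 h4; apply: lerD; rewrite ler_expR; lra.
- rewrite big_split /= -mulr_sumr -/D; apply: lerD => //.
  rewrite exchange_big /=.
  under eq_bigr do rewrite -mulr_sumr.
  apply: (@le_trans _ _ (\sum_(j : {ffun 'I_d -> 'I_(n.*2)})
    expR (kap * T) * expR (3 * d%:R) * 5 ^+ d * cell_sup j)).
    apply: ler_sum => j _; rewrite [leRHS]mulrAC ler_wpM2l ?sum_corner_le//.
    by rewrite !mulr_ge0 ?expR_ge0 ?cell_sup_ge0.
  by rewrite -mulr_sumr ler_wpM2l// !mulr_ge0 ?expR_ge0 ?exprn_ge0.
Qed.

End Tiles.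
End Lattice.

(** * Integrals of nonnegative functions without measurability *)

Section NonmeasurableIntegrands.
Context {disp : measure_display} {X : measurableType disp} {R : realType}.
Variable mu : {measure set X -> \bar R}.
Local Open Scope ereal_scope.
Import HBNNSimple.

(* Measurability is not needed because the integral of a nonnegative function is
   the supremum of the integrals of the simple functions below it. *)
Lemma ge0_le_integral_nomeas (f g : X -> \bar R) :
  (forall x, 0 <= f x) -> (forall x, 0 <= g x) ->
  (forall x, f x <= g x) -> \int[mu]_x f x <= \int[mu]_x g x.
Proof.
move=> f0 g0 fg; rewrite !ge0_integralTE//; apply: le_ereal_sup => _ [h hf <-].
by exists h => // x; exact: le_trans (fg x).
Qed.

(** Monotone convergence is applied to each simple function below [f], which is measurable, and not
    to [f]. *)
Lemma integral_le_exhaustion (f : X -> \bar R) (F : (set X)^nat) (C : \bar R) :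
  (forall x, 0 <= f x) -> nondecreasing_seq F -> (forall n, measurable (F n)) ->
  \bigcup_n F n = setT -> (forall n, \int[mu]_(x in F n) f x <= C) ->
  \int[mu]_x f x <= C.
Proof.
move=> f0 ndF mF FT hC; rewrite ge0_integralTE//; apply: ge_ereal_sup => _ [h hf <-].
rewrite -integralT_nnsfun -FT.
have mh (D : set X) : measurable_fun D (EFin \o h).
  by apply/measurable_EFinP; apply: measurable_funTS.
have hl := ge0_nondecreasing_set_cvg_integral ndF mF (f := EFin \o h) (mu := mu)
  (fun i => mh (F i)).
have {}hl := hl (fun i x _ => ltac:(by rewrite lee_fin)).
rewrite -(cvg_lim _ hl)//; apply: lime_le; first by apply/cvg_ex; eexists; exact: hl.
apply: nearW => n; apply: le_trans (hC n).
rewrite integral_mkcond [leRHS]integral_mkcond; apply: ge0_le_integral_nomeas => x.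
- by rewrite patchE; case: ifP => // _; rewrite lee_fin.
- by rewrite patchE; case: ifP.
- by rewrite !patchE; case: ifP => _; [exact: hf|].
Qed.

End NonmeasurableIntegrands.

(** * Integrals over space compared with sums over unit cells *)

Section CellMeasure.
Context {R : realType} {d : nat}.
Local Notation mR := (measurableTypeR R).
Local Notation row := (fun t : d.-tuple mR => \row_i tnth t i : 'rV[R]_d).

Definition box n : set (d.-tuple mR) := [set t | forall i, - n%:R <= tnth t i < n%:R].

Lemma measurable_tuple_box (A : 'I_d -> set mR) : (forall i, measurable (A i)) ->
  measurable [set t : d.-tuple mR | forall i, A i (tnth t i)].
Proof.
move=> mA; rewrite (_ : mkset _ =
    \bigcap_(i in [set: 'I_d]) ((fun t => tnth t i) @^-1` A i)); last first.
  by apply/seteqP; split => t /= tA i => [_|]; exact: tA.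
apply: fin_bigcap_measurable => // i _.
by rewrite -[X in measurable X]setTI; exact: measurable_tnth.
Qed.

Lemma cell_tupleE N (j : {ffun 'I_d -> 'I_(N.*2)}) :
  row @^-1` cell j =
  [set t : d.-tuple mR | forall i, `[corner j 0 i, corner j 0 i + 1[%classic (tnth t i)].
Proof.
have rE (t : d.-tuple mR) i : (\row_i tnth t i : 'rV[R]_d) 0 i = tnth t i by rewrite mxE.
by apply/seteqP; split => t /= jt i; have := jt i; rewrite /= in_itv /= rE.
Qed.

Lemma measurable_cell N (j : {ffun 'I_d -> 'I_(N.*2)}) : measurable (row @^-1` cell j).
Proof.
rewrite cell_tupleE.
by apply: (measurable_tuple_box (A := fun i => `[corner j 0 i, corner j 0 i + 1[%classic)).
Qed.

Lemma measure_cell N (j : {ffun 'I_d -> 'I_(N.*2)}) :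
  lebesgue_tuple (row @^-1` cell j) = 1%E.
Proof.
rewrite cell_tupleE.
rewrite (lebesgue_tuple_box (A := fun i => `[corner j 0 i, corner j 0 i + 1[%classic))//.
rewrite big1// => i _; rewrite lebesgue_measure_itv /= lte_fin ltrDl ltr01.
by rewrite -EFinD addrAC subrr add0r.
Qed.

Lemma measurable_box n : measurable (box n).
Proof.
rewrite (_ : box n = [set t : d.-tuple mR | forall i,
    `[- n%:R, n%:R[%classic (tnth t i)]).
  by apply: (measurable_tuple_box (A := fun=> `[- n%:R, n%:R[%classic)).
by apply/seteqP; split => t /= jt i; have := jt i; rewrite /= in_itv.
Qed.

Lemma box_nondecreasing : nondecreasing_seq box.
Proof.
move=> m n mn; apply/subsetPset => t h i; have /andP[h1 h2] := h i.
have mn' : m%:R <= n%:R :> R by rewrite ler_nat.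
by rewrite (le_trans _ h1) ?lerN2//= (lt_le_trans h2).
Qed.

Lemma bigcup_box : \bigcup_n box n = setT.
Proof.
apply/seteqP; split => // t _.
exists (\max_i (Num.trunc `|tnth t i|).+1)%N => // i.
have h : `|tnth t i| < (\max_i (Num.trunc `|tnth t i|).+1)%N%:R.
  have /andP[_ h] := truncn_itv (normr_ge0 (tnth t i)).
  by apply: lt_le_trans h _; rewrite ler_nat (leq_bigmax i).
by move: h; rewrite ltr_norml => /andP[h1 h2]; rewrite ltW.
Qed.

Lemma integral_step N (c : {ffun 'I_d -> 'I_(N.*2)} -> R) : (forall j, 0 <= c j) ->
  (\int[@lebesgue_tuple R d]_t (\sum_j (c j)%:E * (\1_(row @^-1` cell j) t)%:E) =
   (\sum_j c j)%:E)%E.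
Proof.
move=> c0; have mind j : measurable_fun setT
    (fun t => (\1_(row @^-1` @cell R d N j) t)%:E : \bar R).
  by apply/measurable_EFinP; apply: measurable_indic; exact: measurable_cell.
rewrite ge0_integral_sum//.
- rewrite -sumEFin; apply: eq_bigr => j _.
  rewrite ge0_integralZl//; first last.
  + by rewrite lee_fin.
  + rewrite integral_indic//; last by apply: (@measurable_cell N j).
    by rewrite setIT [X in (_ * X)%E](@measure_cell N j) mule1.
- by move=> j; apply: measurable_funeM.
- by move=> j t _; rewrite mule_ge0// lee_fin.
Qed.

Lemma sum_cellE N (c : {ffun 'I_d -> 'I_(N.*2)} -> R) j t : cell j (row t) ->
  (\sum_k (c k)%:E * (\1_(row @^-1` cell k) t)%:E = (c j)%:E :> \bar R)%E.
Proof.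
move=> jt; rewrite (bigD1 j)//= big1 ?adde0 => [|k kj].
  by rewrite indicE mem_set// mule1.
rewrite indicE memNset ?mule0//= => kt; case/eqP: kj; exact: cell_inj kt jt.
Qed.

Lemma sum_cell0 N (c : {ffun 'I_d -> 'I_(N.*2)} -> R) t :
  ~ (exists j : {ffun 'I_d -> 'I_(N.*2)}, cell j (row t)) ->
  (\sum_(k : {ffun 'I_d -> 'I_(N.*2)})
    (c k)%:E * (\1_(row @^-1` cell k) t)%:E = 0 :> \bar R)%E.
Proof.
move=> h; rewrite big1// => k _; rewrite indicE memNset ?mule0// => kt.
by apply: h; exists k.
Qed.

Lemma integral_Rd_ge_cells (G : 'rV[R]_d -> \bar R) N (c : {ffun 'I_d -> 'I_(N.*2)} -> R) :
  (forall j, 0 <= c j) -> (forall x, 0 <= G x)%E ->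
  (forall j x, cell j x -> (c j)%:E <= G x)%E ->
  ((\sum_j c j)%:E <= integral_Rd G)%E.
Proof.
move=> c0 G0 cG; rewrite -integral_step//; apply: ge0_le_integral_nomeas => [t|t|t].
- by apply: sume_ge0 => j _; rewrite mule_ge0 ?lee_fin.
- exact: G0.
have [[j jt]|h] := pselect (exists j : {ffun 'I_d -> 'I_(N.*2)}, cell j (row t)).
  by rewrite (sum_cellE c jt) cG.
by rewrite sum_cell0.
Qed.

(** On each box, [F] lies below a step function on the cells; the error [e] may depend on the step
    function, since only the bound [C] has to be common to all boxes. *)
Lemma integral_Rd_le_cells (F : 'rV[R]_d -> \bar R) (C : R) : (forall x, 0 <= F x)%E ->
  (forall N e, 0 < e -> exists c : {ffun 'I_d -> 'I_(N.*2)} -> R,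
    [/\ forall j, 0 <= c j, forall j x, cell j x -> (F x <= (c j)%:E)%E &
        \sum_j c j <= C + e]) ->
  (integral_Rd F <= C%:E)%E.
Proof.
move=> F0 hF; apply: (integral_le_exhaustion (F := box)).
- by move=> t; exact: F0.
- exact: box_nondecreasing.
- exact: measurable_box.
- exact: bigcup_box.
move=> N; apply/lee_addgt0Pr => e e0; have [c [c0 cF cC]] := hF N e e0.
apply: (@le_trans _ _ (\sum_j c j)%:E); last by rewrite -EFinD lee_fin.
rewrite -integral_step// integral_mkcond; apply: ge0_le_integral_nomeas => t.
- by rewrite patchE; case: ifP.
- by apply: sume_ge0 => j _; rewrite mule_ge0 ?lee_fin.
rewrite patchE; case: ifPn => [/set_mem tN|_]; last first.
  by apply: sume_ge0 => j _; rewrite mule_ge0 ?lee_fin.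
have [|j jt] := @cell_cover R d N (row t); first by move=> i; rewrite mxE; exact: tN.
by rewrite (sum_cellE c jt) cF.
Qed.

End CellMeasure.

(** * Coefficient bounds, and assembly of the estimate *)

Section Norms.
Context {R : realType}.

Lemma bounded_le (T : Type) (W : normedModType R) (D : set T) (f : T -> W) :
  [bounded f x | x in D] -> exists M, forall x, D x -> `|f x| <= M.
Proof.
move=> [M [_ h]]; exists (M + 1) => x Dx.
by apply: (h (M + 1)) => //; rewrite ltrDl.
Qed.

Lemma sup_norm_ge (E : Type) (W : normedModType R) (f : E -> W) M xi :
  (forall x, `|f x| <= M) -> `|f xi| <= sup_norm f.
Proof.
move=> fM; apply: sup_upper_bound; last by exists xi.
by split; [exists `|f xi|, xi|exists M => _ [x _ <-]].
Qed.

(** This serves to know that [a] is bounded, so that [sup_norm a] is a genuine supremum; the value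
    of the bound does not enter the final constant. *)
Lemma covariance_bound d K (s : 'M[R]_(d, K)) (B : R) : `|s| <= B ->
  `|s *m s^T| <= K%:R * B ^+ 2.
Proof.
move=> sB; have B0 : 0 <= B by exact: le_trans sB.
apply: mx_norm_le => [|i j]; first by rewrite mulr_ge0// sqr_ge0.
rewrite mxE; apply: le_trans (ler_norm_sum _ _ _) _.
apply: (@le_trans _ _ (\sum_(l < K) B ^+ 2)); last first.
  by rewrite sumr_const card_ord mulr_natl.
apply: ler_sum => l _; rewrite mxE normrM expr2.
by apply: ler_pM => //; apply: le_trans sB; exact: mx_coord_le.
Qed.

End Norms.

Theorem theorem35 (R : realType) (d : nat) (hd : (0 < d)%N) :
  exists C : R -> R -> R -> R,
    (forall norm_a norm_b T : R, 0 <= C norm_a norm_b T) /\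
    forall (K : nat) (hK : (0 < K)%N)
      (E : Type) (hE : inhabited E)
      (b : E -> 'rV[R]_d) (hb : [bounded b xi | xi in [set: E]])
      (sigma : E -> 'M[R]_(d, K)) (hsigma : [bounded sigma xi | xi in [set: E]])
      (a : E -> 'M[R]_d) (ha : forall xi, a xi = sigma xi *m (sigma xi)^T)
      (T : R) (hT : 0 <= T)
      (phi psi : 'rV[R]_d * R -> R)
      (hphi_bd : [bounded phi p | p in halfspace])
      (hphi : viscosity_subsolution b a phi)
      (hpsi_bd : [bounded psi p | p in halfspace])
      (hpsi : viscosity_supersolution b a psi),
      (integral_Rd (fun x : 'rV[R]_d =>
         ereal_sup (env_gap phi psi @` (closed_unit_cube x `*` `[0%R, T])%classic))
       <= (C (sup_norm a) (sup_norm b) T)%:E *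
          integral_Rd (fun x : 'rV[R]_d =>
            ereal_sup ((fun y => env_gap phi psi (y, 0%R)) @` closed_unit_cube x)))%E.
Proof.
exists (fun A Bb T => expR (kappa (d := d) Bb A * T) * expR (3 * d%:R) * 5 ^+ d).
split=> [A Bb T|]; first by rewrite !mulr_ge0 ?expR_ge0 ?exprn_ge0.
move=> K hK E hE b hb sigma hsigma a ha T hT phi psi hphi_bd hphi hpsi_bd hpsi.
have [M1 hM1] := bounded_le hphi_bd; have [M2 hM2] := bounded_le hpsi_bd.
have [N1 hN1] := bounded_le hb; have [S2 hS2] := bounded_le hsigma.
(* The 1 keeps [M] positive even if both functions vanish. *)
pose M := Num.max (Num.max M1 M2) 1.
have M0 : 0 < M by rewrite lt_max ltr01 orbT.
have M20 : 0 < 2 * M by rewrite mulr_gt0.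
have phiM (p : 'rV[R]_d * R) : halfspace p -> `|phi p| <= M.
  by move=> hp; rewrite !le_max hM1.
have psiM (p : 'rV[R]_d * R) : halfspace p -> `|psi p| <= M.
  by move=> hp; rewrite !le_max hM2 ?orbT.
have npsiM (p : 'rV[R]_d * R) : halfspace p -> `|- psi p| <= M.
  by move=> hp; rewrite normrN psiM.
have [xi0] := hE.
have aN xi : `|a xi| <= K%:R * S2 ^+ 2 by rewrite ha covariance_bound// hS2.
have b_bound xi k : `|b xi 0 k| <= sup_norm b.
  apply: le_trans (mx_coord_le _ _ _) _.
  by apply: (sup_norm_ge (M := N1)) => x; exact: hN1.
have a_bound xi k m : `|a xi k m| <= sup_norm a.
  by apply: le_trans (mx_coord_le _ _ _) _; exact: sup_norm_ge aN.
have b0 : 0 <= sup_norm b.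
  by apply: le_trans (normr_ge0 (b xi0)) _; apply: (sup_norm_ge (M := N1)) => x; exact: hN1.
have a0 : 0 <= sup_norm a by exact: le_trans (normr_ge0 (a xi0)) (sup_norm_ge _ aN).
pose u := uenv phi; pose w := uenv (fun q => - psi q).
pose v p := u p + w p.
have gapE p : halfspace p -> env_gap phi psi p = (Num.max (v p) 0)%:E.
  move=> hp; rewrite /env_gap lsc_envE (uenvE phiM hp) (uenvE npsiM hp) oppeK.
  by rewrite -EFinD EFin_max.
have v_le p : 0 <= p.2 -> v p <= 2 * M.
  move=> hp; have := uenv_bound phiM hp; have := uenv_bound npsiM hp.
  by rewrite !ler_norml /v /u /w => /andP[_ ?] /andP[_ ?]; lra.
have cmp (S : 'rV[R]_d * R -> R) (rho : R) : continuous S -> (forall p, 0 <= S p) ->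
    (forall p : 'rV[R]_d * R, p.2 = 0 -> v p <= S p) ->
    (forall p : 'rV[R]_d * R, 0 <= p.2 -> rho < `|p.1| -> 2 * M <= S p) ->
    supersol b a S -> forall p : 'rV[R]_d * R, 0 <= p.2 -> v p <= S p.
  move=> S_cont S_ge0 S_init S_far S_super p hp.
  have aE : a = fun xi => sigma xi *m (sigma xi)^T by apply/funext.
  apply: (@sum_subsolutions_le R d u w S M rho M0 (uenv_bound phiM) (uenv_bound npsiM)
    _ _ S_cont S_init S_ge0 S_far E K b sigma (sup_norm b) (sup_norm a)) => //.
  - by move=> q hq e; exact: uenv_usc phiM q e hq.
  - by move=> q hq e; exact: uenv_usc npsiM q e hq.
  - by move=> xi k; rewrite -ha.
  - by rewrite -aE; exact: viscosity_jet_subsolution phiM hphi.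
  - by move=> xi; rewrite -ha; exact: viscosity_jet_supersolution psiM hpsi.
  - by move=> q; have [l [B [j h]]] := S_super q; exists l, B; split => // xi; rewrite -ha.
set G := fun x : 'rV[R]_d => ereal_sup ((fun y => env_gap phi psi (y, 0)) @` closed_unit_cube x).
have gap_ge0 p : (0 <= env_gap phi psi p)%E by rewrite le_max lexx orbT.
have cubexx (x : 'rV[R]_d) : closed_unit_cube x x by move=> i; rewrite subrr normr0.
have G0 x : (0 <= G x)%E.
  by apply: le_trans (gap_ge0 (x, 0)) _; apply: ereal_sup_ubound; exists x.
have : (0 <= integral_Rd G)%E by apply: integral_ge0 => t _; exact: G0.
case IE : (integral_Rd G) => [I| |]// _; last first.
  (* An infinite right-hand integral is multiplied by a positive constant, so the estimate is
     trivial. *)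
  by rewrite gt0_muley ?leey// lte_fin !mulr_gt0 ?expR_gt0 ?exprn_gt0.
have cell_sup_le n : \sum_(j : {ffun 'I_d -> 'I_(n.*2)}) cell_sup v j <= I.
  rewrite -lee_fin -IE; apply: integral_Rd_ge_cells => // [j|j x jx].
    exact: (cell_sup_ge0 M20 v_le).
  have := G0 x; case GE : (G x) => [r| |]//= r0; last by rewrite leey.
  rewrite lee_fin; apply: (cell_sup_lub M20 v_le) => y jy.
  rewrite -lee_fin -GE -gapE; last by rewrite /halfspace/=.
  by apply: ereal_sup_ubound; exists y => //; exact: cell_sub jx y jy.
rewrite -EFinM; apply: integral_Rd_le_cells => [x|N e e0].
  apply: le_trans (gap_ge0 (x, 0)) _; apply: ereal_sup_ubound; exists (x, 0) => //=.
  by split => //=; rewrite in_itv /= lexx.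
have [c [c0 vc cI]] := tiles_bound b0 a0 b_bound a_bound M20 v_le cmp N hT e0 cell_sup_le.
exists c; split => // j x jx; apply: ge_ereal_sup => _ [[y s] [/= xy]] /[!in_itv]/= sT <-.
rewrite gapE; last by case/andP: sT.
by rewrite lee_fin ge_max c0 andbT; exact: (vc j x).
Qed.
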